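(* Let $F\colon \mathcal{H}\to\mathcal{G}$ be a weak equivalence of Lie groupoids and let $\mathcal{E}$ be a sheaf of complexes on the big site. Then the induced morphism of cosimplicial complexes $\mathcal{E}_F\colon \mathcal{E}(\mathcal{G})\to\mathcal{E}(\mathcal{H})$ induces an isomorphism in cohomology; in particular $$H(\mathcal{E}(\mathcal{G}))\cong H(\mathcal{E}(\mathcal{H})).$$
   Context: **Lie groupoids.** A Lie groupoid $\mathcal{G}$ is a groupoid whose objects $\mathcal{G}_0$ and arrows $\mathcal{G}_1$ are smooth manifolds ($\mathcal{G}_1$ might not be Hausdorff), with smooth structure maps and with source $\mathbf{s}$ and target $\mathbf{t}\colon\mathcal{G}_1\to\mathcal{G}_0$ submersions; $u\colon \mathcal{G}_0\to\mathcal{G}_1$ is the unit. The product $g_2g_1$ is defined when $\mathbf{s}(g_2)=\mathbf{t}(g_1)$. Put $\mathcal{G}^{(0)}=\mathcal{G}_0$ and, for $n\ge1$, $\mathcal{G}^{(n)}=\{(g_n,\dots,g_1): \mathbf{s}(g_{i+1})=\mathbf{t}(g_i)\}$. The nerve has face maps $d^n_i\colon\mathcal{G}^{(n)}\to\mathcal{G}^{(n-1)}$, $0\le i\le n$: for $n=1$, $d^1_0=\mathbf{t}$, $d^1_1=\mathbf{s}$; for $n\ge 2$, $d^n_0$ drops $g_1$, $d^n_n$ drops $g_n$, and $d^n_i$ for $0<i<n$ replaces $g_{i+1},g_i$ by $g_{i+1}g_i$. The degeneracy maps $s^n_i\colon\mathcal{G}^{(n)}\to\mathcal{G}^{(n+1)}$,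 $0\le i\le n$, insert a unit between $g_{i+1}$ and $g_i$ (at the ends for $i=0,n$). **Weak equivalence.** A homomorphism $F\colon\mathcal{H}\to\mathcal{G}$ is a smooth functor $(F_1,F_0)$. It is a weak equivalence if (i) the map $\{(g,x)\in \mathcal{G}_1\times\mathcal{H}_0:\mathbf{s}(g)=F_0(x)\}\to\mathcal{G}_0$, $(g,x)\mapsto\mathbf{t}(g)$, is a surjective submersion, and (ii) the map $h\mapsto(\mathbf{t}(h),F_1(h),\mathbf{s}(h))$ is an isomorphism of Lie groupoids from $\mathcal{H}$ onto the pullback groupoid $F_0^!\mathcal{G}$ with objects $\mathcal{H}_0$, arrows $\{(x,g,y)\in \mathcal{H}_0\times\mathcal{G}_1\times\mathcal{H}_0: F_0(x)=\mathbf{t}(g),\ \mathbf{s}(g)=F_0(y)\}$, target $x$, source $y$, and multiplication $(x,g,y)(y,h,z)=(x,gh,z)$. **Comorphisms.** Let $\mathcal{W}$ be a sheaf of $C^\infty_N$-modules on $N$ and $\mathcal{E}$ a sheaf of $C^\infty_M$-modules on $M$. A comorphism from $\mathcal{W}$ to $\mathcal{E}$ over a smooth map $f\colon M\to N$ is a morphism of $C^\infty_M$-modules $f^*\mathcal{W}\to\mathcal{E}$; equivalently, a family of linear maps $\Phi\colon\mathcal{W}(V)\to\mathcal{E}(f^{-1}(V))$, $V\subseteq N$ open, compatible with restrictions and satisfying $\Phi(a e)=(a\circ f)\,\Phi(e)$ for $a\in C^\infty(V)$. **Big site.** A big site sheaf of modules is a sheaf on the site of smooth manifolds with values in modules and comorphisms: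 it assigns to each smooth manifold $M$ a sheaf $\mathcal{E}_M$ of $C^\infty_M$-modules and, functorially, to each smooth map $f\colon M\to N$ a comorphism from $\mathcal{E}_N$ to $\mathcal{E}_M$ over $f$ (which is restriction when $f$ is the inclusion of an open set). A sheaf of complexes on the big site is a graded family $(\mathcal{E}^k)_{k\in\mathbb{N}}$ of big site sheaves of modules together with $\mathbb{R}$-linear sheaf maps $d_N\colon\mathcal{E}^k_M\to\mathcal{E}^{k+1}_M$ with $d_N^2=0$ that commute with all the comorphisms induced by smooth maps (for example differential forms with the de Rham differential). **The complex and its cohomology.** For a Lie groupoid $\mathcal{G}$, $\mathcal{E}(\mathcal{G})=\mathcal{E}_{\mathcal{G}}$ is the cosimplicial complex with $\mathcal{E}_\mathcal{G}^{n,k}=\mathcal{E}^k_{\mathcal{G}^{(n)}}$, whose coface and codegeneracy maps are the comorphisms induced by $d^n_i$ and $s^n_i$. Taking global sections gives a double complex with differentials $d_N$ (raising $k$) and $\delta=\sum_{i=0}^{n+1}(-1)^i\phi^{n+1}_i$ (raising $n$), where $\phi^{n+1}_i$ is induced by $d^{n+1}_i$. Its cohomology $H(\mathcal{E}(\mathcal{G}))$ is the cohomology of the total complex $\bigoplus_{n+k=\bullet}\mathcal{E}^k(\mathcal{G}^{(n)})$ with differential $\delta+(-1)^n d_N$. The morphism $\mathcal{E}_F$ is induced by the maps $F^{(n)}\colon\mathcal{H}^{(n)}\to\mathcal{G}^{(n)}$. *)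

(* Defs.v *)
From HB Require Import structures.
From mathcomp Require Import all_boot all_order all_algebra.
From mathcomp Require Import all_classical all_reals all_analysis.

Set Implicit Arguments.
Unset Strict Implicit.
Unset Printing Implicit Defensive.

Import Order.TTheory GRing.Theory Num.Theory.
Import numFieldNormedType.Exports.

Local Open Scope classical_set_scope.
Local Open Scope ring_scope.

Section SmoothOnRn.
Context {R : realType}.

(* C^k regularity on [U] (meant for open [U]) through continuity of the
   iterated partial derivatives. *)
Fixpoint Ck (k n : nat) (U : set 'rV[R]_n) (f : 'rV[R]_n -> R) : Prop :=
  (forall x, U x -> {for x, continuous f}) /\
  if k is k'.+1 then
    forall i : 'I_n, (forall x, U x -> derivable f x (delta_mx 0 i)) /\
      Ck k' U (fun x => derive f x (delta_mx 0 i))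
  else True.

Definition smooth_near (n : nat) (x : 'rV[R]_n) (f : 'rV[R]_n -> R) : Prop :=
  exists U : set 'rV[R]_n, [/\ open U, U x & forall k, Ck k U f].

End SmoothOnRn.

(* A space with a structure sheaf of real functions: [smooth_germ x a] says that
   [a] is smooth in a neighbourhood of [x], whatever its values elsewhere.
   Manifolds are the spaces locally isomorphic to open subsets of R^n with their
   smooth functions, see [manifold]. *)
Record smoothSpace (R : realType) := SmoothSpace {
  points :> topologicalType;
  smooth_germ : points -> (points -> R) -> Prop }.

Section Manifolds.
Context {R : realType}.
Implicit Types M N : smoothSpace R.

Definition smooth_on M (U : set M) (a : M -> R) : Prop :=
  forall x, U x -> smooth_germ x a.

(* [phi] is a diffeomorphism from [U] onto an open subset of R^n, with inverse
   [psi]; outside [U] and [phi @` U] these two functions are arbitrary. *)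
Record chart M (n : nat) (U : set M) (phi : M -> 'rV[R]_n)
    (psi : 'rV[R]_n -> M) : Prop := Chart {
  chart_open : open U;
  chart_open_im : open (phi @` U);
  chartK : forall x, U x -> psi (phi x) = x;
  chart_continuous : forall x, U x -> {for x, continuous phi};
  chart_inv_continuous : forall x, U x -> {for phi x, continuous psi};
  chart_smooth : forall x, U x -> forall a : M -> R,
    smooth_germ x a <-> smooth_near (phi x) (a \o psi) }.

(* Not necessarily Hausdorff; the dimension is locally constant. *)
Definition manifold M : Prop :=
  @second_countable M /\
  forall x : M, exists n (U : set M) (phi : M -> 'rV[R]_n) psi,
    chart U phi psi /\ U x.

Definition smooth M N (f : M -> N) : Prop :=
  continuous f /\
  forall x (a : N -> R), smooth_germ (f x) a -> smooth_germ x (a \o f).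

Definition diffeomorphism M N (f : M -> N) : Prop :=
  smooth f /\ exists g : N -> M, [/\ cancel f g, cancel g f & smooth g].

Definition submersion M N (f : M -> N) : Prop :=
  smooth f /\
  forall x : M, exists m n (U : set M) (V : set N)
      (phi : M -> 'rV[R]_m) psi (phi' : N -> 'rV[R]_n) psi',
    [/\ chart U phi psi, U x, chart V phi' psi', V (f x) &
      forall w : 'rV[R]_n, exists v : 'rV[R]_m,
        'd (phi' \o f \o psi) (phi x) v = w].

(* The initial structure for the maps [pi i]: the coarsest topology making them
   continuous, and as smooth functions the smooth functions of finitely many
   pullbacks of smooth functions. It is the product structure when the [pi i]
   are the projections of a finite product of manifolds, and the induced
   structure when [pi] is the inclusion of an embedded submanifold. *)
Section Initial.
Variables (I : Type) (M : I -> smoothSpace R) (S : Type).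
Variable (pi : forall i, S -> M i).

Definition initial_points : topologicalType :=
  initial_topology
    ((fun p i => pi i p) : {classic S} -> prod_topology (fun i => M i)).

Definition initial_germ (p : initial_points) (f : initial_points -> R) : Prop :=
  exists k (idx : 'I_k -> I) (a : forall j : 'I_k, M (idx j) -> R)
      (g : 'rV[R]_k -> R),
    [/\ forall j, smooth_germ (pi (idx j) p) (a j),
        smooth_near (\row_j a j (pi (idx j) p)) g &
        \forall q \near p, f q = g (\row_j a j (pi (idx j) q))].

Definition initial_space : smoothSpace R := SmoothSpace initial_germ.

End Initial.

Definition subspaceS M (P : M -> Prop) : smoothSpace R :=
  @initial_space unit (fun=> M) {x : M | P x} (fun=> sval).

Definition prodS M N : smoothSpace R :=
  @initial_space bool (fun b => if b then M else N) (M * N)%type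
    (fun b => match b with true => fst | false => snd end).

Definition powS M (n : nat) : smoothSpace R :=
  @initial_space 'I_n (fun=> M) ('I_n -> M) (fun i p => p i).

Definition fibre_product M N Q (f : M -> Q) (g : N -> Q) : smoothSpace R :=
  @subspaceS (prodS M N) (fun p : M * N => f p.1 = g p.2).

End Manifolds.

Record groupoid (R : realType) := Groupoid {
  obj : smoothSpace R;
  arr : smoothSpace R;
  src : arr -> obj;
  tgt : arr -> obj;
  gunit : obj -> arr;
  ginv : arr -> arr;
  mul : forall g h : arr, src g = tgt h -> arr;
  src_mul : forall g h e, src (@mul g h e) = src h;
  tgt_mul : forall g h e, tgt (@mul g h e) = tgt g;
  src_unit : forall x, src (gunit x) = x;
  tgt_unit : forall x, tgt (gunit x) = x;
  src_inv : forall g, src (ginv g) = tgt g;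
  tgt_inv : forall g, tgt (ginv g) = src g;
  gmulA : forall g h k e1 e2 e3 e4,
    @mul g (@mul h k e2) e3 = @mul (@mul g h e1) k e4;
  gmul1l : forall g e, @mul (gunit (tgt g)) g e = g;
  gmul1r : forall g e, @mul g (gunit (src g)) e = g;
  gmulVl : forall g e, @mul (ginv g) g e = gunit (src g);
  gmulVr : forall g e, @mul g (ginv g) e = gunit (tgt g) }.

Arguments src {R g} _ : rename.
Arguments tgt {R g} _ : rename.
Arguments gunit {R g} _ : rename.
Arguments ginv {R g} _ : rename.
Arguments mul {R g} _ _ _ : rename.

Section Groupoids.
Context {R : realType}.
Implicit Types G H : groupoid R.

Record is_lie G : Prop := IsLie {
  lie_obj : manifold (obj G);
  lie_arr : manifold (arr G);
  lie_obj_hausdorff : hausdorff_space (obj G);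
  lie_src : submersion (@src R G);
  lie_tgt : submersion (@tgt R G);
  lie_unit : smooth (@gunit R G);
  lie_inv : smooth (@ginv R G);
  lie_mul : @smooth R (fibre_product (@src R G) (@tgt R G)) (arr G)
    (fun p => mul (sval p).1 (sval p).2 (svalP p)) }.

Record is_hom H G (F0 : obj H -> obj G) (F1 : arr H -> arr G) : Prop := IsHom {
  hom_smooth0 : smooth F0;
  hom_smooth1 : smooth F1;
  hom_src : forall h, src (F1 h) = F0 (src h);
  hom_tgt : forall h, tgt (F1 h) = F0 (tgt h);
  hom_unit : forall x, F1 (gunit x) = gunit (F0 x);
  hom_mul : forall h k e e', F1 (mul h k e) = mul (F1 h) (F1 k) e' }.

Record homomorphism H G := Homomorphism {
  hom0 : obj H -> obj G;
  hom1 : arr H -> arr G;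
  homP : is_hom hom0 hom1 }.

Definition is_iso H G (F0 : obj H -> obj G) (F1 : arr H -> arr G) : Prop :=
  [/\ is_hom F0 F1, diffeomorphism F0 & diffeomorphism F1].

Lemma mul_irr G (g h g' h' : arr G) e e' :
  g = g' -> h = h' -> mul g h e = mul g' h' e'.
Proof. by move=> eg eh; subst g' h'; congr mul; exact: Prop_irrelevance. Qed.

Section Pullback.
Variables (X : smoothSpace R) (G : groupoid R) (f : X -> obj G).

Definition pb_cond (p : (X * arr G) * X) : Prop :=
  f p.1.1 = tgt p.1.2 /\ src p.1.2 = f p.2.

Definition pb_arr : smoothSpace R :=
  @subspaceS R (prodS (prodS X (arr G)) X) pb_cond.

Lemma pb_eq (p q : pb_arr) : sval p = sval q -> p = q.
Proof. by move: p q => [p pP] [q qP] /= e; exact: eq_exist. Qed.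

Definition pb_src (p : pb_arr) : X := (sval p).2.
Definition pb_tgt (p : pb_arr) : X := (sval p).1.1.

Lemma pb_unit_subproof (x : X) : pb_cond (x, gunit (f x), x).
Proof. by split; rewrite /= ?tgt_unit ?src_unit. Qed.
Definition pb_unit (x : X) : pb_arr := exist _ _ (pb_unit_subproof x).

Lemma pb_inv_subproof (p : pb_arr) :
  pb_cond ((sval p).2, ginv (sval p).1.2, (sval p).1.1).
Proof. by case: p => -[[x g] y] [/= e1 e2]; split; rewrite /= ?tgt_inv ?src_inv. Qed.
Definition pb_inv (p : pb_arr) : pb_arr := exist _ _ (pb_inv_subproof p).

Lemma pb_comp (p q : pb_arr) :
  pb_src p = pb_tgt q -> src (sval p).1.2 = tgt (sval q).1.2.
Proof.
rewrite /pb_src /pb_tgt.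
case: p q => -[[x g] y] [/= _ ->] [[[y' h] z] [/= e1 _]] /= e.
by rewrite e.
Qed.

Lemma pb_mul_subproof (p q : pb_arr) (e : pb_src p = pb_tgt q) :
  pb_cond ((sval p).1.1, mul (sval p).1.2 (sval q).1.2 (pb_comp e), (sval q).2).
Proof.
by split; rewrite /= ?tgt_mul ?src_mul; [case: (svalP p) | case: (svalP q)].
Qed.
Definition pb_mul (p q : pb_arr) (e : pb_src p = pb_tgt q) : pb_arr :=
  exist _ _ (pb_mul_subproof e).

Definition pullback_groupoid : groupoid R.
Proof.
apply: (@Groupoid R X pb_arr pb_src pb_tgt pb_unit pb_inv pb_mul) => //.
- move=> g h k e1 e2 e3 e4; apply: pb_eq => /=; congr (_, _, _); exact: gmulA.
- case=> -[[x g] y] gP e; apply: pb_eq => /=; congr (_, _, _).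
  have ee : src (gunit (tgt g)) = tgt g by rewrite src_unit.
  by rewrite -[RHS](gmul1l (g := g) ee); apply: mul_irr => //=; rewrite (proj1 gP).
- case=> -[[x g] y] gP e; apply: pb_eq => /=; congr (_, _, _).
  have ee : src g = tgt (gunit (src g)) by rewrite tgt_unit.
  by rewrite -[RHS](gmul1r (g := g) ee); apply: mul_irr => //=; rewrite (proj2 gP).
- case=> -[[x g] y] gP e; apply: pb_eq => /=; congr (_, _, _).
  have ee : src (ginv g) = tgt g by rewrite src_inv.
  rewrite (mul_irr _ ee) //.
  by rewrite gmulVl (proj2 gP).
- case=> -[[x g] y] gP e; apply: pb_eq => /=; congr (_, _, _).
  have ee : src g = tgt (ginv g) by rewrite tgt_inv.
  rewrite (mul_irr _ ee) //.
  by rewrite gmulVr (proj1 gP).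
Defined.

End Pullback.

Lemma to_pullback_subproof H G (F : homomorphism H G) (h : arr H) :
  pb_cond (hom0 F) (tgt h, hom1 F h, src h).
Proof. by case: (homP F) => _ _ hs ht _ _; split; rewrite /= ?hs ?ht. Qed.

Definition to_pullback H G (F : homomorphism H G) (h : arr H) :
    arr (pullback_groupoid (hom0 F)) :=
  exist _ (tgt h, hom1 F h, src h) (to_pullback_subproof F h).

Definition weak_equivalence H G (F : homomorphism H G) : Prop :=
  let ev (p : fibre_product (@src R G) (hom0 F)) : obj G := tgt (sval p).1 in
  [/\ range ev = setT, submersion ev &
      @is_iso H (pullback_groupoid (hom0 F)) id (to_pullback F)].

(* The string (g_n, ..., g_1) is represented by the function [g] on 'I_n with
   [g i] being the arrow g_(i+1). *)
Definition composable G n (g : 'I_n -> arr G) : Prop :=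
  forall i j : 'I_n, j = i.+1 :> nat -> src (g j) = tgt (g i).

Definition nerve G (n : nat) : smoothSpace R :=
  if n is m.+1 then @subspaceS R (powS (arr G) m.+1) (@composable G m.+1)
  else obj G.

Definition face_fun G m (g : 'I_m.+2 -> arr G) (gP : composable g)
    (i : 'I_m.+3) (j : 'I_m.+1) : arr G :=
  if (j.+1 < i)%N then g (widen_ord (leqnSn _) j)
  else if j.+1 == i then
    mul (g (lift ord0 j)) (g (widen_ord (leqnSn _) j))
      (gP (widen_ord (leqnSn _) j) (lift ord0 j) (lift0 j))
  else g (lift ord0 j).

Lemma face_composable G m (g : 'I_m.+2 -> arr G) (gP : composable g)
  (i : 'I_m.+3) : composable (face_fun gP i).
Proof.
have srcE (j : 'I_m.+1) : src (face_fun gP i j) =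
    if (j.+1 < i)%N || (j.+1 == i) then src (g (widen_ord (leqnSn _) j))
    else src (g (lift ord0 j)).
  by rewrite /face_fun; case: ltnP => //= _; case: eqP => // _; rewrite src_mul.
have tgtE (j : 'I_m.+1) : tgt (face_fun gP i j) =
    if (j.+1 < i)%N then tgt (g (widen_ord (leqnSn _) j))
    else tgt (g (lift ord0 j)).
  by rewrite /face_fun; case: ltnP => //= _; case: eqP => // _; rewrite tgt_mul.
move=> j k kj; rewrite srcE tgtE kj.
rewrite orbC -leq_eqVlt; case: ifP => _; apply: (gP _ _ _); first exact: kj.
by rewrite !lift0 kj.
Qed.

(* d^(n+1)_i, from strings of length n+1 to strings of length n *)
Definition face G (n : nat) : 'I_n.+2 -> nerve G n.+1 -> nerve G n :=
  match n with
  | 0 => fun i p => if i == ord0 then tgt (sval p ord0) else src (sval p ord0)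
  | m.+1 => fun i p => exist _ (face_fun (svalP p) i) (face_composable (svalP p) i)
  end.

Lemma nerve_map_subproof H G (F : homomorphism H G) n (g : 'I_n -> arr H) :
  composable g -> composable (hom1 F \o g).
Proof.
case: (homP F) => _ _ hs ht _ _ gP i j ij /=.
by rewrite hs ht; congr hom0; exact: gP.
Qed.

Definition nerve_map H G (F : homomorphism H G) (n : nat) :
    nerve H n -> nerve G n :=
  match n with
  | 0 => hom0 F
  | m.+1 => fun p => exist _ (hom1 F \o sval p) (nerve_map_subproof F (svalP p))
  end.

End Groupoids.

Arguments face {R G} n i _.
Arguments nerve_map {R H G} F n _.

Record lieGroupoid (R : realType) := LieGroupoid {
  lie_groupoid :> groupoid R;
  lieP : is_lie lie_groupoid }.

(* Sections are indexed by all subsets of [M], but only those over open subsets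
   are constrained; likewise [act a] only matters for [a] smooth on [U], and
   [res U V] for [V `<=` U]. *)
Record moduleSheaf (R : realType) (M : smoothSpace R) := ModuleSheaf {
  sect : set M -> lmodType R;
  res : forall U V, {linear sect U -> sect V};
  act : forall U, (M -> R) -> sect U -> sect U;
  res_id : forall U (e : sect U), open U -> res U U e = e;
  res_comp : forall U V W (e : sect U), open U -> open V -> open W ->
    V `<=` U -> W `<=` V -> res V W (res U V e) = res U W e;
  act_ext : forall U (a b : M -> R) (e : sect U), open U ->
    smooth_on U a -> smooth_on U b -> (forall x, U x -> a x = b x) ->
    act a e = act b e;
  act_addl : forall U (a b : M -> R) (e : sect U), open U ->
    smooth_on U a -> smooth_on U b ->
    act (fun x => a x + b x) e = act a e + act b e;
  act_addr : forall U (a : M -> R) (e e' : sect U), open U ->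
    smooth_on U a -> act a (e + e') = act a e + act a e';
  act_mul : forall U (a b : M -> R) (e : sect U), open U ->
    smooth_on U a -> smooth_on U b ->
    act (fun x => a x * b x) e = act a (act b e);
  act_cst : forall U (c : R) (e : sect U), open U -> act (fun=> c) e = c *: e;
  act_res : forall U V (a : M -> R) (e : sect U), open U -> open V ->
    V `<=` U -> smooth_on U a -> res U V (act a e) = act a (res U V e);
  sheaf_local : forall (I : Type) (U : I -> set M)
    (e e' : sect (\bigcup_i U i)), (forall i, open (U i)) ->
    (forall i, res (\bigcup_i U i) (U i) e = res (\bigcup_i U i) (U i) e') ->
    e = e';
  sheaf_glue : forall (I : Type) (U : I -> set M) (s : forall i, sect (U i)),
    (forall i, open (U i)) ->
    (forall i j, res (U i) (U i `&` U j) (s i) = res (U j) (U i `&` U j) (s j)) ->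
    exists e : sect (\bigcup_i U i), forall i, res (\bigcup_i U i) (U i) e = s i }.

Arguments res {R M} _ U V : rename.
Arguments act {R M} _ {U} a e : rename.

Record comorphism (R : realType) (M N : smoothSpace R) (f : M -> N)
    (W : moduleSheaf N) (E : moduleSheaf M) := Comorphism {
  comor : forall V : set N, {linear sect W V -> sect E (f @^-1` V)};
  comor_res : forall U V (e : sect W U), open U -> open V -> V `<=` U ->
    comor V (res W U V e) = res E (f @^-1` U) (f @^-1` V) (comor U e);
  comor_act : forall V (a : N -> R) (e : sect W V), open V -> smooth_on V a ->
    comor V (act W a e) = act E (a \o f) (comor V e) }.

(* The data are given on all spaces and functions, but nothing relates the ones
   outside the site of manifolds and smooth maps, where they may be taken to be
   zero. [bs_open]: E_U is the restriction of E_M to the open subset U, the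
   identification being the comorphism of the inclusion. *)
Record bigSheaf (R : realType) := BigSheaf {
  bs_sheaf : forall M : smoothSpace R, moduleSheaf M;
  bs_map : forall (M N : smoothSpace R) (f : M -> N),
    comorphism f (bs_sheaf N) (bs_sheaf M);
  bs_id : forall (M : smoothSpace R) (V : set M) (e : sect (bs_sheaf M) V),
    manifold M -> open V -> comor (bs_map (id : M -> M)) V e = e;
  bs_comp : forall (M N Q : smoothSpace R) (f : M -> N) (g : N -> Q) (V : set Q)
      (e : sect (bs_sheaf Q) V),
    manifold M -> manifold N -> manifold Q -> smooth f -> smooth g -> open V ->
    comor (bs_map (g \o f)) V e =
      comor (bs_map f) (g @^-1` V) (comor (bs_map g) V e);
  bs_open : forall (M : smoothSpace R) (U V : set M), manifold M -> open U -> open V ->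
    V `<=` U -> bijective (comor (bs_map (sval : subspaceS U -> M)) V) }.

Record sheafComplex (R : realType) := SheafComplex {
  sc_sheaf : nat -> bigSheaf R;
  sc_d : forall k (M : smoothSpace R) (U : set M),
    {linear sect (bs_sheaf (sc_sheaf k) M) U ->
            sect (bs_sheaf (sc_sheaf k.+1) M) U};
  sc_d_res : forall k (M : smoothSpace R) (U V : set M) e, manifold M -> open U -> open V ->
    V `<=` U ->
    sc_d k V (res (bs_sheaf (sc_sheaf k) M) U V e) =
      res (bs_sheaf (sc_sheaf k.+1) M) U V (sc_d k U e);
  sc_dd : forall k (M : smoothSpace R) (U : set M) e, manifold M -> open U ->
    sc_d k.+1 U (sc_d k U e) = 0;
  sc_d_map : forall k (M N : smoothSpace R) (f : M -> N) (V : set N) e,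
    manifold M -> manifold N -> smooth f -> open V ->
    sc_d k (f @^-1` V) (comor (bs_map (sc_sheaf k) f) V e) =
      comor (bs_map (sc_sheaf k.+1) f) V (sc_d k V e) }.

Section DependentProduct.
Variables (R : pzRingType) (I : Type) (V : I -> lmodType R).

Definition dprod : Type := forall i, V i.

HB.instance Definition _ := gen_eqMixin dprod.
HB.instance Definition _ := gen_choiceMixin dprod.

Let add (f g : dprod) : dprod := fun i => f i + g i.
Let opp (f : dprod) : dprod := fun i => - f i.
Let zero : dprod := fun=> 0.
Let scale (a : R) (f : dprod) : dprod := fun i => a *: f i.

Let addA : associative add.
Proof. by move=> f g h; apply: functional_extensionality_dep => i; exact: addrA. Qed.
Let addC : commutative add.
Proof. by move=> f g; apply: functional_extensionality_dep => i; exact: addrC. Qed.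
Let add0 : left_id zero add.
Proof. by move=> f; apply: functional_extensionality_dep => i; exact: add0r. Qed.
Let addN : left_inverse zero opp add.
Proof. by move=> f; apply: functional_extensionality_dep => i; exact: addNr. Qed.

HB.instance Definition _ := GRing.isZmodule.Build dprod addA addC add0 addN.

Let scaleA a b v : scale a (scale b v) = scale (a * b) v.
Proof. by apply: functional_extensionality_dep => i; exact: scalerA. Qed.
Let scale1 : left_id 1 scale.
Proof. by move=> f; apply: functional_extensionality_dep => i; exact: scale1r. Qed.
Let scaleDr : right_distributive scale +%R.
Proof. by move=> a f g; apply: functional_extensionality_dep => i; exact: scalerDr. Qed.
Let scaleDl v : {morph scale^~ v : a b / a + b}.
Proof. by move=> a b; apply: functional_extensionality_dep => i; exact: scalerDl. Qed.

HB.instance Definition _ :=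
  GRing.Zmodule_isLmodule.Build R dprod scaleA scale1 scaleDr scaleDl.

End DependentProduct.

Section LmodQuotient.
Variables (R : pzRingType) (V : lmodType R) (S : {pred V}).
Hypothesis SP : submod_closed S.
Local Open Scope quotient_scope.

Definition lquot_zmodClosed : zmodClosed V :=
  HB.pack S (GRing.isZmodClosed.Build V S (GRing.submod_closedB SP)).

Local Notation I := lquot_zmodClosed.

Definition lquot : Type := {ideal_quot I}.

HB.instance Definition _ := GRing.Zmodule.on lquot.

Definition lclass (v : V) : lquot := \pi_({ideal_quot I}) v.

Lemma lclass_eq (v w : V) : lclass v = lclass w <-> v - w \in S.
Proof.
rewrite -[v - w \in S]/(v - w \in I) Quotient.idealrBE.
by split=> [e|/eqP //]; exact/eqP.
Qed.

Let lclassK (q : lquot) : lclass (repr (q : {ideal_quot I})) = q.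
Proof. exact: reprK. Qed.

Let lclassD (v w : V) : lclass (v + w) = lclass v + lclass w.
Proof. exact: (raddfD (\pi_({ideal_quot I}))). Qed.

Let scale (a : R) (q : lquot) : lquot := lclass (a *: repr (q : {ideal_quot I})).

Let lclassZ a v : lclass (a *: v) = scale a (lclass v).
Proof.
apply/lclass_eq; rewrite -scalerBr; apply: (GRing.subsemimod_closedZ (GRing.submod_closed_semi SP)).
by apply/lclass_eq; rewrite lclassK.
Qed.

Let scaleA a b q : scale a (scale b q) = scale (a * b) q.
Proof. by rewrite -[q]lclassK -!lclassZ scalerA. Qed.
Let scale1 : left_id 1 scale.
Proof. by move=> q; rewrite -[q]lclassK -lclassZ scale1r. Qed.
Let scaleDr : right_distributive scale +%R.
Proof.
by move=> a p q; rewrite -[p]lclassK -[q]lclassK -lclassD -!lclassZ scalerDr lclassD.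
Qed.
Let scaleDl q : {morph scale^~ q : a b / a + b}.
Proof. by move=> a b; rewrite -[q]lclassK -!lclassZ scalerDl lclassD. Qed.

HB.instance Definition _ :=
  GRing.Zmodule_isLmodule.Build R lquot scaleA scale1 scaleDr scaleDl.

Lemma lclass_is_linear : linear lclass.
Proof. by move=> a v w; rewrite lclassD lclassZ. Qed.

HB.instance Definition _ :=
  GRing.isLinear.Build R V lquot *:%R lclass lclass_is_linear.

End LmodQuotient.

Section TotalComplex.
Context {R : realType}.
Variables (E : sheafComplex R) (G : groupoid R).

(* E^k(G^(n)) *)
Definition bicochain (p : nat * nat) : lmodType R :=
  sect (bs_sheaf (sc_sheaf E p.2) (nerve G p.1)) setT.

Definition delta n k (c : bicochain (n, k)) : bicochain (n.+1, k) :=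
  \sum_(i < n.+2) (-1) ^+ i *:
    (comor (bs_map (sc_sheaf E k) (face n i)) setT c : bicochain (n.+1, k)).

(* The total complex in degree m is the submodule [in_degree m] of the product of
   all E^k(G^(n)), made of the elements supported on n + k = m. *)
Definition cochain : lmodType R := dprod bicochain.

Definition in_degree (m : nat) (c : cochain) : Prop :=
  forall n k, (n + k)%N != m -> c (n, k) = 0.

Definition tot_diff (c : cochain) : cochain := fun p =>
  (match p.1 as n return bicochain (n, p.2) with
   | 0 => 0
   | n.+1 => delta (c (n, p.2))
   end : bicochain (p.1, p.2)) +
  (match p.2 as k return bicochain (p.1, k) with
   | 0 => 0
   | k.+1 => (-1) ^+ p.1 *:
       (sc_d E k setT (c (p.1, k)) : bicochain (p.1, k.+1))
   end).

Lemma delta_is_linear n k : linear (@delta n k).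
Proof.
move=> a c c'; rewrite /delta scaler_sumr -big_split /=; apply: eq_bigr => i _.
by rewrite linearP scalerDr !scalerA (mulrC a).
Qed.

Lemma tot_diff_is_linear : linear tot_diff.
Proof.
move=> a c c'; apply: functional_extensionality_dep => -[n k].
rewrite -[RHS]/(a *: tot_diff c (n, k) + tot_diff c' (n, k)) /tot_diff /=.
rewrite scalerDr addrACA; congr (_ + _).
  by case: n => [|n]; [rewrite scaler0 addr0 | exact: delta_is_linear].
case: k => [|k]; first by rewrite scaler0 addr0.
rewrite -[(a *: c + c') (n, k)]/(a *: c (n, k) + c' (n, k)) linearP scalerDr.
by rewrite !scalerA mulrC.
Qed.

Definition is_cocycle (m : nat) (c : cochain) : Prop := in_degree m c /\ tot_diff c = 0.

Definition is_coboundary (m : nat) (c : cochain) : Prop :=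
  if m is l.+1 then exists2 b : cochain, in_degree l b & c = tot_diff b else c = 0.

Definition cocycle_pred (m : nat) : pred cochain := fun c => `[< is_cocycle m c >].

Lemma cocycle_submod_closed m : submod_closed (cocycle_pred m).
Proof.
split=> [|a c c' /asboolP[tc Dc] /asboolP[tc' Dc']]; apply/asboolP; split.
- by [].
- by have := tot_diff_is_linear (-1) 0 0; rewrite scaler0 addr0 scaleN1r addNr.
- move=> n k nk; rewrite -[LHS]/(a *: c (n, k) + c' (n, k)).
  by rewrite tc // tc' // scaler0 addr0.
- by rewrite tot_diff_is_linear Dc Dc' scaler0 addr0.
Qed.

HB.instance Definition _ m :=
  GRing.isSubmodClosed.Build R cochain (cocycle_pred m) (cocycle_submod_closed m).

Record cocycle (m : nat) := Cocycle {
  cocycle_val :> cochain;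
  cocycle_valP : cocycle_val \in cocycle_pred m }.

HB.instance Definition _ m := [isSub for @cocycle_val m].
HB.instance Definition _ m := [Choice of cocycle m by <:].
HB.instance Definition _ m := [SubChoice_isSubLmodule of cocycle m by <:].

Definition coboundary_pred (m : nat) : pred (cocycle m) :=
  fun z => `[< is_coboundary m z >].

Lemma coboundary_submod_closed m : submod_closed (@coboundary_pred m).
Proof.
split=> [|a z z' /asboolP zP /asboolP z'P]; apply/asboolP.
  case: m => [|l] //=; exists 0; first by [].
  by have := tot_diff_is_linear (-1) 0 0; rewrite scaler0 addr0 scaleN1r addNr.
have valE : cocycle_val (a *: z + z') = a *: cocycle_val z + cocycle_val z'.
  exact: (linearP (\val : cocycle m -> cochain)).
rewrite {}valE /is_coboundary.
case: m => [|l] /= in z z' zP z'P *; first by rewrite zP z'P scaler0 addr0.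
case: zP z'P => [b bP ->] [b' b'P ->]; exists (a *: b + b').
  move=> n k nk; rewrite -[LHS]/(a *: b (n, k) + b' (n, k)).
  by rewrite bP // b'P // scaler0 addr0.
by rewrite tot_diff_is_linear.
Qed.

(* Cocycles modulo those cocycles which are coboundaries. *)
Definition cohomology (m : nat) : lmodType R :=
  lquot (coboundary_submod_closed m).

Definition cohomology_class m (z : cocycle m) : cohomology m :=
  lclass (coboundary_submod_closed m) z.

End TotalComplex.

Definition induced_map (R : realType) (E : sheafComplex R) (H G : groupoid R)
    (F : homomorphism H G) (c : cochain E G) : cochain E H :=
  fun p => comor (bs_map (sc_sheaf E p.2) (nerve_map F p.1)) setT (c p).

(* Main.v *)
From HB Require Import structures.
Require Import Defs.
From mathcomp Require Import all_boot all_order all_algebra.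
From mathcomp Require Import all_classical all_reals all_analysis.
From mathcomp Require Import ring lra zify.

(** The theorem compares the nerves of [G] and [H] through a triple complex.

    Let [Y p q] be the space of strings of composable arrows of [G] through p + q
    objects, together with lifts to [H] of the first p objects. For p + q > 0 it is a
    manifold ([manifold_Y]), because a vertex is added to a string by a fibre product
    along a source map; for the vertices in [H] this uses that [F] is fully faithful.
    Removing vertices makes [Y] bisimplicial, and the sections of [E] over the [Y p q]
    form a triple complex. Its axis p = 0 is the complex of [G], since [Y 0 (n + 1)] is
    the nerve of [G] in degree n, and its axis q = 0 is the complex of [H], since [F] is
    fully faithful. The total degree is shifted by one against that of the nerves,
    and [Y 0 0] is left out.

    The part p > 0 of the complex, which is the kernel of the restriction to [G],
    is acyclic: the image in [G] of the first [H]-vertex can be repeated as a new first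
    [G]-vertex, and this is a contracting homotopy of each column ([column_exact]).
    The part q > 0, the kernel of the restriction to [H], is acyclic as well: a
    contracting homotopy of a row inserts as new first [H]-vertex an object of [H]
    whose image is joined to the first [G]-vertex by an arrow. Such objects come from
    sections of the evaluation map, a surjective submersion by essential surjectivity,
    hence exist locally on [G_0]; as the row differential is linear over the functions
    on [G_0], local solutions can be glued by a partition of unity ([row_exact],
    [solve_globally]). So both restrictions are quasi-isomorphisms.

    Finally, pullback along the map that forgets the lifts sends the complex of [G]
    to the triple complex ([spread]). Its restriction to [G] is the identity and its
    restriction to [H] is the map induced by [F], which is therefore bijective in
    cohomology; [induced_map_surjective] and [induced_map_injective] carry out this
    argument on cocycles.

    The analysis behind it is developed from the definition of manifolds by smooth
    germs: the inverse function theorem gives the normal form of submersions, whence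
    local sections and fibre products, and flat functions give bump functions. *)

Set Implicit Arguments.
Unset Strict Implicit.
Unset Printing Implicit Defensive.

Import Order.TTheory GRing.Theory Num.Theory.
Import numFieldNormedType.Exports.

Local Open Scope classical_set_scope.
Local Open Scope ring_scope.

(** * Calculus in R^n: mean values, the chain rule and C^k functions *)

Section MeanValue.
Context {R : realType}.

Local Notation e_ i := (delta_mx 0 i).

Lemma mean_value_1d (g : R -> R) (c eps s t : R) :
  (forall u, Num.min s t <= u <= Num.max s t ->
     derivable g u 1 /\ `|'D_1 g u - c| <= eps) ->
  `|g t - g s - c * (t - s)| <= eps * `|t - s|.
Proof.
wlog st : s t / s <= t => [hw|].
  case/orP: (le_total s t) => st; first exact: hw.
  move=> h; have := hw t s st; rewrite minC maxC => /(_ h).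
  rewrite [`|s - t|]distrC (_ : g s - g t - c * (s - t) = - (g t - g s - c * (t - s))).
    by rewrite normrN.
  by ring.
rewrite (min_idPl st) (max_idPr st) => h.
have [||u uI ->] := @MVT_segment R g ('D_1 g) s t st.
- move=> x /itvP xI; apply/derivableP/(proj1 (h x _)).
  by rewrite !xI.
- apply: derivable_within_continuous => x /itvP xI.
  by apply/(proj1 (h x _)); rewrite !xI.
rewrite -mulrBl normrM ler_wpM2r //.
by apply: (proj2 (h u _)); rewrite !(itvP uI).
Qed.

Lemma derive_line (V W : normedModType R) (f : V -> W) (z v : V) (t : R) :
  derivable f (t *: v + z) v ->
  derivable (fun h : R => f (h *: v + z)) t 1 /\
  'D_1 (fun h : R => f (h *: v + z)) t = 'D_v f (t *: v + z).
Proof.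
have E : (fun h : R => h^-1 *: (((fun h : R => f (h *: v + z)) \o shift t) (h *: (1:R)) - f (t *: v + z)))
   = (fun h : R => h^-1 *: ((f \o shift (t *: v + z)) (h *: v) - f (t *: v + z))).
  apply/funext => h /=; congr (_ *: (f _ - _)).
  by rewrite -[h *: (1 : R)]/(h * 1) mulr1 scalerDl addrA.
by move=> d; split; rewrite /derivable /derive E.
Qed.

Lemma ball_rVP n (p x : 'rV[R]_n) (r : R) : 0 < r ->
  ball p r x <-> forall i, `|p 0 i - x 0 i| < r.
Proof.
move=> r0; split=> [[_ h] i|h]; last first.
  by split=> // i j; rewrite ord1 -ball_normE /=; exact: h.
by have := h 0 i; rewrite -ball_normE.
Qed.

Lemma norm_rV_ge n (x : 'rV[R]_n) (i : 'I_n) : `|x 0 i| <= `|x|.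
Proof.
by rewrite {2}/Num.norm /= mx_normrE; apply: (le_bigmax _ _ (0, i)).
Qed.

Lemma norm_rV_le n (x : 'rV[R]_n) (r : R) : 0 <= r ->
  (forall i, `|x 0 i| <= r) -> `|x| <= r.
Proof.
move=> r0 h; rewrite {1}/Num.norm /= mx_normrE; apply: bigmax_le => // -[i j] _.
by rewrite ord1 /=.
Qed.

(** Passing from [y] to [x] one coordinate at a time stays in the ball, which is a
    cube for the norm of row vectors; the bound on the error is a sum of [n]
    one-dimensional ones. *)
Lemma mean_value_estimate n (f : 'rV[R]_n -> R) (c : 'I_n -> R) p (r eps : R) :
  0 < r ->
  (forall x, ball p r x -> forall i, derivable f x (e_ i) /\
     `|'D_(e_ i) f x - c i| <= eps) ->
  forall x y, ball p r x -> ball p r y ->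
  `|f x - f y - \sum_i c i * (x 0 i - y 0 i)| <= eps * n%:R * `|x - y|.
Proof.
move=> r0 h x y px py.
have [n0|n0] := posnP n.
  subst n; rewrite big_ord0 (_ : x = y); last by apply/rowP; case.
  by rewrite !subrr normr0 mulr0.
have eps0 : 0 <= eps.
  by have [_] := h x px (Ordinal n0); apply: le_trans.
pose z (j : nat) : 'rV[R]_n := \row_i (if (i < j)%N then x 0 i else y 0 i).
have zn : z n = x by apply/rowP => i; rewrite mxE ltn_ord.
have z0 : z 0%N = y by apply/rowP => i; rewrite mxE.
have -> : f x - f y = \sum_(i < n) (f (z i.+1) - f (z i)).
  rewrite -zn -z0 -(telescope_sumr (f \o z)) //.
  by rewrite big_mkord.
rewrite -sumrB.
apply: le_trans (ler_norm_sum _ _ _) _.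
have -> : eps * n%:R * `|x - y| = \sum_(i < n) eps * `|x - y|.
  by rewrite sumr_const card_ord -[RHS]mulr_natr; ring.
apply: ler_sum => i _.
pose w : 'rV[R]_n := \row_j (if j == i then 0 else z i 0 j).
have lineE t j : (t *: e_ i + w) 0 j = if j == i then t else z i 0 j.
  rewrite !mxE eqxx /=.
  by case: eqP => _; rewrite ?mulr1 ?mulr0 ?addr0 ?add0r // mxE.
have -> : z i.+1 = x 0 i *: e_ i + w.
  apply/rowP => j; rewrite lineE !mxE.
  case: eqP => [->|/eqP ji]; first by rewrite ltnSn.
  by rewrite ltnS leq_eqVlt -val_eqE /= in ji *; rewrite (negbTE ji).
have -> : z i = y 0 i *: e_ i + w.
  apply/rowP => j; rewrite lineE.
  by case: eqP => // ->; rewrite mxE ltnn.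
apply: le_trans (@mean_value_1d (fun t => f (t *: e_ i + w)) _ eps _ _ _) _; last first.
  rewrite ler_wpM2l // (le_trans _ (norm_rV_ge _ i)) //.
  by rewrite !mxE.
move=> u /andP[u1 u2].
have B : ball p r (u *: e_ i + w).
  apply/ball_rVP => // j; rewrite lineE.
  have {}px := (proj1 (ball_rVP _ _ r0) px) j.
  have {}py := (proj1 (ball_rVP _ _ r0) py) j.
  case: eqP => [jE|_]; last by rewrite mxE; case: ifP.
  subst j; rewrite ltr_norml; move: px py; rewrite !ltr_norml.
  move=> /andP[? ?] /andP[? ?].
  move: u1 u2; rewrite ge_min le_max => /orP[] ? /orP[] ?; apply/andP; split; lra.
have [d1 d2] := h _ B i.
by have [d3 ->] := derive_line d1.
Qed.

End MeanValue.

Section Differentiability.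
Context {R : realType}.

Local Notation e_ i := (delta_mx 0 i).

Definition linear_form n (c : 'I_n -> R) (v : 'rV[R]_n) : R := \sum_i c i * v 0 i.

Lemma linear_form_is_linear n (c : 'I_n -> R) : linear (linear_form c).
Proof.
move=> a u v; rewrite /linear_form /= scaler_sumr -big_split /=.
by apply: eq_bigr => i _; rewrite !mxE -[a *: (_ : R)]/(a * _); ring.
Qed.

HB.instance Definition _ n c :=
  GRing.isLinear.Build R 'rV[R]_n R *:%R (@linear_form n c)
    (@linear_form_is_linear n c).

Lemma linear_form_continuous n (c : 'I_n -> R) : continuous (linear_form c).
Proof.
have -> : linear_form c = \sum_i (fun v : 'rV[R]_n => c i *: (v 0 i : R)).
  by apply/funext => v; rewrite fct_sumE.
move=> x; apply: differentiable_continuous; apply: differentiable_sum => i.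
by apply: differentiableZ; exact: differentiable_coord.
Qed.

Lemma linear_form_e n (c : 'I_n -> R) i : linear_form c (e_ i) = c i.
Proof.
rewrite /linear_form (bigD1 i) //= mxE !eqxx mulr1 big1 ?addr0 // => j ji.
by rewrite mxE (negbTE ji) andbF mulr0.
Qed.

Lemma is_diff_estimate (V W : normedModType R) (f : V -> W) (df : {linear V -> W}) x :
  continuous df ->
  (forall eps : R, 0 < eps ->
    \forall v \near (0 : V), `|f (v + x) - (f x + df v)| <= eps * `|v|) ->
  is_diff x f df.
Proof.
move=> cdf h; have H : f \o shift x = cst (f x) + df +o_0 id.
  by apply/eqaddoP => eps eps0; exact: h.
have dE := diff_unique cdf H.
by split=> //; apply/diff_locallyP; rewrite dE; split.
Qed.

(** Continuity of the partial derivatives, with the mean value estimate for the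
    constants [c i] equal to their values at [x], gives the total derivative. *)
Lemma is_diff_C1 n (f : 'rV[R]_n -> R) (x : 'rV[R]_n) :
  (\near x, forall i, derivable f x (e_ i)) ->
  (forall i, {for x, continuous ('D_(e_ i) f)}) ->
  is_diff x f (linear_form (fun i => 'D_(e_ i) f x)).
Proof.
move=> dn dc; set c := (fun i => _).
apply: is_diff_estimate => [|eps eps0]; first exact: linear_form_continuous.
have e0 : 0 < eps / n.+1%:R by rewrite divr_gt0.
have : \forall y \near x, forall i, derivable f y (e_ i) /\
    `|'D_(e_ i) f y - c i| <= eps / n.+1%:R.
  near=> y => i; split; first by move: i; near: y.
  move: i; near: y; apply: filter_forall => i.
  by have /cvgrPdist_le/(_ _ e0) := dc i; under eq_near do rewrite distrC.
move=> /nbhs_ballP[r /= r0 hr].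
have rb : nbhs (0 : 'rV[R]_n) (ball 0 r) by apply/nbhs_ballP; exists r.
near=> v; rewrite [X in `|X|](_ : _ = f (v + x) - f x -
    \sum_i c i * ((v + x) 0 i - x 0 i)); last first.
  rewrite /linear_form opprD addrA; congr (_ - _).
  by apply: eq_bigr => i _; rewrite mxE addrK.
have xr : ball x r (v + x).
  have : ball 0 r v by near: v.
  by rewrite -!ball_normE /= opprD addrCA subrr addr0 sub0r.
apply: le_trans (mean_value_estimate r0 hr xr (ballxx _ r0)) _.
rewrite addrK ler_wpM2r // mulrAC ler_pdivrMr // ler_wpM2l ?(ltW eps0) //.
by rewrite ler_nat.
Unshelve. all: by end_near. Qed.

Lemma continuous_row (T : topologicalType) n (f : 'I_n -> T -> R) (x : T) :
  (forall i, {for x, continuous (f i)}) ->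
  {for x, continuous (fun y => \row_i f i y)}.
Proof.
move=> h; apply/cvg_ballP => eps eps0; near=> y.
apply/ball_rVP => // i; rewrite !mxE; move: i; near: y.
by apply: filter_forall => i; have /cvgrPdist_lt/(_ _ eps0) := h i.
Unshelve. all: by end_near. Qed.

(** The chain rule on the line through [x] in the direction [v], written in
    coordinates. *)
Lemma chain_rule n k (f : 'I_k -> 'rV[R]_n -> R) (g : 'rV[R]_k -> R) x v c :
  (forall j, derivable (f j) x v) -> is_diff (\row_j f j x) g (linear_form c) ->
  is_derive x v (fun y => g (\row_j f j y)) (\sum_j c j * 'D_v (f j) x).
Proof.
move=> df dg; pose F (y : 'rV[R]_n) := \row_j f j y.
have dF : derivable F x v.
  by apply/derivable_mxP => i j; rewrite (_ : (fun _ => _) = f j) //; apply/funext => y; rewrite mxE.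
have /derivable1P dL := dF.
have := dL => /derivable1_diffP dL'.
have L0 : F (0 *: v + x) = \row_j f j x by rewrite scale0r add0r.
have dg' : differentiable g (F (0 *: v + x)) by rewrite L0; exact: ex_diff.
have dgL := differentiable_comp dL' dg'.
have dgx : derivable (g \o F) x v.
  by apply/derivable1P/derivable1_diffP; exact: dgL.
split=> //.
have lineE (W : normedModType R) (h : 'rV[R]_n -> W) : derivable h x v ->
    'D_1 (fun t : R => h (t *: v + x)) 0 = 'D_v h x.
  by move=> dh; have [|_ ->] := @derive_line _ _ _ h x v 0; rewrite scale0r add0r.
rewrite -[LHS](lineE _ _ dgx).
rewrite [LHS](_ : _ = 'D_1 (g \o (fun h : R => F (h *: v + x))) 0) //.
rewrite deriveE // diff_comp // /= L0 diff_val -deriveE // (lineE _ _ dF).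
rewrite [X in linear_form _ X](derive_mx dF) /linear_form; apply: eq_bigr => j _; rewrite mxE.
by congr (_ * _); congr (derive _ x v); apply/funext => y; rewrite mxE.
Qed.

End Differentiability.

Section CkAlgebra.
Context {R : realType}.

Local Notation e_ i := (delta_mx 0 i).

Lemma Ck_continuous k n (U : set 'rV[R]_n) f x :
  Ck k U f -> U x -> {for x, continuous f}.
Proof. by case: k => [|k] [h _]; exact: h. Qed.

Lemma Ck_sub k n (U V : set 'rV[R]_n) f : V `<=` U -> Ck k U f -> Ck k V f.
Proof.
move=> VU; elim: k f => [|k IH] f /= [h1 h2]; split=> //; try by move=> x /VU/h1.
by move=> i; have [h3 h4] := h2 i; split=> [x /VU/h3//|]; exact: IH.
Qed.

Lemma Ck_pred k n (U : set 'rV[R]_n) f : Ck k.+1 U f -> Ck k U f.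
Proof.
elim: k f => [|k IH] f; first by case.
by move=> [h1 h2]; split=> // i; have [h3 h4] := h2 i; split=> //; exact: IH.
Qed.

Lemma near_eq_continuous (T U : topologicalType) (f g : T -> U) (x : T) :
  (\forall y \near x, f y = g y) -> {for x, continuous f} -> {for x, continuous g}.
Proof.
move=> fg cf; rewrite /prop_for /continuous_at -(nbhs_singleton fg).
by apply: cvg_trans cf; exact: near_eq_cvg.
Qed.

Lemma open_near_eq (T : topologicalType) (U : Type) (A : set T) (f g : T -> U) x :
  open A -> (forall y, A y -> f y = g y) -> A x -> \forall y \near x, f y = g y.
Proof. by move=> oA fg Ax; apply: filterS fg _; exact: open_nbhs_nbhs. Qed.

(** On an open set the iterated partial derivatives depend on the values there
    alone. *)
Lemma Ck_eq k n (U : set 'rV[R]_n) f g : open U -> (forall x, U x -> f x = g x) ->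
  Ck k U f -> Ck k U g.
Proof.
move=> oU; elim: k f g => [|k IH] f g fg [h1 h2].
  split=> // x Ux; exact: near_eq_continuous (open_near_eq (x := x) oU fg Ux) (h1 x Ux).
split=> [x Ux|i].
  exact: near_eq_continuous (open_near_eq (x := x) oU fg Ux) (h1 x Ux).
have [h3 h4] := h2 i; split.
  by move=> x Ux; exact: near_eq_derivable (open_near_eq (x := x) oU fg Ux) (h3 _ Ux).
by apply: IH h4 => x Ux; exact: near_eq_derive (open_near_eq (x := x) oU fg Ux).
Qed.

Lemma Ck_cst k n (U : set 'rV[R]_n) (c : R) : Ck k U (fun=> c).
Proof.
elim: k c => [|k IH] c; split=> //.
1,2: by move=> x _; exact: cst_continuous.
move=> i; split=> [x _|]; first exact: derivable_cst.
have -> : (fun x : 'rV[R]_n => 'D_(e_ i) (fun=> c) x) = fun=> (0 : R) by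
  apply/funext => x; exact: derive_cst.
exact: IH.
Qed.

Lemma is_derive_coord n (x v : 'rV[R]_n) (j : 'I_n) :
  is_derive x v (fun y : 'rV[R]_n => y 0 j : R) (v 0 j).
Proof.
pose c (i : 'I_n) : R := (i == j)%:R.
have cE : (fun y : 'rV[R]_n => y 0 j : R) = linear_form c.
  apply/funext => y; rewrite /linear_form (bigD1 j) //= /c eqxx mul1r big1 ?addr0 // => i ij.
  by rewrite (negbTE ij) mul0r.
rewrite cE -[v 0 j]/((fun y : 'rV[R]_n => y 0 j : R) v) cE.
have d : differentiable (linear_form c) x.
  by apply: linear_differentiable; exact: linear_form_continuous.
split; first exact: diff_derivable.
by rewrite deriveE // diff_lin //; exact: linear_form_continuous.
Qed.

Lemma Ck_coord k n (U : set 'rV[R]_n) (j : 'I_n) : Ck k U (fun x : 'rV[R]_n => x 0 j).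
Proof.
case: k => [|k]; split=> //.
1,2: by move=> x _; exact: coord_continuous.
move=> i; split=> [x _|]; first by have [] := is_derive_coord x (e_ i) j.
have -> : (fun x : 'rV[R]_n => 'D_(e_ i) (fun y : 'rV[R]_n => y 0 j : R) x) =
    fun=> (e_ i : 'rV[R]_n) 0 j.
  by apply/funext => x; have [_] := is_derive_coord x (e_ i) j.
exact: Ck_cst.
Qed.

Lemma CkD k n (U : set 'rV[R]_n) f g : open U -> Ck k U f -> Ck k U g ->
  Ck k U (fun x => f x + g x).
Proof.
move=> oU; elim: k f g => [|k IH] f g [f1 f2] [g1 g2]; split=> //.
1,2: by move=> x Ux; exact: (cvgD (f1 x Ux) (g1 x Ux)).
move=> i; have [f3 f4] := f2 i; have [g3 g4] := g2 i; split=> [x Ux|].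
  by apply: derivableD; [exact: f3|exact: g3].
apply: Ck_eq (IH _ _ f4 g4) => // x Ux.
by rewrite deriveD //; [exact: f3|exact: g3].
Qed.

Lemma CkM k n (U : set 'rV[R]_n) f g : open U -> Ck k U f -> Ck k U g ->
  Ck k U (fun x => f x * g x).
Proof.
move=> oU; elim: k f g => [|k IH] f g hf hg.
  by split=> // x Ux; exact: (cvgM (proj1 hf x Ux) (proj1 hg x Ux)).
have [f1 f2] := hf; have [g1 g2] := hg.
split; first by move=> x Ux; exact: (cvgM (f1 x Ux) (g1 x Ux)).
move=> i; have [f3 f4] := f2 i; have [g3 g4] := g2 i; split=> [x Ux|].
  by apply: derivableM; [exact: f3|exact: g3].
have := CkD oU (IH _ _ (Ck_pred hf) g4) (IH _ _ (Ck_pred hg) f4).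
apply: Ck_eq => // x Ux.
by rewrite deriveM //; [exact: f3|exact: g3].
Qed.

Lemma Ck_sum k n (U : set 'rV[R]_n) (I : Type) (r : seq I) (P : pred I) f : open U ->
  (forall i, P i -> Ck k U (f i)) -> Ck k U (fun x => \sum_(i <- r | P i) f i x).
Proof.
move=> oU h; elim: r => [|i r IH].
  have -> : (fun x => \sum_(i <- [::] | P i) f i x) = fun=> 0 by
    apply/funext => x; rewrite big_nil.
  exact: Ck_cst.
case Pi : (P i).
  have -> : (fun x => \sum_(j <- i :: r | P j) f j x) =
      fun x => f i x + \sum_(j <- r | P j) f j x by
    apply/funext => x; rewrite big_cons Pi.
  by apply: CkD => //; exact: h.
have -> // : (fun x => \sum_(j <- i :: r | P j) f j x) =
    fun x => \sum_(j <- r | P j) f j x by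
  apply/funext => x; rewrite big_cons Pi.
Qed.

Lemma Ck_prod k n (U : set 'rV[R]_n) (I : Type) (r : seq I) (P : pred I) f : open U ->
  (forall i, P i -> Ck k U (f i)) -> Ck k U (fun x => \prod_(i <- r | P i) f i x).
Proof.
move=> oU h; elim: r => [|i r IH].
  have -> : (fun x => \prod_(i <- [::] | P i) f i x) = fun=> 1 by
    apply/funext => x; rewrite big_nil.
  exact: Ck_cst.
case Pi : (P i).
  have -> : (fun x => \prod_(j <- i :: r | P j) f j x) =
      fun x => f i x * \prod_(j <- r | P j) f j x by
    apply/funext => x; rewrite big_cons Pi.
  by apply: CkM => //; exact: h.
have -> // : (fun x => \prod_(j <- i :: r | P j) f j x) =
    fun x => \prod_(j <- r | P j) f j x by
  apply/funext => x; rewrite big_cons Pi.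
Qed.

Lemma CkV k n (U : set 'rV[R]_n) f : open U -> (forall x, U x -> f x != 0) ->
  Ck k U f -> Ck k U (fun x => (f x)^-1).
Proof.
move=> oU f0; elim: k => [|k IH] hf.
  by split=> // x Ux; exact: (cvgV (f0 x Ux) (proj1 hf x Ux)).
have [f1 f2] := hf.
split; first by move=> x Ux; exact: (cvgV (f0 x Ux) (f1 x Ux)).
move=> i; have [f3 f4] := f2 i; split=> [x Ux|].
  by apply: derivableV; [exact: f0|exact: f3].
have V := IH (Ck_pred hf).
have := CkM oU (Ck_cst k U (-1)) (CkM oU (CkM oU V V) f4).
apply: Ck_eq => // x Ux; rewrite deriveV ?f0 //; last exact: f3.
by rewrite -[RHS]/(_ * _) mulN1r mulNr -expr2 exprVn.
Qed.

Lemma Ck_is_diff k n (U : set 'rV[R]_n) (f : 'rV[R]_n -> R) x : open U -> U x ->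
  Ck k.+1 U f -> is_diff x f (linear_form (fun i => 'D_(e_ i) f x)).
Proof.
move=> oU Ux [f1 f2]; apply: is_diff_C1; last first.
  by move=> i; apply: Ck_continuous Ux; exact: (proj2 (f2 i)).
near=> y => i; apply: (proj1 (f2 i)); near: y; exact: open_nbhs_nbhs.
Unshelve. all: by end_near. Qed.

Lemma Ck_comp k n m (U : set 'rV[R]_n) (V : set 'rV[R]_m) f g :
  open U -> open V -> (forall x, U x -> V (\row_j f j x)) ->
  (forall j, Ck k U (f j)) -> Ck k V g -> Ck k U (fun x => g (\row_j f j x)).
Proof.
move=> oU oV UV.
have C k' g' : (forall j, Ck k' U (f j)) -> Ck k' V g' ->
    forall x, U x -> {for x, continuous (fun x => g' (\row_j f j x))}.
  move=> hf hg x Ux; apply: (continuous_comp (g := g')).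
    by apply: continuous_row => i; exact: Ck_continuous (hf i) Ux.
  by apply: Ck_continuous hg _; exact: UV.
elim: k g => [|k IH] g hf hg; first by split=> //; exact: (C 0%N).
split; first exact: (C k.+1).
have [g1 g2] := hg.
have D x v : U x -> (forall j, derivable (f j) x v) ->
  is_derive x v (fun y => g (\row_j f j y))
    (\sum_j 'D_(e_ j) g (\row_j f j x) * 'D_v (f j) x).
  move=> Ux df; apply: chain_rule => //.
  by apply: Ck_is_diff hg => //; exact: UV.
move=> i; have df x j : U x -> derivable (f j) x (e_ i).
  by move=> Ux; have [_ h] := hf j; exact: (proj1 (h i)).
split=> [x Ux|]; first by have [] := D x (e_ i) Ux (fun j => df x j Ux).
have : Ck k U (fun x => \sum_j 'D_(e_ j) g (\row_j f j x) * 'D_(e_ i) (f j) x).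
  apply: Ck_sum => // j _; apply: CkM => //.
    exact: (IH _ (fun j' => Ck_pred (hf j')) (proj2 (g2 j))).
  by have [_ h] := hf j; exact: (proj2 (h i)).
apply: Ck_eq => // x Ux.
by have [_ ->] := D x (e_ i) Ux (fun j => df x j Ux).
Qed.

End CkAlgebra.

(** * The inverse function theorem *)

Section InverseFunction.
Context {R : realType}.

Local Notation e_ i := (delta_mx 0 i).

Lemma Ck_det k n m (U : set 'rV[R]_n) (A : 'rV[R]_n -> 'M[R]_m) : open U ->
  (forall i j, Ck k U (fun x => A x i j)) -> Ck k U (fun x => \det (A x)).
Proof.
move=> oU h; apply: Ck_sum => // s _; apply: CkM => //; first exact: Ck_cst.
exact: Ck_prod.
Qed.

Lemma Ck_invmx k n m (U : set 'rV[R]_n) (A : 'rV[R]_n -> 'M[R]_m) i j : open U ->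
  (forall x, U x -> A x \in unitmx) ->
  (forall i j, Ck k U (fun x => A x i j)) -> Ck k U (fun x => invmx (A x) i j).
Proof.
move=> oU uA h.
have : Ck k U (fun x => (\det (A x))^-1 * ((-1) ^+ (j + i) *
    \det (row' j (col' i (A x))))).
  apply: CkM => //.
    apply: CkV => //; last exact: Ck_det.
    by move=> x /uA; rewrite unitmxE unitfE.
  apply: CkM => //; first exact: Ck_cst.
  apply: Ck_det => // i' j'.
  have -> : (fun x => row' j (col' i (A x)) i' j') = fun x => A x (lift j i') (lift i j') by
    apply/funext => x; rewrite !mxE.
  exact: h.
by apply: Ck_eq => // x /uA ux; rewrite /invmx ux !mxE.
Qed.

Lemma mulmx_bounded n m (B : 'M[R]_(n, m)) :
  exists2 C : R, 0 < C & forall u : 'rV[R]_n, `|u *m B| <= C * `|u|.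
Proof.
pose C : R := 1 + \sum_i \sum_j `|B i j|.
have S0 : 0 <= \sum_i \sum_j `|B i j| by apply: sumr_ge0 => i _; exact: sumr_ge0.
exists C => [|u]; first by rewrite /C ltr_wpDr.
apply: norm_rV_le => [|j]; first by rewrite mulr_ge0 // addr_ge0.
rewrite mxE; apply: le_trans (ler_norm_sum _ _ _) _.
apply: (@le_trans _ _ (\sum_i `|u| * `|B i j|)).
  by apply: ler_sum => i _; rewrite normrM ler_wpM2r // norm_rV_ge.
rewrite -mulr_sumr mulrC ler_wpM2r // /C ler_wpDl // ler_sum // => i _.
by rewrite (bigD1 j) //= lerDl sumr_ge0.
Qed.

HB.instance Definition _ m n :=
  Uniform_isComplete.Build 'M[R]_(m, n) (@mx_complete R m n).

Variables (n : nat) (f : 'I_n -> 'rV[R]_n -> R) (p : 'rV[R]_n) (U0 : set 'rV[R]_n).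
Hypotheses (oU0 : open U0) (U0p : U0 p) (fC : forall k j, Ck k U0 (f j)).

Let F (x : 'rV[R]_n) : 'rV[R]_n := \row_j f j x.
Let J (x : 'rV[R]_n) : 'M[R]_n := \matrix_(i, j) 'D_(e_ i) (f j) x.

Hypothesis Jp : J p \in unitmx.

Let B := invmx (J p).

Let JC k i j : Ck k U0 (fun x => J x i j).
Proof.
have -> : (fun x => J x i j) = 'D_(e_ i) (f j) by apply/funext => x; rewrite mxE.
by have [_ h] := fC k.+1 j; exact: (proj2 (h i)).
Qed.

(* [T j] below is the j-th coordinate of [x - F x *m B], whose derivative vanishes
   at [p] and is therefore small nearby. *)
Let contraction_radius : exists2 r : R, 0 < r &
  (forall x, ball p r x -> U0 x /\ J x \in unitmx) /\
  (forall x y, ball p r x -> ball p r y ->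
    `|x - y - (F x - F y) *m B| <= 2^-1 * `|x - y|).
Proof.
pose T j (x : 'rV[R]_n) : R := x 0 j + -1 * \sum_l f l x * B l j.
have TC k j : Ck k U0 (T j).
  apply: CkD => //; first exact: Ck_coord.
  apply: CkM => //; first exact: Ck_cst.
  by apply: Ck_sum => // l _; apply: CkM => //; exact: Ck_cst.
have TD x i j : U0 x -> 'D_(e_ i) (T j) x = ((1%:M - J x *m B) i j).
  move=> Ux.
  have d l : derivable (f l) x (e_ i) by have [_ h] := fC 1 l; exact: (proj1 (h i)).
  have -> : T j = (fun y : 'rV[R]_n => y 0 j : R) - \sum_l (f l * cst (B l j)).
    apply/funext => y; rewrite /T mulN1r; congr (_ - _).
    by rewrite fct_sumE.
  have [d1 d2] := is_derive_coord x (e_ i) j.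
  have dM l : derivable (f l * cst (B l j)) x (e_ i) :=
    derivableM (d l) (derivable_cst (B l j) x (e_ i)).
  rewrite [LHS](deriveB d1 (derivable_sum dM)) d2 (derive_sum dM).
  rewrite !mxE eqxx /= eq_sym; congr (_ - _); apply: eq_bigr => l _.
  by rewrite [LHS](deriveM (d l) (derivable_cst _ _ _)) derive_cst scaler0 add0r mxE mulrC.
pose eps : R := 2^-1 / n.+1%:R.
have eps0 : 0 < eps by rewrite divr_gt0.
have D0 : \det (J p) != 0 by rewrite -unitfE -unitmxE.
have c : {for p, continuous (fun x => \det (J x))}.
  apply: (@Ck_continuous _ 0%N _ U0) => //; apply: Ck_det => // i j; exact: JC.
have : \forall x \near p, (U0 x /\ J x \in unitmx) /\
    forall ij : 'I_n * 'I_n, `|'D_(e_ ij.1) (T ij.2) x - 0| <= eps.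
  near=> x; split; first split.
  - by near: x; exact: open_nbhs_nbhs.
  - rewrite unitmxE unitfE; near: x; exact: (cvgr_neq0 _ c D0).
  - near: x; apply: filter_forall => -[i j] /=.
    have : {for p, continuous ('D_(e_ i) (T j))}.
      by apply: (@Ck_continuous _ 0%N _ U0) => //; have [_ h] := TC 1%N j; exact: (proj2 (h i)).
    move=> /cvgrPdist_le/(_ _ eps0).
    by rewrite TD // mulmxV // subrr mxE; under eq_near do rewrite distrC.
move=> /nbhs_ballP[r /= r0 hr]; exists r => //; split; first by move=> x /hr[].
move=> x y px py.
apply: norm_rV_le => [|j]; first by rewrite mulr_ge0 ?invr_ge0.
have := @mean_value_estimate R n (T j) (fun=> 0) p r eps r0 _ x y px py.
rewrite big1 ?subr0; last by move=> i _; rewrite mul0r.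
have -> : (x - y - (F x - F y) *m B) 0 j = T j x - T j y.
  have FB z : (F z *m B) 0 j = \sum_l f l z * B l j.
    by rewrite mxE; apply: eq_bigr => l _; rewrite mxE.
  have subE (u v : 'rV[R]_n) : (u - v) 0 j = u 0 j - v 0 j by rewrite !mxE.
  by rewrite mulmxBl !subE !FB /T; ring.
move=> h; apply: le_trans (h _) _; last first.
  rewrite ler_wpM2r // /eps mulrAC ler_pdivrMr // ler_wpM2l ?invr_ge0 //.
  by rewrite ler_nat.
move=> z /hr[[Uz _] hz] i; split; last exact: (hz (i, j)).
by have [_ h'] := TC 1%N j; exact: (proj1 (h' i)).
Unshelve. all: by end_near. Qed.

(** For [y] near [F p], the map [x + (y - F x) *m B] is a contraction of a closed
    ball, where [B] is the inverse of the derivative at [p], and its fixed point is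
    the preimage of [y]. The inverse [G] is Lipschitz, hence differentiable with
    derivative [invmx (J (G y))]; as this formula involves [G] without
    derivatives, induction makes [G] as smooth as [F]. *)
Theorem inverse_function : exists (U V : set 'rV[R]_n) (G : 'rV[R]_n -> 'rV[R]_n),
  [/\ open U, U p & U `<=` U0] /\
  [/\ open V, forall x, U x -> V (F x) /\ G (F x) = x,
      forall y, V y -> U (G y) /\ F (G y) = y &
      forall k j, Ck k V (fun y => G y 0 j)].
Proof.
have [r r0 [rU rT]] := contraction_radius.
have [C C0 CB] := mulmx_bounded B.
have expand x y : ball p r x -> ball p r y -> `|x - y| <= 2 * `|(F x - F y) *m B|.
  move=> px py; have := rT _ _ px py.
  have := ler_normB (x - y) ((F x - F y) *m B).
  have := ler_distD ((F x - F y) *m B) (x - y) 0; rewrite !subr0.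
  by lra.
pose s := r / 2; have s0 : 0 < s by rewrite divr_gt0.
have sr x : `|p - x| <= s -> ball p r x.
  by rewrite -ball_normE /= => /le_lt_trans; apply; rewrite /s; lra.
pose rho := s / (4 * C); have rho0 : 0 < rho by rewrite divr_gt0 ?mulr_gt0.
pose V := ball (F p) rho.
have VB y : V y -> `|(y - F p) *m B| <= s / 4.
  rewrite /V -ball_normE /= distrC => /ltW h.
  apply: le_trans (CB _) _; rewrite -[s / 4](_ : C * rho = _) ?ler_pM2l //.
  by rewrite /rho; field; rewrite gt_eqF.
have solve y : exists x, V y -> `|p - x| < s /\ F x = y.
  have [Vy|nV] := pselect (V y); last by exists p.
  pose A := closed_ball_ (@Num.Def.normr _ 'rV[R]_n) p s.
  pose phi (x : 'rV[R]_n) := x + (y - F x) *m B.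
  have phiE x z : phi x - phi z = x - z - (F x - F z) *m B.
    rewrite /phi !mulmxBl opprD addrACA; congr (_ + _).
    by rewrite !opprB addrC addrA subrK.
  have phi_p x : A x -> `|p - phi x| <= s / 2 + s / 4.
    move=> Ax; rewrite distrC.
    have -> : phi x - p = (phi x - phi p) + (y - F p) *m B.
      by rewrite [phi p]/phi opprD addrA subrK.
    apply: le_trans (ler_normD _ _) _; apply: lerD; last exact: VB.
    rewrite phiE; apply: le_trans (rT _ _ (sr _ Ax) (ballxx _ r0)) _.
    by rewrite distrC mulrC ler_pM2r // invr_gt0.
  have phiA : {homo phi : x / A x >-> A x}.
    by move=> x /phi_p h; rewrite /A /closed_ball_ /=; apply: le_trans h _; lra.
  have [|||x Ax xE] := @banach_fixed_point _ _ A (mkfun_fun phiA).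
  - exists (2^-1)%:nng => /=; split; first by rewrite /=; lra.
    move=> [x z] [/= Ax Az]; rewrite [X in `|X|]phiE.
    by apply: rT; exact: sr.
  - exact: closed_closed_ball_.
  - by exists p; rewrite /A /closed_ball_ /= subrr normr0 ltW.
  exists x => _; split.
    have := phi_p x Ax; rewrite -[phi x]/(mkfun_fun phiA x) -xE; lra.
  have : (y - F x) *m B = 0.
    by apply: (addrI x); rewrite addr0; exact: esym xE.
  move=> /(congr1 (fun M => M *m J p)); rewrite -mulmxA mulVmx // mulmx1 mul0mx.
  by move/subr0_eq.
have {solve} [G GP] := choice solve.
exists (ball p s `&` F @^-1` V), V, G.
have oV : open V by exact: ball_open.
have sb x : ball p s x -> ball p r x.
  by move=> h; apply: sr; move: h; rewrite -ball_normE => /ltW.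
have bs y : V y -> ball p s (G y) by move=> /GP[]; rewrite -ball_normE.
have Fc x : U0 x -> {for x, continuous F}.
  by move=> Ux; apply: continuous_row => i; exact: Ck_continuous (fC 0 i) Ux.
have GF x : ball p s x -> V (F x) -> G (F x) = x.
  move=> px Vx; have := expand _ _ (sb _ (bs _ Vx)) (sb _ px).
  rewrite (proj2 (GP _ Vx)) subrr mul0mx normr0 mulr0 normr_le0.
  by move/eqP/subr0_eq.
split; split=> //.
- rewrite openE => x [px Vx]; apply: filterI.
    by apply: open_nbhs_nbhs; split=> //; exact: ball_open.
  apply: (Fc x (proj1 (rU _ (sb _ px)))).
  exact: open_nbhs_nbhs.
- by split; exact: ballxx.
- by move=> x [px _]; exact: (proj1 (rU _ (sb _ px))).
- by move=> x [px Vx]; split=> //; exact: GF.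
- by move=> y Vy; have [_ E] := GP y Vy; split=> //; split; [exact: bs|rewrite /preimage /= E].
have Gd y : V y -> forall j,
    is_diff y (fun y => G y 0 j) (linear_form (fun i => invmx (J (G y)) i j)).
  move=> Vy j; set A := invmx (J (G y)).
  have [Ug ug] := rU _ (sb _ (bs _ Vy)).
  have [CA CA0 CAP] := mulmx_bounded A.
  apply: is_diff_estimate => [|eps eps0]; first exact: linear_form_continuous.
  pose e := eps / (CA * (2 * C)).
  have e0 : 0 < e by rewrite divr_gt0 ?mulr_gt0.
  have lin w l : (w *m J (G y)) 0 l = linear_form (fun i => 'D_(e_ i) (f l) (G y)) w.
    by rewrite mxE; apply: eq_bigr => i _; rewrite mxE mulrC.
  have Fd : \forall w \near (0 : 'rV[R]_n),
      `|F (w + G y) - F (G y) - w *m J (G y)| <= e * `|w|.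
    near=> w; apply: norm_rV_le => [|l]; first by rewrite mulr_ge0 // ltW.
    rewrite [X in `|X|](_ : _ = f l (w + G y) - (f l (G y) + (w *m J (G y)) 0 l)); last first.
      have subE (u v : 'rV[R]_n) : (u - v) 0 l = u 0 l - v 0 l by rewrite !mxE.
      by rewrite !subE !mxE opprD addrA.
    move: l; near: w; apply: filter_forall => l.
    have := Ck_is_diff oU0 Ug (fC 1 l) => -[d1 d2].
    move/diff_locallyP : d1; rewrite d2 => -[_ /eqaddoP/(_ _ e0)].
    by apply: filterS => w; rewrite lin.
  have Vn : \forall v \near (0 : 'rV[R]_n), V (v + y).
    have cadd : (fun v : 'rV[R]_n => v + y) @ (0 : 'rV[R]_n) --> (0 : 'rV[R]_n) + y.
      exact: (cvgD (@cvg_id _ _) (@cvg_cst _ y _ _ _)).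
    by apply: cadd; rewrite add0r; exact: open_nbhs_nbhs.
  have Glip v : V (v + y) -> `|G (v + y) - G y| <= 2 * C * `|v|.
    move=> Vv; apply: le_trans (expand _ _ (sb _ (bs _ Vv)) (sb _ (bs _ Vy))) _.
    by rewrite (proj2 (GP _ Vv)) (proj2 (GP _ Vy)) addrK -mulrA ler_pM2l.
  have /nbhs_ballP[d /= d0 dF] := Fd.
  have dn : 0 < d / (2 * C) by rewrite divr_gt0 ?mulr_gt0.
  have bn : nbhs (0 : 'rV[R]_n) (ball 0 (d / (2 * C))) by apply/nbhs_ballP; exists (d / (2 * C)).
  near=> v; have Vv : V (v + y) by near: v.
  have : `|F ((G (v + y) - G y) + G y) - F (G y) - (G (v + y) - G y) *m J (G y)|
      <= e * `|G (v + y) - G y|.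
    apply: dF; rewrite -ball_normE /= sub0r normrN.
    apply: le_lt_trans (Glip _ Vv) _.
    have : ball 0 (d / (2 * C)) v by near: v.
    by rewrite -ball_normE /= sub0r normrN ltr_pdivlMr ?mulr_gt0 // mulrC.
  rewrite subrK (proj2 (GP _ Vv)) (proj2 (GP _ Vy)) addrK.
  set w := G (v + y) - G y => h.
  have -> : G (v + y) 0 j - (G y 0 j + linear_form (fun i => A i j) v) =
      - (((v - w *m J (G y)) *m A) 0 j).
    have subE (u u' : 'rV[R]_n) : (u - u') 0 j = u 0 j - u' 0 j by rewrite !mxE.
    have -> : linear_form (fun i => A i j) v = (v *m A) 0 j.
      by rewrite mxE; apply: eq_bigr => i _; rewrite mulrC.
    by rewrite mulmxBl -mulmxA mulmxV // mulmx1 !subE; ring.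
  rewrite normrN; apply: le_trans (norm_rV_ge _ _) _.
  apply: le_trans (CAP _) _; apply: (@le_trans _ _ (CA * (e * (2 * C * `|v|)))).
    rewrite ler_pM2l //; apply: le_trans h _; rewrite ler_pM2l //; exact: Glip.
  rewrite le_eqVlt; apply/orP; left; apply/eqP; rewrite /e; field.
  by rewrite !gt_eqF.
have Gcont y : V y -> forall j, {for y, continuous (fun y => G y 0 j)}.
  by move=> Vy j; have [d _] := Gd y Vy j; exact: differentiable_continuous.
elim=> [|k IH] j; split=> //; try by move=> y Vy; exact: Gcont.
move=> i; split=> [y Vy|]; first by have [d _] := Gd y Vy j; exact: diff_derivable.
have : Ck k V (fun y => invmx (J (\row_l G y 0 l)) i j).
  have oU : open (ball p r) by exact: ball_open.
  apply: (@Ck_comp R k n n V (ball p r) (fun l y => G y 0 l) (fun x => invmx (J x) i j)) => //.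
    move=> y Vy; rewrite (_ : \row_l _ = G y); last by apply/rowP => l; rewrite mxE.
    exact: sb _ (bs _ Vy).
  apply: Ck_invmx => // [x /rU[]//|i' j'].
  by apply: Ck_sub (JC k i' j') => x /rU[].
apply: Ck_eq => // y Vy.
rewrite (_ : \row_l _ = G y); last by apply/rowP => l; rewrite mxE.
by have [d dE] := Gd y Vy j; rewrite deriveE // dE linear_form_e.
Unshelve. all: by end_near. Qed.

End InverseFunction.

(** * Smooth maps and charts *)

Lemma near_open (T : topologicalType) (x : T) (P : set T) :
  nbhs x P -> exists A : set T, [/\ open A, A x & A `<=` P].
Proof. by rewrite nbhsE => -[A [oA Ax] AP]; exists A. Qed.

Section SmoothNear.
Context {R : realType}.

Local Notation e_ i := (delta_mx 0 i).

Lemma smooth_near_eq n (x : 'rV[R]_n) f g :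
  (\forall y \near x, f y = g y) -> smooth_near x f -> smooth_near x g.
Proof.
move=> /near_open[A [oO Ox fg]] [U [oU Ux hU]].
have oUO : open (U `&` A) by exact: openI.
exists (U `&` A); split=> // k.
apply: (Ck_eq (f := f)) => //; first by move=> y [_ /fg].
by apply: Ck_sub (hU k) => y [].
Qed.

Lemma smooth_near_continuous n (x : 'rV[R]_n) f :
  smooth_near x f -> {for x, continuous f}.
Proof. by move=> [U [oU Ux hU]]; exact: (Ck_continuous (hU 0%N)). Qed.

(** A neighbourhood on which [f j] is C^k for all [k] comes with smoothness at the
    point, so finitely many functions have a common one. *)
Lemma smooth_near_family n (x : 'rV[R]_n) k (f : 'I_k -> 'rV[R]_n -> R) :
  (forall j, smooth_near x (f j)) ->
  exists U : set 'rV[R]_n, [/\ open U, U x & forall l j, Ck l U (f j)].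
Proof.
move=> /choice[U hU]; exists [set y | forall j, U j y]°; split.
- exact: open_interior.
- suff : \forall y \near x, forall j, U j y by [].
  apply: (@filter_forall _ _ U (nbhs x)) => j; have [oU Ux _] := hU j.
  exact: open_nbhs_nbhs.
- move=> l j; have [_ _ h] := hU j; apply: Ck_sub (h l).
  by move=> y /interior_subset; exact.
Qed.

Lemma smooth_near_comp n k (x : 'rV[R]_n) (f : 'I_k -> 'rV[R]_n -> R) g :
  (forall j, smooth_near x (f j)) -> smooth_near (\row_j f j x) g ->
  smooth_near x (fun y => g (\row_j f j y)).
Proof.
move=> /smooth_near_family[U [oU Ux hU]] [V [oV Vx hV]].
have fc y : U y -> {for y, continuous (fun y => \row_j f j y)}.
  by move=> Uy; apply: continuous_row => j; exact: Ck_continuous (hU 0%N j) Uy.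
pose W := U `&` ((fun y => \row_j f j y) @^-1` V)°.
exists W; split=> [||l].
- by apply: openI => //; exact: open_interior.
- by split=> //; apply: fc => //; exact: open_nbhs_nbhs.
- apply: (Ck_comp (V := V)) => //.
  + by apply: openI => //; exact: open_interior.
  + by move=> y [_ /interior_subset].
  + by move=> j; apply: Ck_sub (hU l j) => y [].
Qed.

Lemma smooth_near_cst n (x : 'rV[R]_n) (c : R) : smooth_near x (fun=> c).
Proof. by exists setT; split=> [||k]; [exact: openT| |exact: Ck_cst]. Qed.

Lemma smooth_near_coord n (x : 'rV[R]_n) j : smooth_near x (fun y : 'rV[R]_n => y 0 j).
Proof. by exists setT; split=> [||k]; [exact: openT| |exact: Ck_coord]. Qed.

Lemma smooth_nearD n (x : 'rV[R]_n) f g :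
  smooth_near x f -> smooth_near x g -> smooth_near x (fun y => f y + g y).
Proof.
move=> [U [oU Ux hU]] [V [oV Vx hV]].
have oUV : open (U `&` V) by exact: openI.
exists (U `&` V); split=> // k; apply: CkD => //.
  by apply: Ck_sub (hU k) => y [].
by apply: Ck_sub (hV k) => y [].
Qed.

Lemma smooth_nearM n (x : 'rV[R]_n) f g :
  smooth_near x f -> smooth_near x g -> smooth_near x (fun y => f y * g y).
Proof.
move=> [U [oU Ux hU]] [V [oV Vx hV]].
have oUV : open (U `&` V) by exact: openI.
exists (U `&` V); split=> // k; apply: CkM => //.
  by apply: Ck_sub (hU k) => y [].
by apply: Ck_sub (hV k) => y [].
Qed.

Lemma smooth_near_sum n (x : 'rV[R]_n) (I : Type) (r : seq I) (f : I -> 'rV[R]_n -> R) :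
  (forall i, smooth_near x (f i)) -> smooth_near x (fun y => \sum_(i <- r) f i y).
Proof.
move=> h; elim: r => [|i r IH].
  have -> : (fun y => \sum_(i <- [::]) f i y) = fun=> 0 by
    apply/funext => y; rewrite big_nil.
  exact: smooth_near_cst.
have -> : (fun y => \sum_(j <- i :: r) f j y) =
    fun y => f i y + \sum_(j <- r) f j y by apply/funext => y; rewrite big_cons.
exact: smooth_nearD.
Qed.

End SmoothNear.

Section SmoothAt.
Context {R : realType}.
Implicit Types M N Q : smoothSpace R.

Definition smooth_at M N (f : M -> N) (x : M) : Prop :=
  {for x, continuous f} /\
  forall a : N -> R, smooth_germ (f x) a -> smooth_germ x (a \o f).

Definition euclid (n : nat) : smoothSpace R :=
  @SmoothSpace R 'rV[R]_n (@smooth_near R n).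

Lemma smoothP M N (f : M -> N) : smooth f <-> forall x, smooth_at f x.
Proof.
split=> [[cf sf] x|h]; first by split=> [|a]; [exact: cf|exact: sf].
by split=> [x|x a]; [exact: (h x).1|exact: (h x).2].
Qed.

Lemma smooth_at_comp M N Q (f : M -> N) (g : N -> Q) x :
  smooth_at f x -> smooth_at g (f x) -> smooth_at (g \o f) x.
Proof.
move=> [cf sf] [cg sg]; split; first exact: continuous_comp.
by move=> a /sg/sf.
Qed.

Lemma smooth_comp M N Q (f : M -> N) (g : N -> Q) :
  smooth f -> smooth g -> smooth (g \o f).
Proof. by move=> /smoothP sf /smoothP sg; apply/smoothP => x; exact: smooth_at_comp. Qed.

Lemma smooth_at_id M (x : M) : smooth_at id x.
Proof. by split=> // ; exact: cvg_id. Qed.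

Lemma smooth_id M : smooth (id : M -> M).
Proof. by apply/smoothP => x; exact: smooth_at_id. Qed.

(** What is used of a manifold when maps are built out of it: its germs form
    a local ring closed under smooth operations. *)
Record regular_at M (x : M) : Prop := RegularAt {
  reg_eq : forall a b : M -> R, (\forall y \near x, a y = b y) ->
    smooth_germ x a -> smooth_germ x b;
  reg_comp : forall k (a : 'I_k -> M -> R) g, (forall j, smooth_germ x (a j)) ->
    smooth_near (\row_j a j x) g -> smooth_germ x (fun y => g (\row_j a j y));
  reg_cont : forall a : M -> R, smooth_germ x a -> {for x, continuous a} }.

Lemma regular_euclid n (x : euclid n) : regular_at x.
Proof.
split=> [a b|k a g|a]; [exact: smooth_near_eq|exact: smooth_near_comp|].
exact: smooth_near_continuous.
Qed.

Lemma smooth_at_eq M N (f g : M -> N) x : regular_at x ->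
  (\forall y \near x, f y = g y) -> smooth_at f x -> smooth_at g x.
Proof.
move=> rx fg [cf sf]; split; first exact: near_eq_continuous cf.
move=> a; rewrite -(nbhs_singleton fg) => /sf; apply: reg_eq => //.
by apply: filterS fg => y /= ->.
Qed.

Section ChartMaps.
Variables (M : smoothSpace R) (n : nat) (U : set M).
Variables (phi : M -> 'rV[R]_n) (psi : 'rV[R]_n -> M).

Lemma chart_fwd_at x : chart U phi psi -> U x -> @smooth_at M (euclid n) phi x.
Proof.
move=> c Ux; split=> [|a sa]; first exact: (chart_continuous c).
apply/(chart_smooth c Ux); apply: smooth_near_eq sa.
have oV : open (phi @` U) by exact: chart_open_im c.
have Vx : (phi @` U) (phi x) by exists x.
apply: filterS (open_nbhs_nbhs (conj oV Vx)) => _ [y Uy <-] /=.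
by rewrite (chartK c).
Qed.

Lemma chart_bwd_at x : chart U phi psi -> U x -> @smooth_at (euclid n) M psi (phi x).
Proof.
move=> c Ux; split=> [|a]; first exact: (chart_inv_continuous c).
by rewrite (chartK c) //; move/(chart_smooth c Ux).
Qed.

Lemma chart_regular x : chart U phi psi -> U x -> regular_at x.
Proof.
move=> c Ux; have sE := chart_smooth c Ux.
have pc : {for phi x, continuous psi} by exact: (chart_inv_continuous c).
split=> [a b ab|k a g sa sg|a].
- move/sE => sa; apply/sE; apply: smooth_near_eq sa.
  by have := pc; rewrite /prop_for /continuous_at (chartK c) // => /(_ _ ab).
- apply/sE; have := @smooth_near_comp R n k (phi x) (fun j => a j \o psi) g.
  apply; first by move=> j; exact/sE.
  by rewrite (_ : \row_j _ = \row_j a j x) //; apply/rowP => j; rewrite !mxE /= (chartK c).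
- move/sE => /smooth_near_continuous ca.
  have h : {for x, continuous ((a \o psi) \o phi)}.
    by apply: continuous_comp => //; exact: (chart_continuous c).
  apply: near_eq_continuous h.
  have oU : open U by exact: chart_open c.
  by apply: filterS (open_nbhs_nbhs (conj oU Ux)) => y Uy /=; rewrite (chartK c).
Qed.

Lemma chart_near_inv x : chart U phi psi -> U x ->
  \forall v \near phi x, phi (psi v) = v.
Proof.
move=> c Ux; have oV : open (phi @` U) by exact: chart_open_im c.
have Vx : (phi @` U) (phi x) by exists x.
apply: filterS (open_nbhs_nbhs (conj oV Vx)) => _ [y Uy <-] /=.
by rewrite (chartK c).
Qed.

(** Charts are mostly built from this criterion: [phi] and [psi] are smooth and
    inverse to each other locally. Smoothness of [psi] gives one half of the
    description of the germs on [M], that of [phi] the other. *)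
Lemma chart_of_smooth_at :
  open U -> (forall x, U x -> psi (phi x) = x) ->
  (forall x, U x -> \forall v \near phi x, phi (psi v) = v) ->
  (forall x (a b : M -> R), U x -> (\forall y \near x, a y = b y) ->
    smooth_germ x a -> smooth_germ x b) ->
  (forall x, U x -> @smooth_at M (euclid n) phi x) ->
  (forall x, U x -> @smooth_at (euclid n) M psi (phi x)) -> chart U phi psi.
Proof.
move=> oU K K' reg sphi spsi; split=> //.
- rewrite openE => _ [x Ux <-].
  have Up : \forall v \near phi x, U (psi v).
    by apply: (spsi x Ux).1; rewrite K //; exact: open_nbhs_nbhs.
  by apply: filterS2 Up (K' x Ux) => v Uv <-; exists (psi v).
- by move=> x /sphi[].
- by move=> x /spsi[].
move=> x Ux a; split=> [sa|sa].
  by have [_] := spsi x Ux; apply; rewrite K.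
have [_ /(_ _ sa)] := sphi x Ux; apply: reg => //.
by apply: filterS (open_nbhs_nbhs (conj oU Ux)) => y Uy /=; rewrite K.
Qed.

End ChartMaps.

Lemma manifold_regular M (x : M) : manifold M -> regular_at x.
Proof.
by move=> [_ /(_ x)[n [U [phi [psi [c Ux]]]]]]; exact: chart_regular c Ux.
Qed.

Lemma smooth_germ_coord M n (f : M -> 'rV[R]_n) x :
  @smooth_at M (euclid n) f x -> forall j, smooth_germ x (fun y => f y 0 j).
Proof. by move=> [_ sf] j; apply: (sf (fun v => v 0 j)); exact: smooth_near_coord. Qed.

Lemma smooth_at_row M n (f : M -> 'rV[R]_n) x : regular_at x ->
  (forall j, smooth_germ x (fun y => f y 0 j)) -> @smooth_at M (euclid n) f x.
Proof.
move=> rx h; have fE : f = fun y => \row_j f y 0 j.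
  by apply/funext => y; apply/rowP => j; rewrite mxE.
split=> [|a sa].
  by rewrite fE; apply: continuous_row => j; exact: reg_cont (h j).
rewrite fE; apply: (reg_comp rx) => //.
by rewrite (_ : \row_j _ = f x) //; apply/rowP => j; rewrite mxE.
Qed.

End SmoothAt.

(** * Initial structures and diffeomorphism invariance *)

Section InitialSpaces.
Context {R : realType}.
Implicit Types M N Q : smoothSpace R.

Section Initial.
Variables (I : Type) (M : I -> smoothSpace R) (S : Type) (pi : forall i, S -> M i).

Local Notation Z := (initial_space pi).

Lemma initial_cvg (F : set_system Z) (p : Z) : Filter F ->
  (forall i, (pi i : Z -> M i) @ F --> pi i p) -> F --> p.
Proof.
move=> FF h A [_ [[C oC <-] Cp] CA]; apply: filterS CA _.
pose e : Z -> prod_topology M := fun p i => pi i p.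
suff : e @ F --> e p by apply; exact: open_nbhs_nbhs.
apply/cvg_sup => i B [_ [[D oD <-] Dp] DB].
apply: filterS DB _; apply: (h i D); exact: open_nbhs_nbhs.
Qed.

Lemma initial_proj_continuous i : continuous (pi i : Z -> M i).
Proof.
move=> p; pose e : Z -> prod_topology M := fun p i => pi i p.
have ec : {for p, continuous e} by exact: initial_continuous.
have pc : {for e p, continuous (proj i : prod_topology M -> M i)}.
  move=> A; rewrite nbhsE => -[B [oB Bp] BA].
  have /cvg_sup/(_ i) : e p --> e p by exact: cvg_id.
  apply; exists (proj i @^-1` B); split=> [|//|q /BA//].
  by exists B.
exact: (continuous_comp ec pc).
Qed.

Lemma initial_proj_smooth i : smooth (pi i : Z -> M i).
Proof.
split=> [|p a sa]; first exact: initial_proj_continuous.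
exists 1%N, (fun=> i), (fun=> a), (fun v => v 0 0); split=> //.
  exact: smooth_near_coord.
by near=> q; rewrite mxE.
Unshelve. all: by end_near. Qed.

(** The universal property. A germ on [Z] is a smooth function of pullbacks of
    germs along the [pi i], so its composite with [f] is one of germs on [N], and
    regularity of [x] makes that smooth. *)
Lemma initial_map_smooth_at N (f : N -> Z) x : regular_at x ->
  (forall i, smooth_at (pi i \o f) x) -> smooth_at f x.
Proof.
move=> rx h.
have cf : {for x, continuous f}.
  by apply: initial_cvg => i; exact: (h i).1.
split=> // a [k [idx [b [g [sb sg E]]]]].
have E' : \forall y \near x, g (\row_j b j (pi (idx j) (f y))) = a (f y).
  by apply: (@filterS _ (nbhs x) _ _ _ _ (cf _ E)) => y /= ->.
apply: reg_eq E' _ => //.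
apply: (reg_comp rx (a := fun j y => b j (pi (idx j) (f y)))) => // j.
by have [_] := h (idx j); apply; exact: sb.
Qed.

Lemma initial_germ_eq (p : Z) (a b : Z -> R) :
  (\forall q \near p, a q = b q) -> smooth_germ p a -> smooth_germ p b.
Proof.
move=> ab [k [idx [c [g [sc sg E]]]]]; exists k, idx, c, g; split=> //.
by apply: filterS2 ab E => q <-.
Qed.

Lemma initial_row_smooth_at n (f : Z -> 'rV[R]_n) (p : Z) :
  (forall j, exists i (a : M i -> R), [/\ smooth_germ (pi i p) a,
     {for pi i p, continuous a} & forall q : Z, f q 0 j = a (pi i q)]) ->
  @smooth_at R Z (euclid n) f p.
Proof.
move=> /choice[idx h].
have [a aP] : {a : forall j, M (idx j) -> R & forall j, [/\ smooth_germ (pi (idx j) p) (a j),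
     {for pi (idx j) p, continuous (a j)} & forall q : Z, f q 0 j = a j (pi (idx j) q)]}.
  by exists (fun j => projT1 (cid (h j))) => j; exact: projT2 (cid (h j)).
have fE : f = fun q => \row_j a j (pi (idx j) q).
  by apply/funext => q; apply/rowP => j; rewrite mxE; have [_ _] := aP j.
split.
  rewrite fE; apply: continuous_row => j; have [_ ca _] := aP j.
  exact: (@continuous_comp Z (M (idx j)) R (pi (idx j)) (a j) p (@initial_proj_continuous (idx j) p) ca).
move=> g sg; exists n, idx, a, g; split=> [j||].
- by have [] := aP j.
- by move: sg; rewrite fE.
- by near=> q; rewrite fE.
Unshelve. all: by end_near. Qed.

End Initial.

Lemma second_countable_initial (T : topologicalType) (I : finType)
    (U : I -> topologicalType) (f : forall i, T -> U i) :
  (forall i, continuous (f i)) ->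
  (forall x (A : set T), nbhs x A -> exists C : forall i, set (U i),
     (forall i, nbhs (f i x) (C i)) /\ (forall y, (forall i, C i (f i y)) -> A y)) ->
  (forall i, @second_countable (U i)) -> @second_countable T.
Proof.
move=> fc fi sc.
have [e eP] : {e : forall i, nat -> set (U i) & forall i,
   (forall k, open (e i k)) /\
   forall x A, nbhs x A -> exists k, e i k x /\ e i k `<=` A}.
  suff h i : {e : nat -> set (U i) | (forall k, open (e k)) /\
      forall x A, nbhs x A -> exists k, e k x /\ e k `<=` A}.
    by exists (fun i => projT1 (h i)) => i; exact: projT2 (h i).
  apply: cid; have [B /countable_injP[f' f'inj] [oB bB]] := sc i.
  pose e k := xget set0 [set b | B b /\ f' b = k].
  have eB b : B b -> e (f' b) = b.
    move=> Bb; rewrite /e; case: xgetP => [c _ [Bc /f'inj]|/(_ b)]; last by case.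
    by rewrite !inE; apply.
  exists e; split=> [k|x A Ax]; last first.
    by have [b [Bb bx] bA] := bB x A Ax; exists (f' b); rewrite eB.
  by rewrite /e; case: xgetP => [c _ [/oB]|_] //; exact: open0.
pose B (k : {ffun I -> nat}) : set T := [set y | forall i, e i (k i) (f i y)].
have nB k x : B k x -> nbhs x (B k).
  move=> Bx; suff : \forall y \near x, forall i, e i (k i) (f i y) by [].
  apply: (@filter_forall _ _ (fun i y => e i (k i) (f i y)) (nbhs x)) => i.
  by apply: fc; apply: open_nbhs_nbhs; split; [exact: (eP i).1|exact: Bx].
exists (range B).
  exact: (sub_countable (card_image_le B setT) (countableP _)).
split=> [_ [k _ <-]|x A /fi[C [CN CA]]].
  by rewrite openE => x; exact: nB.
have /choice[k kP] i := (eP i).2 _ _ (CN i).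
exists (B [ffun i => k i]) => /=.
  by split; [exists [ffun i => k i]|move=> i; rewrite ffunE; exact: (kP i).1].
by move=> y By; apply: CA => i; apply: (kP i).2; have := By i; rewrite ffunE.
Qed.

Lemma initial_nbhs (I : finType) (M : I -> smoothSpace R) S (pi : forall i, S -> M i)
    (p : initial_space pi) (A : set (initial_space pi)) : nbhs p A ->
  exists C : forall i, set (M i), (forall i, nbhs (pi i p) (C i)) /\
    (forall q, (forall i, C i (pi i q)) -> A q).
Proof.
pose D := [set C : forall i, set (M i) | forall i, nbhs (pi i p) (C i)].
pose b (C : forall i, set (M i)) : set (initial_space pi) := [set q | forall i, C i (pi i q)].
have FF : Filter (filter_from D b).
  apply: filter_from_filter; first by exists (fun=> setT) => i; exact: filterT.
  move=> C C' DC DC'; exists (fun i => C i `&` C' i) => [i|q h].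
    by apply: filterI; [exact: DC|exact: DC'].
  by split=> i; have [] := h i.
have : filter_from D b --> p.
  apply: initial_cvg => i A' A'p.
  exists (fun j => [set y | forall e : j = i, A' (ecast k (M k) e y)]) => [j|q].
    have [e|ne] := pselect (j = i); last by apply: filterE => y e; case: ne.
    subst j; apply: filterS A'p => y A'y e.
    by rewrite (Prop_irrelevance e erefl).
  by move=> /(_ i erefl).
by move=> h /h[C DC CA]; exists C; split=> // q /CA.
Qed.

Lemma second_countable_initial_space (I : finType) (M : I -> smoothSpace R) S
    (pi : forall i, S -> M i) :
  (forall i, @second_countable (M i)) -> @second_countable (initial_space pi).
Proof.
move=> h; apply: (second_countable_initial (f := pi : forall i, initial_space pi -> M i)) => //.
  by move=> i; exact: initial_proj_continuous.
exact: initial_nbhs.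
Qed.

(** Charts are transported along the diffeomorphism. *)
Lemma manifold_diffeo M N (f : M -> N) (g : N -> M) : cancel f g -> cancel g f ->
  smooth f -> smooth g -> manifold N -> manifold M.
Proof.
move=> fK gK sf sg [scN chN]; have [cf gf] := sf; have [cg gg] := sg.
split.
  apply: (second_countable_initial (I := unit) (f := fun _ => f)) => // x A Ax.
  exists (fun _ => g @^-1` A); split=> [_|y /(_ tt)]; last by rewrite /preimage /= fK.
  by apply: cg; rewrite fK.
move=> x; have [n [U [phi [psi [c Ufx]]]]] := chN (f x).
have /smoothP sfa := sf; have /smoothP sga := sg.
exists n, (f @^-1` U), (phi \o f), (g \o psi); split=> //.
have K y : U (f y) -> (g \o psi) ((phi \o f) y) = y.
  by move=> Uy /=; rewrite (chartK c) ?fK.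
apply: chart_of_smooth_at => //.
- by move/continuousP : cf; apply; exact: chart_open c.
- move=> y Uy; have := chart_near_inv c Uy.
  by apply: filterS => v /= {2}<-; rewrite gK.
- move=> y a b Uy ab sa.
  have sag : smooth_germ (f y) (a \o g) by apply: (sga (f y)).2; rewrite fK.
  have ry : regular_at (f y) by apply: manifold_regular; split.
  have E : \forall z \near f y, (a \o g) z = (b \o g) z.
    by apply: (@filterS _ (nbhs (f y)) _ _ _ _ (cg (f y) _ _)); last by rewrite fK; exact: ab.
  have := (sfa y).2 _ (reg_eq ry E sag).
  by rewrite (_ : (b \o g) \o f = b) //; apply/funext => z /=; rewrite fK.
- move=> y Uy; apply: (@smooth_at_comp _ M N (euclid n) f phi); first exact: sfa.
  exact: chart_fwd_at c Uy.
- move=> y Uy; apply: (@smooth_at_comp _ (euclid n) N M psi g).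
    exact: chart_bwd_at c Uy.
  by rewrite /= (chartK c) //; exact: sga.
Qed.

End InitialSpaces.

Section InitialRegular.
Context {R : realType}.
Variables (I : Type) (M : I -> smoothSpace R) (S : Type) (pi : forall i, S -> M i).

(** Smooth functions of germs in an initial structure are again of the defining
    form, by concatenating the lists of functions they depend on. *)
Lemma initial_regular (p : initial_space pi) :
  (forall i, regular_at (pi i p)) -> regular_at p.
Proof.
move=> reg.
have cont k (idx : 'I_k -> I) (a : forall j, M (idx j) -> R) :
    (forall j, smooth_germ (pi (idx j) p) (a j)) ->
    forall j, {for p, continuous (fun q : initial_space pi => a j (pi (idx j) q))}.
  move=> sa j; apply: (@continuous_comp (initial_space pi) (M (idx j)) R (pi (idx j)) (a j)).
    exact: initial_proj_continuous.
  exact: (reg_cont (reg (idx j))).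
split=> [a b|k a g sa sg|a]; first exact: initial_germ_eq.
- have /choice[kk H1] := sa.
  have [idx H2] : {idx : forall j, 'I_(kk j) -> I & forall j,
      exists (b : forall l : 'I_(kk j), M (idx j l) -> R) (f : 'rV[R]_(kk j) -> R),
      [/\ forall l, smooth_germ (pi (idx j l) p) (b l),
        smooth_near (\row_l b l (pi (idx j l) p)) f &
        \forall q \near p, a j q = f (\row_l b l (pi (idx j l) q))]}.
    by exists (fun j => projT1 (cid (H1 j))) => j; exact: (projT2 (cid (H1 j))).
  have [b H3] : {b : forall j (l : 'I_(kk j)), M (idx j l) -> R & forall j,
      exists f : 'rV[R]_(kk j) -> R,
      [/\ forall l, smooth_germ (pi (idx j l) p) (b j l),
        smooth_near (\row_l b j l (pi (idx j l) p)) f &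
        \forall q \near p, a j q = f (\row_l b j l (pi (idx j l) q))]}.
    by exists (fun j => projT1 (cid (H2 j))) => j; exact: (projT2 (cid (H2 j))).
  have [f H4] : {f : forall j, 'rV[R]_(kk j) -> R & forall j,
      [/\ forall l, smooth_germ (pi (idx j l) p) (b j l),
        smooth_near (\row_l b j l (pi (idx j l) p)) (f j) &
        \forall q \near p, a j q = f j (\row_l b j l (pi (idx j l) q))]}.
    by exists (fun j => projT1 (cid (H3 j))) => j; exact: (projT2 (cid (H3 j))).
  pose T : finType := {j : 'I_k & 'I_(kk j)}.
  pose er j (l : 'I_(kk j)) : 'I_#|T| := enum_rank (Tagged (fun j => 'I_(kk j)) l : T).
  pose idx' (t : 'I_#|T|) : I := idx (tag (enum_val t)) (tagged (enum_val t)).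
  pose b' (t : 'I_#|T|) : M (idx' t) -> R := b (tag (enum_val t)) (tagged (enum_val t)).
  pose W q : 'rV[R]_#|T| := \row_t b' t (pi (idx' t) q).
  have WE q j l : W q 0 (er j l) = b j l (pi (idx j l) q).
    by rewrite mxE /b' /idx' enum_rankK.
  pose h j (v : 'rV[R]_#|T|) := f j (\row_l v 0 (er j l)).
  exists #|T|, idx', b', (fun v => g (\row_j h j v)); split.
  + by move=> t; have [sb _ _] := H4 (tag (enum_val t)); exact: sb.
  + have hE j : h j (W p) = a j p.
      have [_ _ /nbhs_singleton ->] := H4 j.
      by congr (f j _); apply/rowP => l; rewrite mxE WE mxE.
    apply: (@smooth_near_comp R _ _ (W p) h g); last first.
      by rewrite (_ : \row_j _ = \row_j a j p) //; apply/rowP => j; rewrite !mxE.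
    move=> j; apply: (@smooth_near_comp R _ _ (W p) (fun l v => v 0 (er j l)) (f j)).
      by move=> l; exact: smooth_near_coord.
    have [_ sf _] := H4 j; rewrite (_ : \row_l _ = \row_l b j l (pi (idx j l) p)) //.
    by apply/rowP => l; rewrite mxE WE mxE.
  + have : \forall q \near p, forall j, a j q = f j (\row_l b j l (pi (idx j l) q)).
      by apply: (@filter_forall _ _ (fun j q => a j q = _) (nbhs p)) => j; have [] := H4 j.
    apply: filterS => q aq; congr g; apply/rowP => j; rewrite !mxE aq.
    by congr (f j _); apply/rowP => l; rewrite [LHS]mxE [RHS]mxE; exact: esym (WE q j l).
- move=> [k [idx [b [g [sb sg E]]]]].
  have E' : \forall q \near p, g (\row_j b j (pi (idx j) q)) = a q.
    by apply: filterS E => q ->.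
  apply: near_eq_continuous E' _.
  apply: (@continuous_comp (initial_space pi) 'rV[R]_k R (fun q => \row_j b j (pi (idx j) q)) g).
    by apply: continuous_row => j; exact: cont.
  exact: smooth_near_continuous.
Qed.

End InitialRegular.

(** * Submersions *)

Section Submersions.
Context {R : realType}.
Implicit Types M N Q : smoothSpace R.

Local Notation e_ i := (delta_mx 0 i).

Lemma row_full_complement m n (A : 'M[R]_(m, n)) : row_full A ->
  exists k (L : 'M[R]_(m, k)), m = (n + k)%N /\ row_free (row_mx A L).
Proof.
move=> fA; pose K := row_base ((A^T)^C)%MS.
exists (\rank (A^T)^C)%MS, K^T.
have rA : \rank A^T = n by rewrite mxrank_tr; apply/eqP.
have rC : m = (n + \rank (A^T)^C)%N.
  by rewrite mxrank_compl rA subnKC // -rA mxrank_tr rank_leq_row.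
split=> //; rewrite /row_free -mxrank_tr tr_row_mx trmxK -addsmxE.
have := addsmx_compl_full A^T; rewrite /row_full => /eqP rT.
by rewrite (adds_eqmx (eqmx_refl A^T) (eq_row_base (A^T)^C%MS)) rT.
Qed.

Lemma is_diff_row m n (h : 'I_n -> 'rV[R]_m -> R) (c : 'I_n -> 'I_m -> R) x :
  (forall j, is_diff x (h j) (linear_form (c j))) ->
  is_diff x (fun y => \row_j h j y) (mulmxr (\matrix_(i, j) c j i)).
Proof.
move=> hd.
have E : (fun y => \row_j h j y) = \sum_j (fun y => h j y *: (e_ j : 'rV[R]_n)).
  apply/funext => y; rewrite fct_sumE; apply/rowP => j.
  rewrite !mxE summxE (bigD1 j) //= !mxE !eqxx mulr1 big1 ?addr0 // => i ij.
  by rewrite !mxE eqxx eq_sym (negbTE ij) mulr0.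
have d : differentiable (fun y => \row_j h j y) x.
  rewrite E; apply: differentiable_sum => j; apply: differentiableZl.
  by have [] := hd j.
split=> //; apply/funext => v.
rewrite -deriveE // derive_mx; last exact: diff_derivable.
apply/rowP => j; rewrite mxE [RHS]mxE.
have -> : (fun t : 'rV[R]_m => (\row_j0 h j0 t) 0 j) = h j by apply/funext => y; rewrite mxE.
have [dj djE] := hd j; rewrite deriveE // djE; apply: eq_bigr => i _.
by rewrite mxE mulrC.
Qed.

Lemma smooth_near_is_diff n (f : 'rV[R]_n -> R) x : smooth_near x f ->
  is_diff x f (linear_form (fun i => 'D_(e_ i) f x)).
Proof. by move=> [U [oU Ux hU]]; exact: Ck_is_diff oU Ux (hU 1%N). Qed.

Section ChartOperations.
Variables (M : smoothSpace R) (n : nat) (U : set M).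
Variables (phi : M -> 'rV[R]_n) (psi : 'rV[R]_n -> M).
Hypothesis c : chart U phi psi.

Lemma chart_germ_eq x (a b : M -> R) : U x -> (\forall y \near x, a y = b y) ->
  smooth_germ x a -> smooth_germ x b.
Proof. by move=> Ux; exact: (reg_eq (chart_regular c Ux)). Qed.

Lemma chart_restrict (W : set M) : open W -> chart (U `&` W) phi psi.
Proof.
move=> oW; have oU := chart_open c; split; first exact: openI.
- rewrite openE => _ [x [Ux Wx] <-].
  have UW : \forall v \near phi x, (U `&` W) (psi v).
    apply: (chart_inv_continuous c Ux); rewrite (chartK c) //.
    by apply: open_nbhs_nbhs; split=> //; exact: openI.
  by apply: filterS2 UW (chart_near_inv c Ux) => v UWv <-; exists (psi v).
- by move=> x [Ux _]; exact: (chartK c).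
- by move=> x [Ux _]; exact: (chart_continuous c).
- by move=> x [Ux _]; exact: (chart_inv_continuous c).
- by move=> x [Ux _]; exact: (chart_smooth c).
Qed.

(** [F] is a local diffeomorphism of Euclidean space with local inverse [G], and is
    composed with the chart where both are defined. *)
Lemma chart_change (U' : set 'rV[R]_n) (F G : 'rV[R]_n -> 'rV[R]_n) :
  open U' -> (forall x, U' x -> G (F x) = x) ->
  (forall x, U' x -> \forall v \near F x, F (G v) = v) ->
  (forall x, U' x -> @smooth_at R (euclid n) (euclid n) F x) ->
  (forall x, U' x -> @smooth_at R (euclid n) (euclid n) G (F x)) ->
  exists2 W : set M, open W & (forall x, U x -> U' (phi x) -> W x) /\
    chart (U `&` W) (F \o phi) (psi \o G).
Proof.
move=> oU' K K' sF sG; have oU := chart_open c.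
exists (phi @^-1` U')°; first exact: open_interior.
split.
  by move=> x Ux Ux'; apply: (chart_continuous c Ux); exact: open_nbhs_nbhs.
apply: chart_of_smooth_at.
- by apply: openI => //; exact: open_interior.
- by move=> x [Ux /interior_subset Ux'] /=; rewrite K // (chartK c).
- move=> x [Ux /interior_subset Ux'] /=.
  have h : \forall v \near F (phi x), phi (psi (G v)) = G v.
    have := (sG _ Ux').1; rewrite /prop_for /continuous_at K // => cG.
    exact: (cG _ (chart_near_inv c Ux)).
  by apply: filterS2 h (K' _ Ux') => v /= -> .
- by move=> x a b [Ux _]; exact: chart_germ_eq.
- move=> x [Ux /interior_subset Ux'].
  apply: (@smooth_at_comp _ M (euclid n) (euclid n) phi F); last exact: sF.
  exact: chart_fwd_at c Ux.
- move=> x [Ux /interior_subset Ux'].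
  apply: (@smooth_at_comp _ (euclid n) (euclid n) M G psi); first exact: sG.
  by rewrite /= K //; exact: chart_bwd_at c Ux.
Qed.

End ChartOperations.

Lemma smooth_at_germ_row M n (a : 'I_n -> M -> R) x : regular_at x ->
  (forall j, smooth_germ x (a j)) -> @smooth_at R M (euclid n) (fun y => \row_j a j y) x.
Proof.
move=> rx h; apply: smooth_at_row => // j.
by rewrite (_ : (fun y => _) = a j) //; apply/funext => y; rewrite mxE.
Qed.

(** Near any point a submersion is, in suitable charts, the projection onto the
    first coordinates: complete the coordinates of [f] by linear forms which are
    independent of its differential, and use the inverse function theorem. *)
Lemma submersion_normal_form M N (f : M -> N) (x : M) : submersion f ->
  exists n k (U : set M) (V : set N) (phi : M -> 'rV[R]_(n + k)) psi (phi' : N -> 'rV[R]_n) psi',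
    [/\ chart U phi psi, U x, chart V phi' psi' &
      forall y, U y -> V (f y) /\ lsubmx (phi y) = phi' (f y)].
Proof.
move=> [sf /(_ x)[m [n [U1 [V [phi1 [psi1 [phi' [psi']]]]]]]]] [c1 U1x c2 Vfx surj].
have /smoothP sfa := sf.
pose h (v : 'rV[R]_m) := phi' (f (psi1 v)).
pose p := phi1 x.
have sh : @smooth_at R (euclid m) (euclid n) h p.
  apply: (@smooth_at_comp _ (euclid m) M (euclid n) psi1 (phi' \o f)).
    exact: chart_bwd_at c1 U1x.
  rewrite (chartK c1) //; apply: (@smooth_at_comp _ M N (euclid n) f phi') => //.
  exact: chart_fwd_at c2 Vfx.
have shj j : smooth_near p (fun v => h v 0 j) := smooth_germ_coord sh j.
have dh := is_diff_row (fun j => smooth_near_is_diff (shj j)).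
have hE : (fun v => \row_j h v 0 j) = h by apply/funext => v; apply/rowP => j; rewrite mxE.
rewrite hE in dh.
set A := \matrix_(i, j) _ in dh.
have fA : row_full A.
  apply/row_fullP; have /choice[s sP] := surj.
  exists (\matrix_i s (e_ i)); apply/row_matrixP => i; rewrite row_mul rowK row1.
  by have := sP (e_ i); rewrite -[_ \o _]/h -/p; have [_ ->] := dh.
have [k [L [mE fL]]] := row_full_complement fA.
subst m.
pose f0 (j : 'I_(n + k)) (v : 'rV[R]_(n + k)) := row_mx (h v) (v *m L) 0 j.
have sf0 j : smooth_near p (f0 j).
  rewrite /f0; case: (split_ordP j) => j' ->.
    have -> // : (fun v => row_mx (h v) (v *m L) 0 (lshift k j')) = fun v => h v 0 j'.
    by apply/funext => v; rewrite row_mxEl.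
  have -> : (fun v => row_mx (h v) (v *m L) 0 (rshift n j')) =
      fun v : 'rV[R]_(n + k) => \sum_i v 0 i * L i j'.
    by apply/funext => v; rewrite row_mxEr mxE.
  apply: smooth_near_sum => i; apply: smooth_nearM; first exact: smooth_near_coord.
  exact: smooth_near_cst.
have [U0 [oU0 U0p CU0]] := smooth_near_family sf0.
have Jp : \matrix_(i, j) 'D_(e_ i) (f0 j) p = row_mx A L.
  apply/matrixP => i j; rewrite mxE /f0; case: (split_ordP j) => j' ->.
    rewrite row_mxEl mxE; congr (derive _ _ _).
    by apply/funext => v; rewrite row_mxEl.
  rewrite row_mxEr.
  have -> : (fun v => row_mx (h v) (v *m L) 0 (rshift n j')) = linear_form (fun i => L i j').
    apply/funext => v; rewrite row_mxEr mxE /linear_form.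
    by apply: eq_bigr => l _; rewrite mulrC.
  have lc := @linear_form_continuous R _ (fun i => L i j').
  rewrite deriveE; last exact: linear_differentiable.
  by rewrite diff_lin //; exact: linear_form_e.
have uJ : \matrix_(i, j) 'D_(e_ i) (f0 j) p \in unitmx by rewrite Jp -row_free_unit.
have [U2 [V2 [G [[oU2 U2p U20] [oV2 FG GF GC]]]]] := inverse_function oU0 U0p CU0 uJ.
pose F v : 'rV[R]_(n + k) := \row_j f0 j v.
have [||||W oW [WP cW]] := chart_change c1 (U' := U2) (F := F) (G := G) oU2.
- by move=> v /FG[].
- move=> v /FG[Vv _].
  by apply: filterS (open_nbhs_nbhs (conj oV2 Vv)) => y /GF[].
- move=> v U2v; apply: smooth_at_germ_row; first exact: regular_euclid.
  by move=> j; exists U0; split=> //; exact: U20.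
- move=> v /FG[Vv _]; apply: smooth_at_row; first exact: regular_euclid.
  by move=> j; exists V2; split.
have oD : open (f @^-1` V).
  by have /continuousP := sf.1; apply; exact: (chart_open c2).
have oU2' : open (phi1 @^-1` U2)° by exact: open_interior.
exists n, k, ((U1 `&` W) `&` (f @^-1` V)), V, (F \o phi1), (psi1 \o G), phi', psi'; split=> //.
- exact: chart_restrict.
- by split=> //; split=> //; apply: WP.
move=> y [[U1y Wy] Vy]; split=> //.
apply/rowP => j; rewrite mxE /= mxE /f0 row_mxEl /h.
by rewrite (chartK c1).
Qed.

(** In the normal form a section is [y |-> (y, constant)]. *)
Lemma submersion_section M N (f : M -> N) (x : M) : submersion f ->
  exists (V : set N) (s : N -> M), [/\ open V, V (f x), forall y, V y -> f (s y) = y &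
    forall y, V y -> smooth_at s y].
Proof.
move=> sf; have [n [k [U [V [phi [psi [phi' [psi' [c Ux c' UV]]]]]]]]] := submersion_normal_form x sf.
pose r : 'rV[R]_k := rsubmx (phi x).
pose u (y : N) := row_mx (phi' y) r.
have uE y : phi' y = lsubmx (u y) by rewrite row_mxKl.
pose V' := V `&` (u @^-1` (phi @` U))°.
have uc y : V y -> @smooth_at R N (euclid (n + k)) u y.
  move=> Vy; apply: smooth_at_row; first exact: chart_regular c' Vy.
  move=> j; rewrite /u; case: (split_ordP j) => j' ->.
    rewrite (_ : (fun y => _) = fun y => phi' y 0 j'); last by apply/funext => z; rewrite row_mxEl.
    exact: smooth_germ_coord (chart_fwd_at c' Vy) _.
  rewrite (_ : (fun y => _) = fun y => r 0 j'); last by apply/funext => z; rewrite row_mxEr.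
  have := reg_comp (chart_regular c' Vy) (k := 0) (a := fun _ _ => 0) (g := fun=> r 0 j').
  by apply; [case|exact: smooth_near_cst].
have Vfx : V (f x) by have [] := UV x Ux.
exists V', (psi \o u); split.
- by apply: openI; [exact: (chart_open c')|exact: open_interior].
- split=> //; apply: (uc _ Vfx).1; apply: open_nbhs_nbhs; split; first exact: (chart_open_im c).
  exists x => //; rewrite /u -(UV x Ux).2; exact: esym (hsubmxK _).
- move=> y [Vy /interior_subset[z Uz zE]] /=.
  rewrite -zE (chartK c) //; have [Vz zE'] := UV z Uz.
  by rewrite -(chartK c' Vz) -zE' zE row_mxKl (chartK c').
- move=> y [Vy /interior_subset[z Uz zE]].
  apply: (@smooth_at_comp _ N (euclid (n + k)) M u psi); first exact: uc.
  by rewrite -zE; exact: chart_bwd_at c Uz.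
Qed.
End Submersions.

(** * Open subspaces and fibre products *)

Section FibreProducts.
Context {R : realType}.
Implicit Types M N Q : smoothSpace R.

Local Notation e_ i := (delta_mx 0 i).

Lemma subspace_val_smooth M (P : M -> Prop) : smooth (sval : subspaceS P -> M).
Proof. exact: (@initial_proj_smooth R unit (fun=> M) _ (fun=> sval) tt). Qed.

Lemma subspace_eq M (P : M -> Prop) (p q : subspaceS P) : sval p = sval q -> p = q.
Proof. by move: p q => [p pP] [q qP] /= e; exact: eq_exist. Qed.

Lemma subspace_map_smooth_at M N (P : N -> Prop) (f : M -> subspaceS P) x :
  regular_at x -> smooth_at (sval \o f) x -> smooth_at f x.
Proof. by move=> rx h; exact: (@initial_map_smooth_at R unit (fun=> N) _ (fun=> sval)). Qed.

Lemma prod_fst_smooth M N : smooth (fst : prodS M N -> M).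
Proof.
exact: (@initial_proj_smooth R bool (fun b => if b then M else N) _
  (fun b => match b with true => fst | false => snd end) true).
Qed.

Lemma prod_snd_smooth M N : smooth (snd : prodS M N -> N).
Proof.
exact: (@initial_proj_smooth R bool (fun b => if b then M else N) _
  (fun b => match b with true => fst | false => snd end) false).
Qed.

Lemma prod_map_smooth_at M N Q (f : Q -> prodS M N) x : regular_at x ->
  @smooth_at R Q M (fst \o f) x -> @smooth_at R Q N (snd \o f) x -> smooth_at f x.
Proof.
by move=> rx h1 h2; apply: initial_map_smooth_at => // -[].
Qed.

Section OpenSubspace.
Variables (M : smoothSpace R) (U : set M).
Hypotheses (mM : manifold M) (oU : open U).

Lemma open_subspace_manifold : manifold (subspaceS U).
Proof.
split.
  by apply: (@second_countable_initial_space R unit (fun=> M)) => _; exact: mM.1.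
move=> x; have [n [W [phi [psi [c Wx]]]]] := mM.2 (sval x).
have cV := chart_restrict c oU.
(* Outside the image of the chart the inverse takes the value [x]. *)
pose psi' (v : 'rV[R]_n) : subspaceS U :=
  if pselect (U (psi v)) is left h then exist _ (psi v) h else x.
have psiE v : U (psi v) -> sval (psi' v) = psi v.
  by rewrite /psi'; case: pselect.
exists n, (sval @^-1` W), (phi \o sval), psi'; split=> //.
have Uv (y : subspaceS U) : W (sval y) -> \forall v \near phi (sval y), U (psi v).
  move=> Wy; have := chart_inv_continuous c Wy.
  rewrite /prop_for /continuous_at (chartK c) // => h.
  by apply: (h U); apply: open_nbhs_nbhs; split=> //; exact: svalP.
apply: chart_of_smooth_at.
- have /continuousP := (subspace_val_smooth U).1; apply; exact: (chart_open c).
- move=> y Wy; apply: subspace_eq; rewrite psiE /= (chartK c) //; exact: svalP.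
- move=> y Wy; apply: filterS2 (Uv y Wy) (chart_near_inv c Wy) => v Uv' /=.
  by rewrite psiE.
- by move=> y a b _; exact: initial_germ_eq.
- move=> y Wy; apply: (@smooth_at_comp _ (subspaceS U) M (euclid n) sval phi).
    by have /smoothP := subspace_val_smooth U.
  exact: chart_fwd_at c Wy.
- move=> y Wy; apply: subspace_map_smooth_at; first exact: regular_euclid.
  apply: smooth_at_eq (chart_bwd_at c Wy); first exact: regular_euclid.
  by apply: filterS (Uv y Wy) => v /psiE /= ->.
Qed.

End OpenSubspace.

Section FibreProduct.
Variables (M N Q : smoothSpace R) (f : M -> Q) (h : N -> Q).
Hypotheses (mM : manifold M) (mN : manifold N) (mQ : manifold Q).
Hypotheses (sf : submersion f) (sh : smooth h).

Local Notation Z := (fibre_product f h).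

Definition fp1 (z : Z) : M := (sval z).1.
Definition fp2 (z : Z) : N := (sval z).2.

Lemma fp1_smooth : smooth fp1.
Proof.
by apply: (@smooth_comp R Z (prodS M N) M sval fst);
  [exact: subspace_val_smooth|exact: prod_fst_smooth].
Qed.

Lemma fp2_smooth : smooth fp2.
Proof.
by apply: (@smooth_comp R Z (prodS M N) N sval snd);
  [exact: subspace_val_smooth|exact: prod_snd_smooth].
Qed.

Lemma fp_map_smooth_at Q' (g : Q' -> Z) x : regular_at x ->
  smooth_at (fp1 \o g) x -> smooth_at (fp2 \o g) x -> smooth_at g x.
Proof.
move=> rx h1 h2; apply: subspace_map_smooth_at => //.
exact: prod_map_smooth_at.
Qed.

Lemma fp_row_smooth_at n (g : Z -> 'rV[R]_n) (z : Z) :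
  (forall j, (exists a : M -> R, smooth_germ (fp1 z) a /\ forall q, g q 0 j = a (fp1 q)) \/
     (exists a : N -> R, smooth_germ (fp2 z) a /\ forall q, g q 0 j = a (fp2 q))) ->
  @smooth_at R Z (euclid n) g z.
Proof.
move=> H; apply: (@initial_row_smooth_at R unit (fun=> prodS M N) _ (fun=> sval)) => j.
exists tt; have [[a [sa aE]]|[a [sa aE]]] := H j.
- exists (fun p => a p.1); split=> //.
    by have /smoothP/(_ (sval z))[_] := @prod_fst_smooth M N; apply.
  apply: (@continuous_comp (prodS M N) M R fst a); first exact: (@prod_fst_smooth M N).1.
  exact: (reg_cont (manifold_regular _ mM)).
- exists (fun p => a p.2); split=> //.
    by have /smoothP/(_ (sval z))[_] := @prod_snd_smooth M N; apply.
  apply: (@continuous_comp (prodS M N) N R snd a); first exact: (@prod_snd_smooth M N).1.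
  exact: (reg_cont (manifold_regular _ mN)).
Qed.

(** In the normal form of the submersion [f], the points of the fibre product
    over a point of [N] are parametrized by the last coordinates. *)
Lemma fibre_product_manifold : manifold Z.
Proof.
split.
  apply: (@second_countable_initial_space R unit (fun=> prodS M N)) => _.
  by apply: (@second_countable_initial_space R bool) => -[]; [exact: mM.1|exact: mN.1].
move=> z0; have [n [k [U [V [phi [psi [phi' [psi' [c Uz c' UV]]]]]]]]] :=
  submersion_normal_form (fp1 z0) sf.
have [l [W [chi [chi' [d Wz]]]]] := mN.2 (fp2 z0).
(* [phi] splits as (coordinates of [f], fibre coordinates); the former are
   determined by [h] of the second component, so the fibre coordinates and those of
   the second component are coordinates on [Z]. *)
pose Phi (z : Z) : 'rV[R]_(k + l) := row_mx (rsubmx (phi (fp1 z))) (chi (fp2 z)).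
pose nn (w : 'rV[R]_(k + l)) := chi' (rsubmx w).
pose u (w : 'rV[R]_(k + l)) := row_mx (phi' (h (nn w))) (lsubmx w).
pose mm w := psi (u w).
pose Psi w : Z := if pselect (f (mm w) = h (nn w)) is left e then exist _ (mm w, nn w) e else z0.
have PsiE w : f (mm w) = h (nn w) -> fp1 (Psi w) = mm w /\ fp2 (Psi w) = nn w.
  by rewrite /Psi; case: pselect.
pose D : set Z := [set z | U (fp1 z) /\ W (fp2 z)].
have nnK z : D z -> nn (Phi z) = fp2 z.
  by move=> [_ Wz']; rewrite /nn row_mxKr (chartK d).
have uK z : D z -> u (Phi z) = phi (fp1 z).
  move=> Dz; rewrite /u nnK // row_mxKl -(svalP z) -/(fp1 z).
  by rewrite -(UV _ Dz.1).2 hsubmxK.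
have mmK z : D z -> mm (Phi z) = fp1 z.
  by move=> Dz; rewrite /mm uK // (chartK c) //; exact: Dz.1.
have snn z : D z -> @smooth_at R (euclid (k + l)) N nn (Phi z).
  move=> [_ Wz']; apply: (@smooth_at_comp _ (euclid (k + l)) (euclid l) N (@rsubmx _ _ _ _) chi').
    apply: smooth_at_row; first exact: regular_euclid.
    move=> j; have -> : (fun y : 'rV[R]_(k + l) => rsubmx y 0 j) = fun y => y 0 (rshift k j).
      by apply/funext => y; rewrite mxE.
    exact: smooth_near_coord.
  by rewrite row_mxKr; exact: chart_bwd_at d Wz'.
have Vh z : D z -> V (h (fp2 z)) by move=> Dz; rewrite -(svalP z); exact: (UV _ Dz.1).1.
have su z : D z -> @smooth_at R (euclid (k + l)) (euclid (n + k)) u (Phi z).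
  move=> Dz; have rE := @regular_euclid R (k + l) (Phi z).
  apply: smooth_at_row => // j; rewrite /u; case: (split_ordP j) => j' ->; last first.
    have -> : (fun w => row_mx (phi' (h (nn w))) (lsubmx w) 0 (rshift n j')) =
        fun w => w 0 (lshift l j') by apply/funext => w; rewrite row_mxEr mxE.
    exact: smooth_near_coord.
  have -> : (fun w => row_mx (phi' (h (nn w))) (lsubmx w) 0 (lshift k j')) =
        fun w => phi' (h (nn w)) 0 j' by apply/funext => w; rewrite row_mxEl.
  apply: (@smooth_germ_coord R (euclid (k + l)) n (fun w => phi' (h (nn w))) (Phi z)).
  apply: (@smooth_at_comp _ (euclid (k + l)) N (euclid n) nn (phi' \o h)); first exact: snn.
  rewrite nnK //; apply: (@smooth_at_comp _ N Q (euclid n) h phi').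
    by have /smoothP := sh.
  by apply: chart_fwd_at c' _; exact: Vh.
have nE z : D z -> \forall w \near Phi z,
    [/\ f (mm w) = h (nn w), phi (mm w) = u w & chi (nn w) = rsubmx w].
  move=> Dz; have Vn : \forall w \near Phi z, V (h (nn w)).
    have hc := sh.1 (fp2 z); have := (snn z Dz).1.
    rewrite /prop_for /continuous_at nnK // => nc.
    apply: (nc (h @^-1` V)); apply: hc; apply: open_nbhs_nbhs.
    by split; [exact: (chart_open c')|exact: Vh].
  have uc := (su z Dz).1; rewrite /prop_for /continuous_at uK // in uc.
  have pu : \forall w \near Phi z, phi (psi (u w)) = u w := uc _ (chart_near_inv c Dz.1).
  have Un : \forall w \near Phi z, U (psi (u w)).
    have h1 := chart_inv_continuous c Dz.1; rewrite /prop_for /continuous_at (chartK c Dz.1) in h1.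
    apply: (uc (psi @^-1` U)); apply: (h1 U); apply: open_nbhs_nbhs; split; last exact: Dz.1.
    exact: (chart_open c).
  have cd : \forall w \near Phi z, chi (chi' (rsubmx w)) = rsubmx w.
    have rc : {for Phi z, continuous (@rsubmx R 1 k l)}.
      by apply: differentiable_continuous; exact: differentiable_rsubmx.
    rewrite /prop_for /continuous_at row_mxKr in rc.
    exact: (rc _ (chart_near_inv d Dz.2)).
  near=> w; have e1 : phi (mm w) = u w by near: w.
  split=> //; last by near: w.
  have [Vw E] : V (f (mm w)) /\ lsubmx (phi (mm w)) = phi' (f (mm w)).
    by apply: UV; near: w.
  have Vw' : V (h (nn w)) by near: w.
  by rewrite -(chartK c' Vw) -E e1 row_mxKl (chartK c').
exists (k + l)%N, D, Phi, Psi; split=> //; apply: chart_of_smooth_at.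
- have -> : D = fp1 @^-1` U `&` fp2 @^-1` W by [].
  apply: openI.
    by have /continuousP := fp1_smooth.1; apply; exact: (chart_open c).
  by have /continuousP := fp2_smooth.1; apply; exact: (chart_open d).
- move=> z Dz; have [e _ _] := nbhs_singleton (nE z Dz); have [e1 e2] := PsiE _ e.
  apply: subspace_eq; rewrite [LHS]surjective_pairing [RHS]surjective_pairing.
  by rewrite -/(fp1 _) -/(fp2 _) e1 e2 mmK // nnK.
- move=> z Dz; apply: filterS (nE z Dz) => w [e1 e2 e3].
  by have [E1 E2] := PsiE _ e1; rewrite /Phi E1 E2 e2 e3 row_mxKr hsubmxK.
- by move=> z a b _; exact: initial_germ_eq.
- move=> z Dz; apply: fp_row_smooth_at => j; rewrite /Phi; case: (split_ordP j) => j' ->.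
    left; exists (fun m => phi m 0 (rshift n j')); split; last first.
      by move=> q; rewrite row_mxEl mxE.
    exact: (smooth_germ_coord (chart_fwd_at c Dz.1)).
  right; exists (fun m => chi m 0 j'); split; last by move=> q; rewrite row_mxEr.
  exact: (smooth_germ_coord (chart_fwd_at d Dz.2)).
- move=> z Dz; have rE := @regular_euclid R (k + l) (Phi z).
  have E1 : \forall w \near Phi z, fp1 (Psi w) = mm w.
    by apply: filterS (nE z Dz) => w [/PsiE[]].
  have E2 : \forall w \near Phi z, fp2 (Psi w) = nn w.
    by apply: filterS (nE z Dz) => w [/PsiE[]].
  apply: fp_map_smooth_at => //.
    apply: (@smooth_at_eq _ (euclid (k + l)) M mm) => //; first by apply: filterS E1 => w <-.
    apply: (@smooth_at_comp _ (euclid (k + l)) (euclid (n + k)) M u psi); first exact: su.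
    by rewrite uK //; exact: chart_bwd_at c Dz.1.
  apply: (@smooth_at_eq _ (euclid (k + l)) N nn) => //; first by apply: filterS E2 => w <-.
  exact: snn.
Unshelve. all: by end_near. Qed.

End FibreProduct.
End FibreProducts.

(** * Bump functions and countable covers *)

Section FlatFunctions.
Context {R : realType}.

Local Notation e_ i := (delta_mx 0 i).

(** The functions t^-j exp(-1/t), extended by 0 to the negative half line: the
    derivative of one of them is a combination of the next two. *)
Definition flat (j : nat) (t : R) : R :=
  if 0 < t then t^-1 ^+ j * expR (- t^-1) else 0.

(** The bound t^2 makes these functions continuous and differentiable at 0. *)
Lemma flat_le j : exists2 C : R, 0 < C & forall t, `|flat j t| <= C * t ^+ 2.
Proof.
exists ((j.+2)`!%:R) => [|t]; first by rewrite ltr0n fact_gt0.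
have F0 : 0 < (j.+2)`!%:R :> R by rewrite ltr0n fact_gt0.
rewrite /flat; case: ltP => t0; last by rewrite normr0 mulr_ge0 ?sqr_ge0 // ltW.
have s0 : 0 < t^-1 by rewrite invr_gt0.
rewrite ger0_norm; last by rewrite mulr_ge0 ?expR_ge0 // exprn_ge0 // ltW.
rewrite expRN ler_pdivrMr ?expR_gt0 //.
have := expR_ge1Dxn j.+1 (ltW s0).
set e := expR _ => h.
have {}h : t^-1 ^+ j.+2 <= (j.+2)`!%:R * e.
  by rewrite mulrC -ler_pdivrMr //; apply: le_trans h; rewrite lerDr.
have -> : t^-1 ^+ j = t ^+ 2 * t^-1 ^+ j.+2.
  by rewrite !exprS mulrACA; field; rewrite gt_eqF.
by rewrite [leRHS]mulrAC [leLHS]mulrC ler_pM2r ?exprn_gt0.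
Qed.

Lemma is_derive_flat (j : nat) (t : R) : is_derive t (1 : R) (flat j) (flat j.+2 t - j%:R * flat j.+1 t).
Proof.
have [t0|t0|t0] := ltgtP t 0.
- have E : \forall u \near t, cst 0 u = flat j u.
    near=> u; have u0 : u < 0 by near: u; exact: lt_nbhsl.
    by rewrite /flat ltNge ltW.
  apply: near_eq_is_derive E _; rewrite /flat !ltNge ltW //= mulr0 subr0.
  exact: is_derive_cst.
- have E : \forall u \near t, (fun u => u^-1 ^+ j * expR (- u^-1)) u = flat j u.
    near=> u; have u0 : 0 < u by near: u; exact: lt_nbhsr.
    by rewrite /flat u0.
  apply: near_eq_is_derive E _; rewrite /flat t0.
  pose g (s : R) := s ^+ j * expR (- s).
  have tn0 : t != 0 by rewrite gt_eqF.
  have di : is_derive t 1 (fun u : R => u^-1) (- t ^- 2).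
    by have := @is_deriveV R id t 1 1 tn0 (is_derive_id _ _); rewrite -[_ *: 1]/(_ * 1) mulr1.
  have dg (s : R) : is_derive s 1 g (j%:R * s ^+ j.-1 * expR (- s) - s ^+ j * expR (- s)).
    have d1 : is_derive s 1 (fun s : R => s ^+ j) (j%:R * s ^+ j.-1).
      by split; [exact: exprn_derivable|rewrite exp_derive -[_ *: _]/(_ * 1) mulr1 -mulr_natl].
    have d2 : is_derive s 1 (expR \o -%R) (expR (- s) * -1).
      by apply: is_derive1_comp.
    have [h1 h2] := is_deriveM d1 d2; split=> //; rewrite h2 /=.
    by rewrite -[X in X + _]/(_ * _) -[X in _ + X]/(_ * _); ring.
  have [h1 h2] := is_derive1_comp (dg t^-1) di; split=> //; rewrite [LHS]h2.
  case: j @g dg {h1 h2} => [|j] g dg /=; first by rewrite !exprVn; field.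
  rewrite !(exprS t^-1); move: (t^-1 ^+ j) => P; field; exact: tn0.
subst t.
have [C C0 hC] := flat_le j.
have f0 i : flat i 0 = 0 by rewrite /flat ltxx.
rewrite !f0 mulr0 subr0.
have d : is_diff 0 (flat j) (\0 : R -> R).
  apply: (@is_diff_estimate R R R (flat j) \0); first exact: cst_continuous.
  move=> eps eps0; near=> v.
  rewrite addr0 f0 add0r subr0; apply: le_trans (hC v) _.
  rewrite -(real_normK (num_real v)) expr2 mulrA ler_wpM2r // mulrC -ler_pdivlMr //.
  have : ball 0 (eps / C) v.
    by near: v; apply/nbhs_ballP; exists (eps / C) => //=; rewrite divr_gt0.
  by rewrite -ball_normE /= sub0r normrN => /ltW.
have [d1 d2] := d; split; first exact: diff_derivable.
by rewrite deriveE // d2.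
Unshelve. all: by end_near. Qed.

Lemma Ck_flat k j n (U : set 'rV[R]_n) (q : 'rV[R]_n -> R) : open U ->
  (forall k, Ck k U q) -> Ck k U (fun x => flat j (q x)).
Proof.
move=> oU hq.
have dq x : U x -> differentiable q x by move=> Ux; have [] := Ck_is_diff oU Ux (hq 1%N).
have df i t : differentiable (flat i) t.
  by apply/derivable1_diffP; have [] := is_derive_flat i t.
have dfq i x : U x -> differentiable (flat i \o q) x.
  by move=> Ux; apply: differentiable_comp; [exact: dq|exact: df].
elim: k j => [|k IH] j; split=> //.
1,2: by move=> x Ux; apply: differentiable_continuous; exact: dfq.
move=> i; split=> [x Ux|]; first by exact: (diff_derivable (dfq j x Ux)).
have q1 : Ck k U ('D_(e_ i) q) by have [_ h] := hq k.+1; exact: (h i).2.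
have := CkM oU (CkD oU (IH j.+2) (CkM oU (Ck_cst k U (- j%:R)) (IH j.+1))) q1.
apply: Ck_eq => // x Ux.
rewrite (deriveE _ (dfq j x Ux)).
rewrite (diff_comp (dq x Ux) (df j _)).
rewrite /= -(deriveE _ (dq x Ux)).
have [d1 d2] := is_derive_flat j (q x).
by rewrite (deriv1E d1) derive1E d2 -[RHS]/(_ * _) mulrC mulNr.
Qed.

(** With [s] the squared Euclidean distance to [p] and f the flat function, take
    f(r^2 - s) / (f(r^2 - s) + f(s - r^2/4)). The norm is the maximum norm, so that
    r < |p - x| implies r^2 < s. *)
Lemma bump_rV n (p : 'rV[R]_n) (r : R) : 0 < r -> exists b : 'rV[R]_n -> R,
  [/\ forall x, smooth_near x b, forall x, r < `|p - x| -> b x = 0 &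
      \forall x \near p, b x = 1].
Proof.
move=> r0; pose s (x : 'rV[R]_n) := \sum_i (x 0 i - p 0 i) * (x 0 i - p 0 i).
have sC k : Ck k setT s.
  have oT : open [set: 'rV[R]_n] by exact: openT.
  have c1 i : Ck k setT (fun x : 'rV[R]_n => x 0 i - p 0 i).
    by apply: CkD => //; [exact: Ck_coord|exact: Ck_cst].
  by apply: Ck_sum => // i _; apply: CkM.
pose A x := flat 0 (r ^+ 2 - s x); pose B x := flat 0 (s x - (r / 2) ^+ 2).
have oT : open [set: 'rV[R]_n] by exact: openT.
have AC k : Ck k setT A.
  apply: Ck_flat => // k'; have := CkD oT (Ck_cst k' setT (r ^+ 2)) (CkM oT (Ck_cst k' setT (-1)) (sC k')).
  by apply: Ck_eq => // x _; rewrite mulN1r.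
have BC k : Ck k setT B.
  by apply: Ck_flat => // k'; apply: CkD => //; exact: Ck_cst.
have fp t : 0 < t -> 0 < flat 0 t by move=> t0; rewrite /flat t0 mul1r expR_gt0.
have fn t : t <= 0 -> flat 0 t = 0 by move=> t0; rewrite /flat ltNge t0.
have f0 t : 0 <= flat 0 t by have [/fn->//|/fp/ltW] := leP t 0.
have rr : (r / 2) ^+ 2 < r ^+ 2 by rewrite ltr_pXn2r ?nnegrE ?divr_ge0 ?ltW //; lra.
have AB x : A x + B x != 0.
  rewrite gt_eqF //; have [h|h] := ltP (s x) (r ^+ 2).
    by apply: ltr_pwDl; [apply: fp; rewrite subr_gt0|exact: f0].
  by apply: ltr_wpDl; [exact: f0|apply: fp; rewrite subr_gt0 (lt_le_trans rr)].
exists (fun x => A x * (A x + B x)^-1); split.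
- move=> x; exists setT; split=> // k; apply: CkM => //; apply: CkV => //.
  exact: CkD.
- move=> x rx; rewrite [A x]fn ?mul0r // subr_le0.
  have [i ri] : exists i, r < `|(p - x) 0 i|.
    apply: contrapT => /forallNP h; move: rx; rewrite ltNge; apply/negP/negPn.
    by apply: norm_rV_le => [|i]; [exact: ltW|rewrite leNgt; apply/negP/h].
  rewrite /s (bigD1 i) //=; apply: ler_wpDr.
    by apply: sumr_ge0 => j' _; rewrite -expr2 sqr_ge0.
  rewrite -expr2 -[leRHS](real_normK (num_real _)) ler_pXn2r ?nnegrE ?normr_ge0 ?(ltW r0) //.
  by move: ri; rewrite !mxE distrC => /ltW.
- have sp : s p = 0 by apply: big1 => k _; rewrite subrr mul0r.
  have : \forall x \near p, s x < (r / 2) ^+ 2.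
    have c : {for p, continuous s} by apply: Ck_continuous (sC 0%N) _.
    by apply: (cvgr_lt _ c); rewrite sp exprn_gt0 // divr_gt0.
  apply: filterS => x sx; rewrite [B x]fn ?addr0; last by rewrite subr_le0 ltW.
  by rewrite divff // gt_eqF // fp // subr_gt0 (lt_trans sx).
Qed.

End FlatFunctions.

Section BumpFunctions.
Context {R : realType}.
Implicit Types M N : smoothSpace R.

Lemma smooth_germ_cst N (x : N) (c : R) : regular_at x -> smooth_germ x (fun=> c).
Proof.
move=> rx; have := reg_comp rx (k := 0) (a := fun _ _ => 0) (g := fun=> c).
by apply; [case|exact: smooth_near_cst].
Qed.

(** On a Hausdorff manifold bump functions of charts extend by zero, because
    their compact supports are closed. *)
Lemma bump_function N (y : N) (U : set N) : manifold N -> hausdorff_space N ->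
  open U -> U y -> exists (b : N -> R) (V K : set N),
  [/\ forall x, smooth_germ x b, open V /\ V y, forall x, V x -> b x = 1 &
      [/\ closed K, K `<=` U & forall x, ~ K x -> b x = 0]].
Proof.
move=> mN hN oU Uy; have [n [W0 [phi [psi [c0 W0y]]]]] := mN.2 y.
pose W := W0 `&` U; have c : chart W phi psi by exact: chart_restrict.
have Wy : W y by [].
have oP := chart_open_im c; have [r0 /= r00 rP] : nbhs_ball (phi y) (phi @` W).
  by apply/nbhs_ballP; apply: open_nbhs_nbhs; split=> //; exists y.
pose r := r0 / 2; have rp : 0 < r by rewrite divr_gt0.
pose C := closed_ball_ (@Num.Def.normr _ 'rV[R]_n) (phi y) r.
have CP : C `<=` phi @` W.
  move=> v; rewrite /C /closed_ball_ /= => h; apply: rP.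
  by rewrite -ball_normE /=; apply: le_lt_trans h _; rewrite /r; lra.
have [b [sb b0 b1]] := bump_rV (phi y) rp.
pose K := psi @` C.
have KW : K `<=` W by move=> _ [v /CP[x Wx <-] <-]; rewrite (chartK c).
have cK : closed K.
  apply: compact_closed => //; apply: continuous_compact.
    apply: continuous_in_subspaceT => v; rewrite inE => /CP[x Wx <-].
    exact: (chart_inv_continuous c).
  apply: bounded_closed_compact; last exact: closed_closed_ball_.
  exists (`|phi y| + r); split; first exact: num_real.
  move=> M hM v; rewrite /C /closed_ball_ /= => h; apply: ltW; apply: le_lt_trans hM.
  have -> : v = phi y - (phi y - v) by rewrite opprB addrC subrK.
  by apply: le_trans (ler_normB _ _) _; rewrite lerD2l.
pose beta x := if `[< W x >] then b (phi x) else 0.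
have bK x : ~ K x -> beta x = 0.
  move=> nK; rewrite /beta; case: asboolP => // Wx; apply: b0.
  rewrite ltNge; apply/negP => h; apply: nK; exists (phi x) => //.
  exact: (chartK c).
have bW x : W x -> \forall z \near x, b (phi z) = beta z.
  move=> Wx; apply: filterS (open_nbhs_nbhs (conj (chart_open c) Wx)) => z Wz.
  by rewrite /beta asboolT.
have [V [oV Vy VE]] : exists V : set N, [/\ open V, V y & V `<=` [set x | beta x = 1]].
  apply: near_open; have := chart_continuous c Wy => /(_ _ b1) h.
  by apply: filterS2 (bW y Wy) h => z /= <-.
exists beta, V, K; split=> //; last by split=> // x /KW[].
move=> x; have rx := manifold_regular x mN.
have [Kx|nKx] := pselect (K x).
  have Wx := KW _ Kx; apply: (reg_eq rx (bW x Wx)).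
  exact: (chart_fwd_at c Wx).2 _ (sb _).
apply: (reg_eq rx (a := fun=> 0)); last exact: smooth_germ_cst.
have oK : open (~` K) by rewrite openC.
by apply: filterS (open_nbhs_nbhs (conj oK nKx)) => z /bK ->.
Qed.

(** One member of the cover is chosen for each basic open set contained in a
    member; the numbers that code no such set get the empty set. *)
Lemma countable_subcover (T : topologicalType) (P : set T -> Prop) :
  @second_countable T -> P set0 ->
  (forall x : T, exists V : set T, [/\ open V, V x & P V]) ->
  exists V : nat -> set T, [/\ forall n, open (V n), forall n, P (V n) &
    forall x, exists n, V n x].
Proof.
move=> [B /countable_injP[f finj] [oB bB]] P0 h.
have good (k : nat) : exists V : set T, [/\ open V, P V &
    forall W b, open W -> P W -> B b -> f b = k -> b `<=` W -> b `<=` V].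
  have [[W [b [oW PW Bb fb bW]]]|nW] :=
      pselect (exists W b, [/\ open W, P W, B b, f b = k & b `<=` W]).
    exists W; split=> // W' b' oW' PW' Bb' fb' _.
    by rewrite (_ : b' = b) //; apply: finj; rewrite ?inE // fb'.
  exists set0; split=> //; first exact: open0.
  by move=> W b oW PW Bb fb bW; exfalso; apply: nW; exists W, b.
have [V hV] := choice good; exists V; split.
- by move=> k; have [] := hV k.
- by move=> k; have [] := hV k.
- move=> x; have [W [oW Wx PW]] := h x.
  have [b [Bb bx] bW] := bB x W (open_nbhs_nbhs (conj oW Wx)).
  by exists (f b); have [_ _ g] := hV (f b); exact: (g W b oW PW Bb erefl bW x bx).
Qed.

End BumpFunctions.

(** * Solving linear equations in sheaves of modules *)

Section SheafSections.
Context {R : realType}.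

Lemma smooth_germD (N : smoothSpace R) (x : N) (a b : N -> R) : regular_at x ->
  smooth_germ x a -> smooth_germ x b -> smooth_germ x (fun y => a y + b y).
Proof.
move=> rx sa sb.
pose ab (j : 'I_2) := if j == 0 then a else b.
have -> : (fun y => a y + b y) = fun y => (\row_j ab j y) 0 0 + (\row_j ab j y) 0 1.
  by apply/funext => y; rewrite !mxE.
apply: (reg_comp rx (a := ab) (g := fun v => v 0 0 + v 0 1)).
  by move=> j; rewrite /ab; case: ifP.
by apply: smooth_nearD; exact: smooth_near_coord.
Qed.

Lemma smooth_germM (N : smoothSpace R) (x : N) (a b : N -> R) : regular_at x ->
  smooth_germ x a -> smooth_germ x b -> smooth_germ x (fun y => a y * b y).
Proof.
move=> rx sa sb.
pose ab (j : 'I_2) := if j == 0 then a else b.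
have -> : (fun y => a y * b y) = fun y => (\row_j ab j y) 0 0 * (\row_j ab j y) 0 1.
  by apply/funext => y; rewrite !mxE.
apply: (reg_comp rx (a := ab) (g := fun v => v 0 0 * v 0 1)).
  by move=> j; rewrite /ab; case: ifP.
by apply: smooth_nearM; exact: smooth_near_coord.
Qed.

Section OneSheaf.
Variables (N : smoothSpace R) (W : moduleSheaf N).

Lemma sect_eq (I : Type) (U : I -> set N) (e e' : sect W setT) :
  (forall i, open (U i)) -> (forall x, exists i, U i x) ->
  (forall i, res W setT (U i) e = res W setT (U i) e') -> e = e'.
Proof.
move=> oU cov h; pose B := \bigcup_i U i.
have oB : open B by apply: bigcup_open => i _; exact: oU.
have oT : open [set: N] by exact: openT.
have TB : setT `<=` B by move=> x _; have [i Ux] := cov x; exists i.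
have UB i : U i `<=` B by move=> x Ux; exists i.
have E : res W setT B e = res W setT B e'.
  by apply: sheaf_local => // i; rewrite !res_comp.
by rewrite -[e]res_id // -[e']res_id // -(res_comp (V := B) (W := setT)) // E res_comp.
Qed.

Lemma sect_glue (I : Type) (U : I -> set N) (s : forall i, sect W (U i)) :
  (forall i, open (U i)) -> (forall x, exists i, U i x) ->
  (forall i j, res W (U i) (U i `&` U j) (s i) = res W (U j) (U i `&` U j) (s j)) ->
  exists e : sect W setT, forall i, res W setT (U i) e = s i.
Proof.
move=> oU cov h; have [e eP] := sheaf_glue oU h.
have oB : open (\bigcup_i U i) by apply: bigcup_open => i _; exact: oU.
have oT : open [set: N] by exact: openT.
exists (res W (\bigcup_i U i) setT e) => i.
rewrite res_comp ?eP //.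
by move=> x _; have [j Ux] := cov x; exists j.
Qed.

Lemma act_eq0 (U : set N) (a : N -> R) (e : sect W U) : open U ->
  (forall x, U x -> regular_at x) -> smooth_on U a ->
  (forall x, U x -> a x = 0) -> act W a e = 0.
Proof.
move=> oU reg sa a0; rewrite (act_ext (b := fun=> 0)) //.
  by rewrite act_cst // scale0r.
by move=> x Ux; exact: smooth_germ_cst (reg x Ux).
Qed.

Lemma act_eq1 (U : set N) (a : N -> R) (e : sect W U) : open U ->
  (forall x, U x -> regular_at x) -> smooth_on U a ->
  (forall x, U x -> a x = 1) -> act W a e = e.
Proof.
move=> oU reg sa a1; rewrite (act_ext (b := fun=> 1)) //.
  by rewrite act_cst // scale1r.
by move=> x Ux; exact: smooth_germ_cst (reg x Ux).
Qed.

Lemma act_sum (U : set N) (a : N -> R) n (r : 'I_n -> R) (e : 'I_n -> sect W U) : open U ->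
  (forall x, U x -> regular_at x) -> smooth_on U a ->
  act W a (\sum_i r i *: e i) = \sum_i r i *: act W a (e i).
Proof.
move=> oU reg sa; have actD := fun u v => @act_addr _ _ W U a u v oU sa.
have act0 : act W a (0 : sect W U) = 0.
  by apply: (addrI (act W a 0)); rewrite -actD !addr0.
rewrite (big_morph _ actD act0); apply: eq_bigr => i _.
have sc : smooth_on U (fun _ : N => r i) by move=> x Ux; exact: smooth_germ_cst (reg x Ux).
rewrite -!act_cst // -!act_mul //; apply: act_ext => //.
- by move=> x Ux; apply: smooth_germM => //; [exact: reg|exact: sa|exact: sc].
- by move=> x Ux; apply: smooth_germM => //; [exact: reg|exact: sc|exact: sa].
- by move=> x _; rewrite mulrC.
Qed.

End OneSheaf.

(** A morphism of sheaves of modules which is locally solvable for [c] is globally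
    solvable, thanks to partitions of unity. *)
Section SolveGlobally.
Variables (N : smoothSpace R) (W1 W2 : moduleSheaf N).
Hypotheses (mN : manifold N) (hN : hausdorff_space N).
Variable L : forall U : set N, {additive sect W1 U -> sect W2 U}.
Hypothesis L_res : forall U V e, open U -> open V -> V `<=` U ->
  L V (res W1 U V e) = res W2 U V (L U e).
Hypothesis L_act : forall U (a : N -> R) e, open U -> smooth_on U a ->
  L U (act W1 a e) = act W2 a (L U e).

Variable c : sect W2 setT.

Let reg (x : N) : regular_at x := manifold_regular x mN.
Let oT : open [set: N] := openT.

(** Multiplying a solution on [U] by a bump function supported in [U] gives, after
    extension by zero, a global solution for [b c] with [b = 1] on [V]; the sets [V]
    with this property cover [N]. *)
Let solved (V : set N) : Prop := exists (b : N -> R) (e : sect W1 setT),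
  [/\ smooth_on setT b, forall x, V x -> b x = 1 & L setT e = act W2 b c].

Let solve_locally (y : N) (U : set N) (e : sect W1 U) : open U -> U y ->
  L U e = res W2 setT U c -> exists V : set N, [/\ open V, V y & solved V].
Proof.
move=> oU Uy Le; have [b [V [K [sb [oV Vy] b1 [cK KU b0]]]]] := bump_function mN hN oU Uy.
exists V; split=> //.
have sbU A : smooth_on A b by move=> x _; exact: sb.
have oK : open (~` K) by rewrite openC.
pose D (i : bool) := if i then U else ~` K.
pose s (i : bool) : sect W1 (D i) := if i return sect W1 (D i) then act W1 b e else 0.
have oD i : open (D i) by case: i.
have cov x : exists i, D i x.
  by have [/KU|] := pselect (K x); [exists true|exists false].
have b0s W (A : set N) (u : sect W A) : open A -> A `<=` ~` K -> act W b u = 0.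
  by move=> oA AK; apply: act_eq0 => // x /AK/b0.
have [E hE] : exists E : sect W1 setT, forall i, res W1 setT (D i) E = s i.
  have eK A : open A -> A `<=` U -> A `<=` ~` K -> res W1 U A (act W1 b e) = 0.
    by move=> oA AU AK; rewrite act_res ?b0s.
  apply: sect_glue => // -[] [].
  - by [].
  - by rewrite /s /= raddf0 eK //; exact: openI.
  - by rewrite /s /= raddf0 eK //; exact: openI.
  - by rewrite /s /= !raddf0.
exists b, E; split; [exact: (sbU setT)|exact: b1|].
apply: (@sect_eq _ _ _ D) => // i; rewrite -L_res // hE act_res //.
case: i => /=; first by rewrite L_act ?Le.
by rewrite raddf0 b0s.
Qed.

(** With a countable cover, the functions [b_n prod_(i < n) (1 - b_i)] form a
    partition of unity: the partial sums telescope to [1 - prod_(i < n) (1 - b_i)],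
    and on [V_i] all the terms after the i-th vanish, so that the partial sums [E n]
    of the solutions stabilize there and can be glued. *)
Theorem solve_globally :
  (forall y : N, exists (U : set N) (e : sect W1 U),
     [/\ open U, U y & L U e = res W2 setT U c]) ->
  exists e : sect W1 setT, L setT e = c.
Proof.
move=> hloc.
have [||V [oV sV cov]] := @countable_subcover N solved mN.1.
- exists (fun=> 0), 0; split=> //.
    by move=> x _; exact: smooth_germ_cst (reg x).
  by rewrite raddf0 act_cst // scale0r.
- by move=> y; have [U [e [oU Uy Le]]] := hloc y; exact: solve_locally Le.
have /choice[b] := sV => /choice[e be].
have sb n : smooth_on setT (b n) by have [] := be n.
pose w := fix w n x : R := if n is n'.+1 then w n' x * (1 + -1 * b n' x) else 1.
have sw n : smooth_on setT (w n).
  elim: n => [|n IH] x _ /=; first exact: smooth_germ_cst (reg x).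
  apply: smooth_germM (reg x) (IH x I) _; apply: smooth_germD (reg x) _ _.
    exact: smooth_germ_cst (reg x).
  by apply: smooth_germM (reg x) (smooth_germ_cst _ (reg x)) _; exact: sb.
have sub (A : set N) a : smooth_on setT a -> smooth_on A a by move=> h x _; exact: h.
have s1 n : smooth_on setT (fun x => 1 + -1 * w n x).
  move=> x _; apply: smooth_germD (reg x) (smooth_germ_cst _ (reg x)) _.
  by apply: smooth_germM (reg x) (smooth_germ_cst _ (reg x)) _; exact: sw.
pose E := fix E n : sect W1 setT := if n is n'.+1 then E n' + act W1 (w n') (e n') else 0.
have LE n : L setT (E n) = act W2 (fun x => 1 + -1 * w n x) c.
  elim: n => [|n IH] /=.
    rewrite raddf0; symmetry; apply: act_eq0 => //; first exact: (s1 0%N).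
    by move=> x _; ring.
  have swb : smooth_on setT (fun x => w n x * b n x).
    by move=> x _; exact: (smooth_germM (reg x) (sw n x I) (sb n x I)).
  have sn := s1 n.
  rewrite raddfD L_act // IH; have [_ _ ->] := be n.
  rewrite -act_mul // -act_addl //.
  apply: act_ext => //; last by move=> x _; ring.
  - move=> x _; apply: smooth_germD (reg x) _ _; first exact: s1.
    exact: (smooth_germM (reg x) (sw n x I) (sb n x I)).
  - exact: (s1 n.+1).
have w0 n m x : V n x -> (n < m)%N -> w m x = 0.
  move=> Vx; elim: m => [//|m IH]; rewrite ltnS leq_eqVlt => /orP[/eqP <-|/IH /= ->].
    by rewrite /=; have [_ -> //] := be n; rewrite mulN1r subrr mulr0.
  by rewrite mul0r.
have ER (A : set N) n m : open A -> A `<=` V n -> (n < m)%N ->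
    res W1 setT A (E m) = res W1 setT A (E n.+1).
  move=> oA AV; elim: m => [//|m IH]; rewrite ltnS leq_eqVlt => /orP[/eqP -> //|nm].
  have -> : E m.+1 = E m + act W1 (w m) (e m) by [].
  rewrite linearD (IH nm) act_res // act_eq0 ?addr0 //; first exact: sub.
  by move=> x /AV Vx; exact: w0 nm.
have [|F hF] := @sect_glue _ W1 nat V (fun n => res W1 setT (V n) (E n.+1)) oV cov.
  move=> i j; have oI : open (V i `&` V j) by exact: openI.
  have Ii : V i `&` V j `<=` V i by move=> x [].
  have Ij : V i `&` V j `<=` V j by move=> x [].
  rewrite !res_comp //; pose m := (maxn i j).+1.
  have im : (i < m)%N by rewrite ltnS leq_maxl.
  have jm : (j < m)%N by rewrite ltnS leq_maxr.
  by rewrite -(ER _ _ _ oI Ii im) -(ER _ _ _ oI Ij jm).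
exists F; apply: (@sect_eq _ _ _ V) => // n.
rewrite -L_res // hF L_res // LE act_res // act_eq1 //; first exact: sub.
by move=> x Vx; rewrite (w0 n) // mulr0 addr0.
Qed.

End SolveGlobally.

Section PushForward.
Variables (M N : smoothSpace R) (v : M -> N) (W : moduleSheaf M).
Hypothesis sv : smooth v.

Let ov (U : set N) : open U -> open (v @^-1` U).
Proof. by move=> oU; have /continuousP := sv.1; apply. Qed.

Let sov (U : set N) (a : N -> R) : smooth_on U a -> smooth_on (v @^-1` U) (a \o v).
Proof. by move=> sa x Ux; apply: sv.2; exact: sa. Qed.

(** This makes sections over a space [M] above [N] into sections over [N], so that a
    partition of unity on [N] can be used for an equation between sections over [M]. *)
Definition pushforward : moduleSheaf N.
Proof.
apply: (@ModuleSheaf R N (fun U => sect W (v @^-1` U))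
  (fun U V => res W (v @^-1` U) (v @^-1` V)) (fun U a => act W (a \o v))).
- by move=> U e oU; apply: res_id; exact: ov.
- move=> U V A e oU oV oA VU AV; apply: res_comp; try exact: ov.
  + by move=> x; exact: VU.
  + by move=> x; exact: AV.
- move=> U a b e oU sa sb ab; apply: act_ext; [exact: ov|exact: sov..|].
  by move=> x Ux /=; exact: ab.
- by move=> U a b e oU sa sb; apply: act_addl; [exact: ov|exact: sov..].
- by move=> U a e e' oU sa; apply: act_addr; [exact: ov|exact: sov].
- by move=> U a b e oU sa sb; apply: act_mul; [exact: ov|exact: sov..].
- by move=> U k e oU; apply: act_cst; exact: ov.
- move=> U V a e oU oV VU sa; apply: act_res; [exact: ov|exact: ov| |exact: sov].
  by move=> x; exact: VU.
- move=> I U e e' oU h; apply: (@sheaf_local _ _ W I (fun i => v @^-1` U i)) => //.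
  by move=> i; exact: ov.
- move=> I U s oU h; apply: (@sheaf_glue _ _ W I (fun i => v @^-1` U i)) => //.
  by move=> i; exact: ov.
Defined.

End PushForward.
End SheafSections.

(** * Groupoids and functors from codiscrete groupoids *)

Section GroupoidAlgebra.
Context {R : realType}.
Variable G : groupoid R.
Implicit Types g h k : arr G.

(** The product, extended by a junk value to non-composable pairs; this keeps
    proofs of composability out of the terms. *)
Definition gm g h : arr G :=
  if pselect (src g = tgt h) is left e then Defs.mul g h e else g.

Lemma gmE g h (e : src g = tgt h) : gm g h = Defs.mul g h e.
Proof. by rewrite /gm; case: pselect => // e'; exact: mul_irr. Qed.

Lemma src_gm g h : src g = tgt h -> src (gm g h) = src h.
Proof. by move=> e; rewrite gmE src_mul. Qed.

Lemma tgt_gm g h : src g = tgt h -> tgt (gm g h) = tgt g.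
Proof. by move=> e; rewrite gmE tgt_mul. Qed.

Lemma gmA g h k : src g = tgt h -> src h = tgt k ->
  gm g (gm h k) = gm (gm g h) k.
Proof.
move=> e1 e2; rewrite (gmE e2) (gmE e1).
have e3 : src g = tgt (Defs.mul h k e2) by rewrite tgt_mul.
have e4 : src (Defs.mul g h e1) = tgt k by rewrite src_mul.
by rewrite (gmE e3) (gmE e4); exact: gmulA.
Qed.

Lemma gm1l g x : x = tgt g -> gm (gunit x) g = g.
Proof.
move=> ->; have e : src (gunit (tgt g)) = tgt g by rewrite src_unit.
by rewrite (gmE e) gmul1l.
Qed.

Lemma gm1r g x : x = src g -> gm g (gunit x) = g.
Proof.
move=> ->; have e : src g = tgt (gunit (src g)) by rewrite tgt_unit.
by rewrite (gmE e) gmul1r.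
Qed.

Lemma gmVl g : gm (ginv g) g = gunit (src g).
Proof.
have e : src (ginv g) = tgt g by rewrite src_inv.
by rewrite (gmE e) gmulVl.
Qed.

Lemma gmVr g : gm g (ginv g) = gunit (tgt g).
Proof.
have e : src g = tgt (ginv g) by rewrite tgt_inv.
by rewrite (gmE e) gmulVr.
Qed.

Lemma gmKl g h : src g = tgt h -> gm (ginv g) (gm g h) = h.
Proof. by move=> e; rewrite gmA ?src_inv // gmVl gm1l. Qed.

Lemma gmKr g h : src g = tgt h -> gm (gm g h) (ginv h) = g.
Proof. by move=> e; rewrite -gmA ?tgt_inv // gmVr gm1r. Qed.

Lemma ginvK g : ginv (ginv g) = g.
Proof.
rewrite -[LHS](@gm1r _ (src g)); last by rewrite src_inv tgt_inv.
by rewrite -gmVl gmKl // src_inv.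
Qed.

Lemma gmVK g h : tgt g = tgt h -> gm g (gm (ginv g) h) = h.
Proof. by move=> e; rewrite -{1}[g]ginvK gmKl // src_inv. Qed.

Lemma ginv_unit (x : obj G) : ginv (gunit x) = gunit x.
Proof.
rewrite -[LHS](@gm1r _ x); last by rewrite src_inv tgt_unit.
by rewrite gmVl src_unit.
Qed.

Lemma gm_idem g : gm g g = g -> src g = tgt g -> g = gunit (src g).
Proof. by move=> gg e; rewrite -[LHS](gmKl e) gg gmVl. Qed.

Lemma gm_smooth_at (M : smoothSpace R) (a b : M -> arr G) x : is_lie G -> regular_at x ->
  (forall y, src (a y) = tgt (b y)) -> smooth_at a x -> smooth_at b x ->
  smooth_at (fun y => gm (a y) (b y)) x.
Proof.
move=> lG rx e sa sb.
pose f (y : M) : fibre_product (@src R G) (@tgt R G) := exist _ (a y, b y) (e y).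
have -> : (fun y => gm (a y) (b y)) =
    (fun p : fibre_product (@src R G) (@tgt R G) =>
       Defs.mul (sval p).1 (sval p).2 (svalP p)) \o f.
  by apply/funext => y /=; exact: gmE.
apply: smooth_at_comp; last by have /smoothP := lie_mul lG.
exact: fp_map_smooth_at.
Qed.

End GroupoidAlgebra.

Section Codiscrete.
Context {R : realType}.
Variable G : groupoid R.

Definition vert J (g : J -> J -> arr G) (u : J) : obj G := src (g u u).

(** Functors to [G] from the groupoid with objects [J] and exactly one arrow
    between any two objects. A string of composable arrows is such a functor on its
    vertices, and this description treats all the vertices alike: faces are
    reindexings. *)
Record codiscrete J (g : J -> J -> arr G) : Prop := Codiscrete {
  cod_src : forall u v, src (g u v) = vert g u;
  cod_tgt : forall u v, tgt (g u v) = vert g v;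
  cod_mul : forall u v w, gm (g v w) (g u v) = g u w }.

Lemma cod_comp J (g : J -> J -> arr G) u v w : codiscrete g -> src (g v w) = tgt (g u v).
Proof. by move=> c; rewrite (cod_src c) (cod_tgt c). Qed.

Lemma cod_unit J (g : J -> J -> arr G) u : codiscrete g -> g u u = gunit (vert g u).
Proof.
move=> c; rewrite {1}(@gm_idem _ _ (g u u)) ?(cod_mul c) //.
by rewrite (cod_src c) (cod_tgt c).
Qed.

Lemma cod_inv J (g : J -> J -> arr G) u v : codiscrete g -> ginv (g u v) = g v u.
Proof.
move=> c; have e : src (g v u) = tgt (g u v) by exact: cod_comp.
rewrite -[RHS](gmKr e) (cod_mul c) (cod_unit u c) gm1l //.
by rewrite tgt_inv (cod_src c).
Qed.

Lemma cod_reindex J J' (g : J -> J -> arr G) (b : J' -> J) :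
  codiscrete g -> codiscrete (fun u v => g (b u) (b v)).
Proof.
move=> c; split=> [u v|u v|u v w]; rewrite ?(cod_mul c) //.
  by rewrite (cod_src c).
by rewrite (cod_tgt c).
Qed.

(** Moving the objects of such a functor along arrows [k u] ending at [b u]. *)
Definition twist J J' (g : J -> J -> arr G) (b : J' -> J) (k : J' -> arr G) (u v : J') :=
  gm (ginv (k v)) (gm (g (b u) (b v)) (k u)).

Section Twist.
Variables (J J' : Type) (g : J -> J -> arr G) (b : J' -> J) (k : J' -> arr G).
Hypotheses (c : codiscrete g) (kP : forall u, tgt (k u) = vert g (b u)).

Let e1 u v : src (g (b u) (b v)) = tgt (k u).
Proof. by rewrite (cod_src c) kP. Qed.

Let e2 u v : src (ginv (k v)) = tgt (gm (g (b u) (b v)) (k u)).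
Proof. by rewrite src_inv tgt_gm // kP (cod_tgt c). Qed.

Lemma src_twist u v : src (twist g b k u v) = src (k u).
Proof. by rewrite /twist src_gm // src_gm. Qed.

Lemma tgt_twist u v : tgt (twist g b k u v) = src (k v).
Proof. by rewrite /twist tgt_gm // tgt_inv. Qed.

Lemma vert_twist u : vert (twist g b k) u = src (k u).
Proof. exact: src_twist. Qed.

Lemma twist_codiscrete : codiscrete (twist g b k).
Proof.
split=> [u v|u v|u v w]; rewrite ?vert_twist ?src_twist ?tgt_twist //.
rewrite /twist; set x := gm (g (b u) (b v)) (k u).
have sv : src (k v) = tgt (gm (ginv (k v)) x) by rewrite (tgt_gm (e2 u v)) tgt_inv.
have e3 : src (g (b v) (b w)) = tgt (k v) by rewrite (cod_src c) kP.
have e4 : tgt (k v) = tgt x by rewrite (tgt_gm (e1 u v)) kP (cod_tgt c).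
have e5 : src (gm (g (b v) (b w)) (k v)) = tgt (gm (ginv (k v)) x) by rewrite (src_gm e3).
rewrite -(gmA (e2 v w) e5) -(gmA e3 sv) (gmVK e4).
by rewrite /x (gmA (cod_comp _ _ _ c) (e1 u v)) (cod_mul c).
Qed.

End Twist.
Lemma twist_unit J J' (g : J -> J -> arr G) (b : J' -> J) (k : J' -> arr G) u v :
  codiscrete g -> k u = gunit (vert g (b u)) -> k v = gunit (vert g (b v)) ->
  twist g b k u v = g (b u) (b v).
Proof.
move=> c ku kv; rewrite /twist ku kv ginv_unit gm1r ?gm1l ?cod_tgt //.
by rewrite cod_src.
Qed.

Lemma twist_from J J' (g : J -> J -> arr G) (b : J' -> J) (k : J' -> arr G) u v :
  codiscrete g -> k v = gunit (vert g (b v)) -> tgt (k u) = vert g (b u) -> b u = b v ->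
  twist g b k u v = k u.
Proof.
move=> c kv ku uv; rewrite /twist kv uv cod_unit // ginv_unit -uv.
by rewrite !gm1l // ?tgt_gm ?src_unit ?tgt_unit.
Qed.

Lemma eq_twist J1 J2 J1' J2' (g1 : J1 -> J1 -> arr G) (g2 : J2 -> J2 -> arr G)
    (b1 : J1' -> J1) (b2 : J2' -> J2) k1 k2 u1 v1 u2 v2 :
  g1 (b1 u1) (b1 v1) = g2 (b2 u2) (b2 v2) -> k1 u1 = k2 u2 -> k1 v1 = k2 v2 ->
  twist g1 b1 k1 u1 v1 = twist g2 b2 k2 u2 v2.
Proof. by move=> e1 e2 e3; rewrite /twist e1 e2 e3. Qed.

End Codiscrete.

(** * Strings with vertices in two groupoids *)

Section Attach.
Context {R : realType}.
Variable G : groupoid R.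

(** Adding an object to a functor from a codiscrete groupoid, joined to the old
    object [u0] by the arrow [k0]; [old] is the partial inverse of the inclusion of
    the old objects. *)
Definition attach J J' (old : J' -> option J) (u0 : J) (k0 : arr G) (g : J -> J -> arr G) :
    J' -> J' -> arr G :=
  twist g (fun u => odflt u0 (old u))
    (fun u => if old u is Some v then gunit (vert g v) else k0).

Section AttachLemmas.
Variables (J J' : Type) (old : J' -> option J) (u0 : J) (k0 : arr G).

Lemma attach_codiscrete (g : J -> J -> arr G) :
  codiscrete g -> tgt k0 = vert g u0 -> codiscrete (attach old u0 k0 g).
Proof.
by move=> c e; apply: twist_codiscrete => // u; case: (old u) => //= v; rewrite tgt_unit.
Qed.

Lemma attach_old (g : J -> J -> arr G) u v u' v' : codiscrete g ->
  old u = Some u' -> old v = Some v' -> attach old u0 k0 g u v = g u' v'.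
Proof. by move=> c eu ev; rewrite /attach twist_unit // ?eu ?ev. Qed.

Lemma attach_new (g : J -> J -> arr G) u v : codiscrete g -> tgt k0 = vert g u0 ->
  old u = None -> old v = Some u0 -> attach old u0 k0 g u v = k0.
Proof. by move=> c e eu ev; rewrite /attach twist_from // ?eu ?ev. Qed.

Lemma vert_attach_old (g : J -> J -> arr G) u u' : codiscrete g ->
  old u = Some u' -> vert (attach old u0 k0 g) u = vert g u'.
Proof. by move=> c eu; rewrite /vert (attach_old (u' := u') (v' := u')). Qed.

Lemma vert_attach_new (g : J -> J -> arr G) u : codiscrete g -> tgt k0 = vert g u0 ->
  old u = None -> vert (attach old u0 k0 g) u = src k0.
Proof.
move=> c e eu; rewrite /attach vert_twist ?eu //.
by move=> v; case: (old v) => //= w; rewrite tgt_unit.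
Qed.

(** As the old objects enter through [old] and [g] only, removing one of them
    commutes with attaching a new object. *)
Lemma attach_restr K K' (old2 : K' -> option K) (s : K -> J) (r : K' -> J') (w0 : K)
    (g : J -> J -> arr G) u v :
  (forall u, old (r u) = omap s (old2 u)) -> s w0 = u0 ->
  attach old u0 k0 g (r u) (r v) = attach old2 w0 k0 (fun x y => g (s x) (s y)) u v.
Proof.
move=> e e0; apply: eq_twist.
- by rewrite !e; case: (old2 u) => [?|]; case: (old2 v) => [?|] /=; rewrite ?e0.
- by rewrite e; case: (old2 u).
- by rewrite e; case: (old2 v).
Qed.

(** By functoriality an object can be removed and attached again along any of its
    arrows to the others. *)
Lemma attach_rebuild (g : J' -> J' -> arr G) (s : J -> J') (n : J') u v :
  codiscrete g -> (forall u v, old u = Some v -> u = s v) ->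
  (forall u, old u = None -> u = n) -> k0 = g n (s u0) ->
  attach old u0 k0 (fun x y => g (s x) (s y)) u v = g u v.
Proof.
move=> c e1 e2 k0E; rewrite /attach /twist.
have kE w : (if old w is Some w' then gunit (vert (fun x y => g (s x) (s y)) w') else k0) =
    g w (s (odflt u0 (old w))).
  case e : (old w) => [w'|] /=; last by rewrite k0E (e2 w e).
  by rewrite (e1 _ _ e) cod_unit.
by rewrite !kE (cod_inv _ _ c) !(cod_mul c).
Qed.

End AttachLemmas.
End Attach.

Section MixedStrings.
Context {R : realType}.
Variables (H G : groupoid R) (F : homomorphism H G).

Local Notation J p q := ('I_p + 'I_q)%type.
Local Notation F0 := (hom0 F).
Local Notation F1 := (hom1 F).

Definition Ycond p q (d : ('I_p -> obj H) * (J p q -> J p q -> arr G)) : Prop :=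
  codiscrete d.2 /\ forall i, vert d.2 (inl i) = F0 (d.1 i).

Definition Ycomp p q (i : 'I_p + J p q * J p q) : smoothSpace R :=
  if i is inl _ then obj H else arr G.

Definition Yproj p q (i : 'I_p + J p q * J p q) (y : {d | @Ycond p q d}) : Ycomp i :=
  match i with
  | inl i => (sval y).1 i
  | inr uv => (sval y).2 uv.1 uv.2
  end.

(** Strings of composable arrows of [G] on p + q objects, given by all the
    composites, together with lifts to [H] of the first p objects. For p, q > 0
    this amounts to p - 1 composable arrows of [H], q - 1 composable arrows of [G],
    and an arrow of [G] from the image of an end of the former to an end of the latter. *)
Definition Y p q : smoothSpace R := initial_space (@Yproj p q).

Definition yx p q (y : Y p q) (i : 'I_p) : obj H := (sval y).1 i.
Definition yg p q (y : Y p q) (u v : J p q) : arr G := (sval y).2 u v.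

Lemma ycod p q (y : Y p q) : codiscrete (yg y).
Proof. exact: (svalP y).1. Qed.

Lemma yvert p q (y : Y p q) i : vert (yg y) (inl i) = F0 (yx y i).
Proof. exact: (svalP y).2. Qed.

Definition mkY p q (x : 'I_p -> obj H) (g : J p q -> J p q -> arr G)
    (c : codiscrete g) (e : forall i, vert g (inl i) = F0 (x i)) : Y p q :=
  exist _ (x, g) (conj c e).

Lemma yP p q (y y' : Y p q) : (forall i, yx y i = yx y' i) ->
  (forall u v, yg y u v = yg y' u v) -> y = y'.
Proof.
move: y y' => [[x g] yP] [[x' g'] yP'] ex eg; apply: eq_exist.
congr (_, _); first by apply/funext => i; exact: ex.
by apply/funext => u; apply/funext => v; exact: eg.
Qed.

Lemma yx_smooth p q i : smooth (fun y : Y p q => yx y i).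
Proof. exact: (@initial_proj_smooth R _ (@Ycomp p q) _ (@Yproj p q) (inl i)). Qed.

Lemma yg_smooth p q u v : smooth (fun y : Y p q => yg y u v).
Proof. exact: (@initial_proj_smooth R _ (@Ycomp p q) _ (@Yproj p q) (inr (u, v))). Qed.

Lemma y_map_smooth (M : smoothSpace R) p q (f : M -> Y p q) :
  (forall x : M, regular_at x) ->
  (forall i, smooth (fun m => yx (f m) i)) ->
  (forall u v, smooth (fun m => yg (f m) u v)) -> smooth f.
Proof.
move=> rM sx sg; apply/smoothP => x; apply: initial_map_smooth_at => // -[i|[u v]].
  by have /smoothP := sx i; apply.
by have /smoothP := sg u v; apply.
Qed.

Definition smap p q p' q' (r : 'I_p' -> 'I_p) (s : 'I_q' -> 'I_q) (u : J p' q') : J p q :=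
  match u with inl i => inl (r i) | inr j => inr (s j) end.

Definition dH p q (i : 'I_p.+1) (y : Y p.+1 q) : Y p q :=
  mkY (x := fun k => yx y (lift i k)) (cod_reindex (smap (lift i) id) (ycod y))
    (fun k => yvert y (lift i k)).

Definition dG p q (j : 'I_q.+1) (y : Y p q.+1) : Y p q :=
  mkY (x := yx y) (cod_reindex (smap id (lift j)) (ycod y)) (yvert y).

Definition oldH p q (u : J p.+1 q) : option (J p q) :=
  match u with inl i => omap inl (unlift ord0 i) | inr j => Some (inr j) end.

Definition oldG p q (u : J p q.+1) : option (J p q) :=
  match u with inl i => Some (inl i) | inr j => omap inr (unlift ord0 j) end.

Definition addH p q (y : Y p q) (u0 : J p q) (x0 : obj H) (k0 : arr G)
  (e : src k0 = F0 x0) (e' : tgt k0 = vert (yg y) u0) : Y p.+1 q.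
Proof.
apply: (@mkY p.+1 q (fun i => if unlift ord0 i is Some i' then yx y i' else x0)
  (attach (@oldH p q) u0 k0 (yg y))); first by apply: attach_codiscrete => //; exact: ycod.
move=> i; case ei : (unlift ord0 i) => [i'|].
  by rewrite (@vert_attach_old _ _ _ _ _ _ _ _ _ (inl i')) ?yvert //=; [exact: ycod|rewrite ei].
by rewrite vert_attach_new //=; [exact: ycod|rewrite ei].
Defined.

Definition addG p q (y : Y p q) (u0 : J p q) (k0 : arr G)
  (e' : tgt k0 = vert (yg y) u0) : Y p q.+1.
Proof.
apply: (@mkY p q.+1 (yx y) (attach (@oldG p q) u0 k0 (yg y))).
  by apply: attach_codiscrete => //; exact: ycod.
by move=> i; rewrite (@vert_attach_old _ _ _ _ _ _ _ _ _ (inl i)) ?yvert //; exact: ycod.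
Defined.

Lemma oldHK p q (u : J p q) : oldH (smap (lift ord0) id u) = Some u.
Proof. by case: u => [i|j] //=; rewrite liftK. Qed.

Lemma oldGK p q (u : J p q) : oldG (smap id (lift ord0) u) = Some u.
Proof. by case: u => [i|j] //=; rewrite liftK. Qed.

Lemma oldHS p q (u : J p.+1 q) v : oldH u = Some v -> u = smap (lift ord0) id v.
Proof.
case: u => [i|j] /=; last by move=> [<-].
by case: unliftP => [i' ->|//] /= [<-].
Qed.

Lemma oldGS p q (u : J p q.+1) v : oldG u = Some v -> u = smap id (lift ord0) v.
Proof.
case: u => [i|j] /=; first by move=> [<-].
by case: unliftP => [j' ->|//] /= [<-].
Qed.

Lemma oldHN p q (u : J p.+1 q) : oldH u = None -> u = inl ord0.
Proof. by case: u => [i|j] //=; case: unliftP => [i' ->|->]. Qed.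

Lemma oldGN p q (u : J p q.+1) : oldG u = None -> u = inr ord0.
Proof. by case: u => [i|j] //=; case: unliftP => [j' ->|->]. Qed.

Lemma lift_lift0 n (i : 'I_n.+1) (k : 'I_n) :
  lift (lift ord0 i) (lift ord0 k) = lift ord0 (lift i k) :> 'I_n.+2.
Proof. by apply: val_inj => /=; rewrite /bump /=; lia. Qed.

Lemma lift_lift00 n (i : 'I_n.+1) : lift (lift ord0 i) ord0 = ord0 :> 'I_n.+2.
Proof. by apply: val_inj. Qed.

Lemma yx_addH p q (y : Y p q) u0 x0 k0 e e' i :
  yx (@addH p q y u0 x0 k0 e e') i = if unlift ord0 i is Some i' then yx y i' else x0.
Proof. by []. Qed.

Lemma yx_dH p q (y : Y p.+1 q) i k : yx (dH i y) k = yx y (lift i k).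
Proof. by []. Qed.

Section AddH.
Variables (p q : nat).

Lemma dH0_addH (y : Y p q) u0 x0 k0 e e' : dH ord0 (@addH p q y u0 x0 k0 e e') = y.
Proof.
apply: yP => [i|u v]; first by rewrite yx_dH yx_addH liftK.
by apply: attach_old; [exact: ycod|exact: oldHK|exact: oldHK].
Qed.

Lemma dH_addH i (y : Y p.+1 q) u0 w0 x0 k0 e e' e1 e2 : smap (lift i) id w0 = u0 ->
  dH (lift ord0 i) (@addH p.+1 q y u0 x0 k0 e e1) = @addH p q (dH i y) w0 x0 k0 e' e2.
Proof.
move=> wu; apply: yP => [k|u v].
  rewrite yx_dH !yx_addH.
  case: (unliftP ord0 k) => [k' ->|->]; first by rewrite lift_lift0 !liftK.
  by rewrite lift_lift00 !unlift_none.
apply: attach_restr => // -[k|//] /=.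
case: (unliftP ord0 k) => [k' ->|->]; first by rewrite lift_lift0 !liftK.
by rewrite lift_lift00 !unlift_none.
Qed.

Lemma addH_dH0 (y : Y p.+1 q) u0 x0 k0 e e' : x0 = yx y ord0 ->
  k0 = yg y (inl ord0) (smap (lift ord0) id u0) -> @addH p q (dH ord0 y) u0 x0 k0 e e' = y.
Proof.
move=> ex ek; apply: yP => [i|u v].
  by rewrite yx_addH; case: unliftP => [i' ->|->].
by apply: (@attach_rebuild _ _ _ _ _ _ _ (yg y) (smap (lift ord0) id) (inl ord0));
  [exact: ycod|exact: oldHS|exact: oldHN|exact: ek].
Qed.

Lemma yg_addH (y : Y p q) u0 x0 k0 e e' :
  yg (@addH p q y u0 x0 k0 e e') (inl ord0) (smap (lift ord0) id u0) = k0.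
Proof.
by apply: attach_new; [exact: ycod|exact: e'|rewrite /= unlift_none|exact: oldHK].
Qed.

End AddH.

Section AddG.
Variables (p q : nat).

Lemma dG0_addG (y : Y p q) u0 k0 e : dG ord0 (@addG p q y u0 k0 e) = y.
Proof.
apply: yP => [//|u v].
by apply: attach_old; [exact: ycod|exact: oldGK|exact: oldGK].
Qed.

Lemma dG_addG j (y : Y p q.+1) u0 w0 k0 e1 e2 : smap id (lift j) w0 = u0 ->
  dG (lift ord0 j) (@addG p q.+1 y u0 k0 e1) = @addG p q (dG j y) w0 k0 e2.
Proof.
move=> wu; apply: yP => [//|u v].
apply: attach_restr => // -[//|k] /=.
case: (unliftP ord0 k) => [k' ->|->]; first by rewrite lift_lift0 !liftK.
by rewrite lift_lift00 !unlift_none.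
Qed.

Lemma addG_dG0 (y : Y p q.+1) u0 k0 e :
  k0 = yg y (inr ord0) (smap id (lift ord0) u0) -> @addG p q (dG ord0 y) u0 k0 e = y.
Proof.
move=> ek; apply: yP => [//|u v].
by apply: (@attach_rebuild _ _ _ _ _ _ _ (yg y) (smap id (lift ord0)) (inr ord0));
  [exact: ycod|exact: oldGS|exact: oldGN|exact: ek].
Qed.

Lemma yg_addG (y : Y p q) u0 k0 e :
  yg (@addG p q y u0 k0 e) (inr ord0) (smap id (lift ord0) u0) = k0.
Proof.
by apply: attach_new; [exact: ycod|exact: e|rewrite /= unlift_none|exact: oldGK].
Qed.

End AddG.

End MixedStrings.

(** * The spaces of strings are manifolds *)

Section SmoothGroupoidMaps.
Context {R : realType}.
Variable G : groupoid R.
Hypothesis lG : is_lie G.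

Variable M : smoothSpace R.
Hypothesis rM : forall x : M, regular_at x.

Lemma gm_smooth (a b : M -> arr G) : (forall y, src (a y) = tgt (b y)) ->
  smooth a -> smooth b -> smooth (fun y => gm (a y) (b y)).
Proof.
move=> e /smoothP sa /smoothP sb; apply/smoothP => x.
exact: gm_smooth_at lG (rM x) e (sa x) (sb x).
Qed.

Lemma ginv_smooth (a : M -> arr G) : smooth a -> smooth (fun y => ginv (a y)).
Proof. by move=> sa; exact: smooth_comp sa (lie_inv lG). Qed.

Lemma vert_smooth J (g : M -> J -> J -> arr G) u :
  (forall u v, smooth (fun m => g m u v)) -> smooth (fun m => vert (g m) u).
Proof. by move=> sg; exact: smooth_comp (sg u u) (lie_src lG).1. Qed.

Lemma attach_smooth J J' (old : J' -> option J) u0 (k0 : M -> arr G)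
    (g : M -> J -> J -> arr G) u v :
  (forall m, codiscrete (g m)) -> (forall m, tgt (k0 m) = vert (g m) u0) ->
  smooth k0 -> (forall u v, smooth (fun m => g m u v)) ->
  smooth (fun m => attach old u0 (k0 m) (g m) u v).
Proof.
move=> c e sk sg; rewrite /attach.
set k := fun m w => if old w is Some v0 then gunit (vert (g m) v0) else k0 m.
have sk' w : smooth (fun m => k m w).
  rewrite /k; case: (old w) => [w'|//].
  exact: smooth_comp (vert_smooth w' sg) (lie_unit lG).
have kP m w : tgt (k m w) = vert (g m) (odflt u0 (old w)).
  by rewrite /k; case: (old w) => [w'|] /=; [exact: tgt_unit|exact: e].
have e1 m : src (g m (odflt u0 (old u)) (odflt u0 (old v))) = tgt (k m u).
  by rewrite (cod_src (c m)) kP.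
have e2 m : src (ginv (k m v)) = tgt (gm (g m (odflt u0 (old u)) (odflt u0 (old v))) (k m u)).
  by rewrite src_inv (tgt_gm (e1 m)) (cod_tgt (c m)) kP.
apply: gm_smooth => //; first exact: (ginv_smooth (sk' v)).
exact: (gm_smooth e1 (sg _ _) (sk' u)).
Qed.

End SmoothGroupoidMaps.

Section MixedManifold.
Context {R : realType}.
Variables (H G : groupoid R) (F : homomorphism H G).

Local Notation J p q := ('I_p + 'I_q)%type.
Local Notation F0 := (hom0 F).
Local Notation F1 := (hom1 F).
Local Notation Y := (Y F).

Lemma hom1_gm (h k : arr H) : src h = tgt k -> F1 (gm h k) = gm (F1 h) (F1 k).
Proof.
move=> e; have [_ _ hs ht _ hm] := homP F.
have e' : src (F1 h) = tgt (F1 k) by rewrite hs ht e.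
by rewrite (gmE e) (gmE e') (hm _ _ e e').
Qed.

Lemma hom1_inv (h : arr H) : F1 (ginv h) = ginv (F1 h).
Proof.
have [_ _ hs ht hu _] := homP F.
have e : src (F1 (ginv h)) = tgt (F1 h) by rewrite hs ht src_inv.
rewrite -[LHS](gmKr e) -hom1_gm ?src_inv // gmVl hu gm1l //.
by rewrite tgt_inv hs.
Qed.

Hypotheses (lH : is_lie H) (lG : is_lie G).

Let mH0 := lie_obj lH.
Let mH1 := lie_arr lH.
Let mG0 := lie_obj lG.
Let mG1 := lie_arr lG.

Lemma Y_regular p q (y : Y p q) : regular_at y.
Proof. by apply: initial_regular => -[i|u] /=; exact: manifold_regular. Qed.

Lemma yvert_smooth p q u : smooth (fun y : Y p q => vert (yg y) u).
Proof. by apply: vert_smooth => // v w; exact: yg_smooth. Qed.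

Lemma dH_smooth p q i : smooth (@dH R H G F p q i).
Proof.
apply: y_map_smooth => [y|k|u v]; first exact: Y_regular.
  exact: yx_smooth.
exact: yg_smooth.
Qed.

Lemma dG_smooth p q j : smooth (@dG R H G F p q j).
Proof.
apply: y_map_smooth => [y|k|u v]; first exact: Y_regular.
  exact: yx_smooth.
exact: yg_smooth.
Qed.

Lemma addH_smooth (M : smoothSpace R) p q (f : M -> Y p q) u0 x0 k0
    (e : forall m, src (k0 m) = F0 (x0 m)) (e' : forall m, tgt (k0 m) = vert (yg (f m)) u0) :
  (forall x : M, regular_at x) -> smooth f -> smooth x0 -> smooth k0 ->
  smooth (fun m => addH (e m) (e' m)).
Proof.
move=> rM sf sx sk; apply: y_map_smooth => // [i|u v].
  have -> : (fun m => yx (addH (e m) (e' m)) i) =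
      fun m => if unlift ord0 i is Some i' then yx (f m) i' else x0 m by [].
  by case: (unlift ord0 i) => [i'|]; [exact: (smooth_comp sf (yx_smooth F _ i'))|exact: sx].
apply: (@attach_smooth _ G lG M rM) => // [m|u' v']; first exact: ycod.
exact: (smooth_comp sf (yg_smooth F u' v')).
Qed.

Lemma addG_smooth (M : smoothSpace R) p q (f : M -> Y p q) u0 k0
    (e' : forall m, tgt (k0 m) = vert (yg (f m)) u0) :
  (forall x : M, regular_at x) -> smooth f -> smooth k0 ->
  smooth (fun m => addG (e' m)).
Proof.
move=> rM sf sk; apply: y_map_smooth => // [i|u v].
  exact: (smooth_comp sf (yx_smooth F _ i)).
apply: (@attach_smooth _ G lG M rM) => // [m|u' v']; first exact: ycod.
exact: (smooth_comp sf (yg_smooth F u' v')).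
Qed.

Lemma fp_map_smooth (M N Q Q' : smoothSpace R) (f : M -> Q) (h : N -> Q)
    (g : Q' -> fibre_product f h) : (forall x : Q', regular_at x) ->
  smooth (@fp1 R M N Q f h \o g) -> smooth (@fp2 R M N Q f h \o g) -> smooth g.
Proof.
move=> r /smoothP s1 /smoothP s2; apply/smoothP => x.
exact: fp_map_smooth_at (r x) (s1 x) (s2 x).
Qed.

Lemma fp_eq (M N Q : smoothSpace R) (f : M -> Q) (h : N -> Q) (z z' : fibre_product f h) :
  fp1 z = fp1 z' -> fp2 z = fp2 z' -> z = z'.
Proof.
move=> e1 e2; apply: subspace_eq.
by rewrite [LHS]surjective_pairing [RHS]surjective_pairing; congr (_, _).
Qed.

Lemma manifold_Y10 : manifold (Y 1 0).
Proof.
have c (x : obj H) : @codiscrete R G (J 1 0) (fun _ _ => gunit (F0 x)).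
  by split=> [u v|u v|u v w]; rewrite /vert ?src_unit ?tgt_unit // gm1l // tgt_unit.
have e x (i : 'I_1) : vert (fun _ _ : J 1 0 => gunit (F0 x)) (inl i) = F0 x.
  exact: src_unit.
have sF : smooth F0 by have [] := homP F.
apply: (@manifold_diffeo R (Y 1 0) (obj H) (fun y => yx y ord0)
  (fun x => mkY (c x) (e x))) => //.
- move=> y; apply: yP => [i|u v]; first by rewrite (ord1 i).
  case: u => [i|[]//]; case: v => [j|[]//].
  by rewrite (ord1 i) (ord1 j) (cod_unit _ (ycod y)) yvert.
- exact: yx_smooth.
- apply: y_map_smooth => [x|i|u v]; first exact: manifold_regular.
    exact: smooth_id.
  exact: smooth_comp sF (lie_unit lG).
Qed.

Lemma manifold_Y01 : manifold (Y 0 1).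
Proof.
have c (x : obj G) : @codiscrete R G (J 0 1) (fun _ _ => gunit x).
  by split=> [u v|u v|u v w]; rewrite /vert ?src_unit ?tgt_unit // gm1l // tgt_unit.
pose x0 (i : 'I_0) : obj H := False_rect _ (notF (ltn_ord i)).
have e x (i : 'I_0) : vert (fun _ _ : J 0 1 => gunit x) (inl i) = F0 (x0 i) by case: i.
apply: (@manifold_diffeo R (Y 0 1) (obj G) (fun y => vert (yg y) (inr ord0))
  (fun x => mkY (c x) (e x))) => //.
- move=> y; apply: yP => [[]//|u v].
  case: u => [[]//|i]; case: v => [[]//|j].
  by rewrite (ord1 i) (ord1 j) (cod_unit _ (ycod y)).
- by move=> x; exact: src_unit.
- exact: yvert_smooth.
- apply: y_map_smooth => [x|[]//|u v]; first exact: manifold_regular.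
  exact: (lie_unit lG).
Qed.

(** A new [G]-vertex amounts to an arrow of [G] out of an old vertex. *)
Lemma manifold_addG p q (u0 : J p q) : manifold (Y p q) -> manifold (Y p q.+1).
Proof.
move=> mY; pose v0 (y : Y p q) := vert (yg y) u0.
pose Z := fibre_product (@src R G) v0.
have mZ : manifold Z.
  by apply: fibre_product_manifold => //; [exact: (lie_src lG)|exact: yvert_smooth].
have e (z : Z) : tgt (ginv (fp1 z)) = vert (yg (fp2 z)) u0.
  by rewrite tgt_inv; exact: (svalP z).
pose bwd (z : Z) : Y p q.+1 := addG (e z).
pose s0 : J p q.+1 := smap id (lift ord0) u0.
have e' (y : Y p q.+1) : src (yg y s0 (inr ord0)) = v0 (dG ord0 y).
  by rewrite (cod_src (ycod y)).
pose fwd (y : Y p q.+1) : Z := exist _ (yg y s0 (inr ord0), dG ord0 y) (e' y).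
apply: (@manifold_diffeo R (Y p q.+1) Z fwd bwd) => //.
- move=> y; apply: addG_dG0; exact: (cod_inv _ _ (ycod y)).
- move=> z; apply: fp_eq; last exact: dG0_addG.
  rewrite /fp1 /= -(cod_inv _ _ (ycod (bwd z))).
  by rewrite /bwd yg_addG ginvK.
- apply: fp_map_smooth => [y||]; first exact: Y_regular.
    exact: (yg_smooth F s0 (inr ord0)).
  exact: dG_smooth.
- apply: addG_smooth => [z||]; first exact: manifold_regular.
    exact: fp2_smooth.
  by apply: ginv_smooth => //; exact: fp1_smooth.
Qed.

(** The inverse [lam] of the comparison with the pullback groupoid lifts an arrow of
    [G] between images of objects of [H]. *)
Section FullyFaithful.
Variable lam : pb_arr F0 -> arr H.
Hypotheses (lamK : cancel (to_pullback F) lam) (lamK' : cancel lam (to_pullback F)).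
Hypothesis slam : smooth lam.

Lemma src_lam P : src (lam P) = (sval P).2.
Proof. by rewrite -{2}(lamK' P). Qed.

Lemma tgt_lam P : tgt (lam P) = (sval P).1.1.
Proof. by rewrite -{2}(lamK' P). Qed.

Lemma hom1_lam P : F1 (lam P) = (sval P).1.2.
Proof. by rewrite -{2}(lamK' P). Qed.

Lemma hom1_faithful (h k : arr H) : src h = src k -> tgt h = tgt k -> F1 h = F1 k -> h = k.
Proof.
move=> es et e; rewrite -(lamK h) -(lamK k); congr lam.
by apply: pb_eq; rewrite /= es et e.
Qed.

(** As [F] is fully faithful, there is exactly one arrow of [H] over the composite
    from the vertex [i] to the vertex [j]. *)
Definition liftY_subproof p q (y : Y p q) (i j : 'I_p) :
  pb_cond F0 (yx y j, yg y (inl i) (inl j), yx y i).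
Proof.
by split; rewrite /= ?(cod_src (ycod y)) ?(cod_tgt (ycod y)) yvert.
Qed.

Definition liftY p q (y : Y p q) (i j : 'I_p) : arr H :=
  lam (exist _ _ (liftY_subproof y i j)).

Lemma pb_map_smooth (M : smoothSpace R) (f : M -> pb_arr F0) :
  (forall x : M, regular_at x) -> smooth (fun m => (sval (f m)).1.1) ->
  smooth (fun m => (sval (f m)).1.2) -> smooth (fun m => (sval (f m)).2) -> smooth f.
Proof.
move=> rM /smoothP s1 /smoothP s2 /smoothP s3; apply/smoothP => x.
apply: subspace_map_smooth_at => //; apply: prod_map_smooth_at => //.
exact: prod_map_smooth_at.
Qed.

Lemma liftY_smooth p q i j : smooth (fun y : Y p q => liftY y i j).
Proof.
apply: (@smooth_comp _ (Y p q) (pb_arr F0) (arr H)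
  (fun y => exist _ _ (liftY_subproof y i j)) lam) => //.
apply: pb_map_smooth => [y|||]; first exact: Y_regular.
- exact: yx_smooth.
- exact: yg_smooth.
- exact: yx_smooth.
Qed.

(** A new [H]-vertex amounts to an arrow of [H] out of an old [H]-vertex. *)
Lemma manifold_addH p q : manifold (Y p.+1 q) -> manifold (Y p.+2 q).
Proof.
move=> mY; pose v0 (y : Y p.+1 q) := yx y ord0.
pose Z := fibre_product (@src R H) v0.
have mZ : manifold Z.
  by apply: fibre_product_manifold => //; [exact: (lie_src lH)|exact: yx_smooth].
have [_ _ hs ht _ _] := homP F.
have e (z : Z) : src (F1 (ginv (fp1 z))) = F0 (tgt (fp1 z)) by rewrite hs src_inv.
have e' (z : Z) : tgt (F1 (ginv (fp1 z))) = vert (yg (fp2 z)) (inl ord0).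
  by rewrite ht tgt_inv yvert; congr F0; exact: (svalP z).
pose bwd (z : Z) : Y p.+2 q := addH (e z) (e' z).
pose i1 : 'I_p.+2 := lift ord0 ord0.
have e1 (y : Y p.+2 q) : src (liftY y i1 ord0) = v0 (dH ord0 y) by rewrite src_lam.
pose fwd (y : Y p.+2 q) : Z := exist _ (liftY y i1 ord0, dH ord0 y) (e1 y).
apply: (@manifold_diffeo R (Y p.+2 q) Z fwd bwd) => //.
- move=> y; apply: addH_dH0; first exact: tgt_lam.
  by rewrite hom1_inv hom1_lam; exact: (cod_inv _ _ (ycod y)).
- move=> z; apply: fp_eq; last exact: dH0_addH.
  apply: hom1_faithful.
  + by rewrite src_lam /= yx_addH liftK; exact: esym (svalP z).
  + by rewrite tgt_lam /= yx_addH unlift_none.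
  rewrite hom1_lam /= -(cod_inv _ _ (ycod (bwd z))).
  have := yg_addH (e z) (e' z); rewrite -/(bwd z) /= => ->.
  by rewrite hom1_inv ginvK.
- apply: fp_map_smooth => [y||]; first exact: Y_regular.
    exact: liftY_smooth.
  exact: dH_smooth.
- have sfp1 : smooth (@fp1 R _ _ _ (@src R H) v0) by exact: fp1_smooth.
  apply: addH_smooth => [z|||]; first exact: manifold_regular.
  + exact: fp2_smooth.
  + exact: (smooth_comp sfp1 (lie_tgt lH).1).
  + have sF1 : smooth F1 by have [] := homP F.
    exact: (smooth_comp (ginv_smooth lH sfp1) sF1).
Qed.

(** Vertices are added one at a time, the [H]-vertices after the first by lifting
    along [F]; every step is a fibre product along the source map of [H] or [G].
    The induction starts from the objects of [H] and of [G]. *)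
Theorem manifold_Y p q : (0 < p + q)%N -> manifold (Y p q).
Proof.
elim: q p => [|q IH] [|p] // _.
- by elim: p => [|p IHp]; [exact: manifold_Y10|exact: manifold_addH].
- case: q IH => [_|q IH]; first exact: manifold_Y01.
  by apply: (manifold_addG (inr ord0)); exact: IH.
- by apply: (manifold_addG (inl ord0)); exact: IH.
Qed.

End FullyFaithful.
End MixedManifold.

(** * Nerves *)

Section NerveStrings.
Context {R : realType}.
Variable K : groupoid R.

Lemma string_composable m (g : 'I_m.+2 -> 'I_m.+2 -> arr K) : codiscrete g ->
  @composable R K m.+1 (fun i => g (widen_ord (leqnSn _) i) (lift ord0 i)).
Proof.
move=> c i j ij; rewrite (cod_src c) (cod_tgt c); congr vert.
by apply: val_inj; rewrite /= ij.
Qed.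

Definition string m : forall g : 'I_m.+1 -> 'I_m.+1 -> arr K, codiscrete g -> nerve K m :=
  match m with
  | 0 => fun g _ => vert g ord0
  | m.+1 => fun g c => exist _ _ (string_composable c)
  end.

(** The composite of the arrows from the vertex 0 to the vertex [i]. *)
Definition leg m : nerve K m -> nat -> arr K :=
  match m return nerve K m -> nat -> arr K with
  | 0 => fun x _ => gunit x
  | m'.+1 => fun s => fix leg i :=
      if i is i'.+1 then gm (sval s (inord i')) (leg i') else gunit (src (sval s ord0))
  end.

Definition leg0 m : nerve K m -> obj K :=
  match m return nerve K m -> obj K with
  | 0 => fun x => x
  | m'.+1 => fun s => src (sval s ord0)
  end.

Lemma leg_comp m (s : nerve K m.+1) i : (i <= m)%N ->
  src (sval s (inord i)) = tgt (leg s i).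
Proof.
case: i => [_|i im] /=.
  by rewrite tgt_unit; congr (src (sval s _)); apply: val_inj; rewrite /= inordK.
elim: i im => [|i IH] im /=.
  rewrite tgt_gm; last by rewrite tgt_unit; congr (src (sval s _)); apply: val_inj; rewrite /= inordK.
  by apply: (svalP s); rewrite !inordK // ltnW.
rewrite tgt_gm; last by apply: IH; exact: ltnW.
by apply: (svalP s); rewrite !inordK // ltnW.
Qed.

Lemma src_leg m (s : nerve K m) i : (i <= m)%N -> src (leg s i) = leg0 s.
Proof.
case: m s => [|m] s /=; first by rewrite src_unit.
elim: i => [|i IH] im; first by rewrite src_unit.
by rewrite src_gm ?IH ?(ltnW im) //; exact: leg_comp.
Qed.

(** All the composites, in either direction, of the arrows of a string. *)
Definition edges m (s : nerve K m) : 'I_m.+1 -> 'I_m.+1 -> arr K :=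
  twist (fun _ _ : unit => gunit (leg0 s)) (fun=> tt) (fun u => ginv (leg s u)).

Lemma const_codiscrete J (x : obj K) : codiscrete (fun _ _ : J => gunit x).
Proof.
by split=> [u v|u v|u v w]; rewrite /vert ?src_unit ?tgt_unit // gm1l // tgt_unit.
Qed.

Lemma edges_codiscrete m (s : nerve K m) : codiscrete (edges s).
Proof.
apply: twist_codiscrete; first exact: const_codiscrete.
by move=> u; rewrite /vert src_unit tgt_inv src_leg // -ltnS.
Qed.

Lemma edgesE m (s : nerve K m) u v : edges s u v = gm (leg s v) (ginv (leg s u)).
Proof.
rewrite /edges /twist ginvK [gm (gunit _) _]gm1l //.
by rewrite tgt_inv src_leg // -ltnS.
Qed.

Lemma edgesK m (s : nerve K m) : string (edges_codiscrete s) = s.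
Proof.
case: m s => [|m] s /=.
  by rewrite /vert edgesE /= ginv_unit gm1l ?src_unit ?tgt_unit.
apply: eq_sig_hprop => /=; first by move=> ? ? ?; exact: Prop_irrelevance.
apply/funext => i.
have -> : edges s (widen_ord (leqnSn _) i) (lift ord0 i) =
    gm (gm (sval s (inord i)) (leg s i)) (ginv (leg s i)) by rewrite edgesE lift0.
have e := leg_comp s (ltn_ord i : (i <= m)%N).
by rewrite (gmKr e); congr (sval s _); apply: val_inj; rewrite /= inordK.
Qed.

Lemma leg_string m (g : 'I_m.+1 -> 'I_m.+1 -> arr K) (c : codiscrete g) (u : 'I_m.+1) :
  leg (string c) u = g ord0 u.
Proof.
case: m g c u => [|m] g c u /=.
  by rewrite (ord1 u) (cod_unit _ c).
case: u => i im; elim: i im => [|i IH] im /=.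
  rewrite (cod_src c) (_ : Ordinal im = ord0); last exact: val_inj.
  rewrite (cod_unit _ c); congr (gunit (vert g _)); exact: val_inj.
have im' : (i < m.+2)%N by rewrite ltnW.
rewrite (IH im').
rewrite (_ : widen_ord _ _ = Ordinal im'); last by apply: val_inj; rewrite /= inordK.
rewrite (cod_mul c); congr (g _ _); by apply: val_inj; rewrite /= /bump /= inordK.
Qed.

Lemma edges_string m (g : 'I_m.+1 -> 'I_m.+1 -> arr K) (c : codiscrete g) u v :
  edges (string c) u v = g u v.
Proof. by rewrite edgesE !leg_string (cod_inv _ _ c) (cod_mul c). Qed.

Lemma string_eq m (g g' : 'I_m.+1 -> 'I_m.+1 -> arr K) (c : codiscrete g) (c' : codiscrete g') :
  (forall u v, g u v = g' u v) -> string c = string c'.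
Proof.
move=> e; have eg : g = g' by apply/funext => u; apply/funext => v.
by subst g'; congr string; exact: Prop_irrelevance.
Qed.

(** Together with [edgesK] and [edges_string] this replaces the case distinctions in
    the definition of the faces by the removal of one vertex. *)
Lemma face_string m (i : 'I_m.+2) (g : 'I_m.+2 -> 'I_m.+2 -> arr K) (c : codiscrete g) :
  face m i (string c) = string (cod_reindex (lift i) c).
Proof.
case: m i g c => [|m] i g c.
  rewrite [RHS]/(vert _ _) /=.
  case: eqP => [->|i0].
    rewrite (cod_tgt c); congr vert; exact: val_inj.
  rewrite (cod_src c); congr vert; apply: val_inj => /=.
  have : i != 0%N :> nat by apply/eqP => h; apply: i0; apply: val_inj.
  by rewrite /bump; case: (nat_of_ord i).
apply: eq_sig_hprop => /=; first by move=> ? ? ?; exact: Prop_irrelevance.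
apply/funext => j; rewrite /face_fun /=.
case: ltnP => ji; last case: eqP => ji'.
- by congr (g _ _); apply: val_inj; rewrite /= /bump; lia.
- rewrite -gmE (_ : widen_ord _ (lift ord0 j) = lift ord0 (widen_ord (leqnSn _) j)); last exact: val_inj.
  by rewrite (cod_mul c); congr (g _ _); apply: val_inj; rewrite /= /bump; lia.
- by congr (g _ _); apply: val_inj; rewrite /= /bump; lia.
Qed.

Hypothesis lK : is_lie K.

Lemma nerve_regular m (s : nerve K m) : regular_at s.
Proof.
case: m s => [|m] s /=; first exact: manifold_regular (lie_obj lK).
apply: initial_regular => _; apply: initial_regular => i.
exact: manifold_regular (lie_arr lK).
Qed.

Lemma nerve_arrow_smooth m (i : 'I_m.+1) :
  smooth (fun s : nerve K m.+1 => sval s i).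
Proof.
have s1 : smooth (fun s : powS (arr K) m.+1 => s i).
  exact: (@initial_proj_smooth R 'I_m.+1 (fun=> arr K) _ (fun i p => p i) i).
apply: (@smooth_comp R (nerve K m.+1) (powS (arr K) m.+1) (arr K) sval (fun s => s i)) s1.
exact: (@subspace_val_smooth R (powS (arr K) m.+1)).
Qed.

Lemma leg0_smooth m : smooth (@leg0 m).
Proof.
case: m => [|m]; first exact: smooth_id.
exact: (smooth_comp (nerve_arrow_smooth ord0) (lie_src lK).1).
Qed.

Lemma leg_smooth m i : (i <= m)%N -> smooth (fun s : nerve K m => leg s i).
Proof.
case: m => [|m] im; first exact: (lie_unit lK).
elim: i im => [|i IH] im /=.
  exact: (smooth_comp (@leg0_smooth m.+1) (lie_unit lK)).
apply: (@gm_smooth R K lK (nerve K m.+1)) => [s|s||]; first exact: nerve_regular.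
- exact: leg_comp.
- exact: nerve_arrow_smooth.
- exact: IH (ltnW im).
Qed.

Lemma edges_smooth m u v : smooth (fun s : nerve K m => edges s u v).
Proof.
have -> : (fun s : nerve K m => edges s u v) = fun s => gm (leg s v) (ginv (leg s u)).
  by apply/funext => s; exact: edgesE.
have lu (w : 'I_m.+1) : (w <= m)%N by rewrite -ltnS.
apply: (@gm_smooth R K lK (nerve K m)) => [s|s||]; first exact: nerve_regular.
- by rewrite tgt_inv !src_leg.
- exact: leg_smooth.
- by apply: ginv_smooth => //; exact: leg_smooth.
Qed.

Lemma string_smooth (M : smoothSpace R) m (g : M -> 'I_m.+1 -> 'I_m.+1 -> arr K)
    (c : forall x, codiscrete (g x)) : (forall x : M, regular_at x) ->
  (forall u v, smooth (fun x => g x u v)) -> smooth (fun x => string (c x)).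
Proof.
case: m g c => [|m] g c rM sg; first by apply: vert_smooth.
apply/smoothP => x; apply: subspace_map_smooth_at => //.
apply: initial_map_smooth_at => // i.
by have /smoothP := sg (widen_ord (leqnSn _) i) (lift ord0 i); apply.
Qed.

End NerveStrings.

Section NerveMaps.
Context {R : realType}.
Variables (H G : groupoid R) (F : homomorphism H G).

Lemma hom_codiscrete J (g : J -> J -> arr H) : codiscrete g ->
  codiscrete (fun u v => hom1 F (g u v)).
Proof.
move=> c; have [_ _ hs ht _ _] := homP F.
split=> [u v|u v|u v w]; rewrite /vert ?hs ?ht ?(cod_src c) ?(cod_tgt c) //.
by rewrite -hom1_gm ?(cod_mul c) //; exact: cod_comp.
Qed.

Lemma nerve_map_string m (g : 'I_m.+1 -> 'I_m.+1 -> arr H) (c : codiscrete g) :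
  nerve_map F m (string c) = string (hom_codiscrete c).
Proof.
have [_ _ hs _ _ _] := homP F.
case: m g c => [|m] g c /=; first by rewrite /vert hs.
by apply: eq_sig_hprop => /= [? ? ?|//]; exact: Prop_irrelevance.
Qed.

End NerveMaps.

(** * Triple complexes with exact rows or columns *)

Section TripleComplex.

(** Complexes with three anticommuting differentials, one for each index. The
    identities are required away from p = q = 0 only, since there the signs of the
    complexes of nerves would fail; the cochains considered vanish in that place. *)
Variable X : nat -> nat -> nat -> zmodType.
Variables (d1 : forall p q k, X p q k -> X p.+1 q k)
  (d2 : forall p q k, X p q k -> X p q.+1 k)
  (d3 : forall p q k, X p q k -> X p q k.+1).

Definition t1 (c : forall p q k, X p q k) p : forall q k, X p q k :=
  match p with 0 => fun q k => 0 | p'.+1 => fun q k => d1 (c p' q k) end.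
Definition t2 (c : forall p q k, X p q k) p q : forall k, X p q k :=
  match q with 0 => fun k => 0 | q'.+1 => fun k => d2 (c p q' k) end.
Definition t3 (c : forall p q k, X p q k) p q k : X p q k :=
  match k with 0 => 0 | k'.+1 => d3 (c p q k') end.
Definition D (c : forall p q k, X p q k) p q k : X p q k :=
  t1 c p q k + t2 c p q k + t3 c p q k.

Record triple_complex : Prop := TripleComplex {
  d1B : forall p q k, {morph @d1 p q k : x y / x - y};
  d2B : forall p q k, {morph @d2 p q k : x y / x - y};
  d3B : forall p q k, {morph @d3 p q k : x y / x - y};
  d11 : forall p q k (c : X p q k), (0 < p + q)%N -> d1 (d1 c) = 0;
  d22 : forall p q k (c : X p q k), (0 < p + q)%N -> d2 (d2 c) = 0;
  d33 : forall p q k (c : X p q k), (0 < p + q)%N -> d3 (d3 c) = 0;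
  d12 : forall p q k (c : X p q k), (0 < p + q)%N -> d1 (d2 c) = - d2 (d1 c);
  d13 : forall p q k (c : X p q k), (0 < p + q)%N -> d1 (d3 c) = - d3 (d1 c);
  d23 : forall p q k (c : X p q k), (0 < p + q)%N -> d2 (d3 c) = - d3 (d2 c) }.

Hypothesis tc : triple_complex.

Lemma morphB0 (U V : zmodType) (f : U -> V) : {morph f : x y / x - y} -> f 0 = 0.
Proof. by move=> fB; rewrite -(subrr 0) fB subrr. Qed.

Lemma morphBN (U V : zmodType) (f : U -> V) x : {morph f : x y / x - y} -> f (- x) = - f x.
Proof. by move=> fB; rewrite -[- x]sub0r fB morphB0 // sub0r. Qed.

Lemma morphBD (U V : zmodType) (f : U -> V) : {morph f : x y / x - y} -> {morph f : x y / x + y}.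
Proof. by move=> fB x y; rewrite -[in LHS](opprK y) fB (morphBN y fB) opprK. Qed.

Implicit Types (c z b : forall p q k, X p q k).

Lemma t1B c c' p q k : t1 (fun p q k => c p q k - c' p q k) p q k = t1 c p q k - t1 c' p q k.
Proof. by case: p => [|p] /=; rewrite ?subr0 // (d1B tc). Qed.

Lemma t2B c c' p q k : t2 (fun p q k => c p q k - c' p q k) p q k = t2 c p q k - t2 c' p q k.
Proof. by case: q => [|q] /=; rewrite ?subr0 // (d2B tc). Qed.

Lemma t3B c c' p q k : t3 (fun p q k => c p q k - c' p q k) p q k = t3 c p q k - t3 c' p q k.
Proof. by case: k => [|k] /=; rewrite ?subr0 // (d3B tc). Qed.

Lemma DB c c' p q k : D (fun p q k => c p q k - c' p q k) p q k = D c p q k - D c' p q k.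
Proof. by rewrite /D t1B t2B t3B !opprD [RHS]addrACA [in RHS](addrACA (t1 c p q k)). Qed.

Lemma DD c p q k : (forall k, c 0 0 k = 0) -> D (D c) p q k = 0.
Proof.
move=> c0.
have z1 i j l := morphB0 (@d1B tc i j l).
have z2 i j l := morphB0 (@d2B tc i j l).
have z3 i j l := morphB0 (@d3B tc i j l).
have a1 i j l := morphBD (@d1B tc i j l).
have a2 i j l := morphBD (@d2B tc i j l).
have a3 i j l := morphBD (@d3B tc i j l).
have g0 i j : (0 < i + j)%N \/ (i = 0%N /\ j = 0%N) by lia.
have e11 i j l : d1 (d1 (c i j l)) = 0.
  by have [/(d11 tc)//|[-> ->]] := g0 i j; rewrite c0 !z1.
have e22 i j l : d2 (d2 (c i j l)) = 0.
  by have [/(d22 tc)//|[-> ->]] := g0 i j; rewrite c0 !z2.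
have e33 i j l : d3 (d3 (c i j l)) = 0.
  by have [/(d33 tc)//|[-> ->]] := g0 i j; rewrite c0 !z3.
have e12 i j l : d1 (d2 (c i j l)) = - d2 (d1 (c i j l)).
  by have [/(d12 tc)//|[-> ->]] := g0 i j; rewrite c0 z1 !z2 z1 oppr0.
have e13 i j l : d1 (d3 (c i j l)) = - d3 (d1 (c i j l)).
  by have [/(d13 tc)//|[-> ->]] := g0 i j; rewrite c0 z1 !z3 z1 oppr0.
have e23 i j l : d2 (d3 (c i j l)) = - d3 (d2 (c i j l)).
  by have [/(d23 tc)//|[-> ->]] := g0 i j; rewrite c0 z2 !z3 z2 oppr0.
have T1 c' c'' c''' i j l : t1 (fun p q k => c' p q k + c'' p q k + c''' p q k) i j l =
    t1 c' i j l + t1 c'' i j l + t1 c''' i j l by case: i => [|i] /=; rewrite ?addr0 // !a1.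
have T2 c' c'' c''' i j l : t2 (fun p q k => c' p q k + c'' p q k + c''' p q k) i j l =
    t2 c' i j l + t2 c'' i j l + t2 c''' i j l by case: j => [|j] /=; rewrite ?addr0 // !a2.
have T3 c' c'' c''' i j l : t3 (fun p q k => c' p q k + c'' p q k + c''' p q k) i j l =
    t3 c' i j l + t3 c'' i j l + t3 c''' i j l by case: l => [|l] /=; rewrite ?addr0 // !a3.
have s11 : t1 (t1 c) p q k = 0 by case: p => [|[|p]] /=; rewrite ?z1 ?e11.
have s22 : t2 (t2 c) p q k = 0 by clear s11; case: q => [|[|q]] /=; rewrite ?z2 ?e22.
have s33 : t3 (t3 c) p q k = 0 by clear s11 s22; case: k => [|[|k]] /=; rewrite ?z3 ?e33.
have s12 : t1 (t2 c) p q k = - t2 (t1 c) p q k.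
  by clear s11 s22 s33; case: p => [|p]; case: q => [|q] /=; rewrite ?z1 ?z2 ?oppr0.
have s13 : t1 (t3 c) p q k = - t3 (t1 c) p q k.
  by clear s11 s22 s33 s12; case: p => [|p]; case: k => [|k] /=; rewrite ?z1 ?z3 ?oppr0.
have s23 : t2 (t3 c) p q k = - t3 (t2 c) p q k.
  by clear s11 s22 s33 s12 s13; case: q => [|q]; case: k => [|k] /=; rewrite ?z2 ?z3 ?oppr0.
rewrite /D T1 T2 T3 s11 s22 s33 s12 s13 s23 add0r !addr0.
move: (t2 _ _ _ _) (t3 _ _ _ _) (t3 _ _ _ _) => x y z.
by rewrite addrACA !subrK addNr.
Qed.

Lemma D0 p q k : D (fun p q k => 0) p q k = 0.
Proof.
have h := DB (fun p q k => 0) (fun p q k => 0) p q k; rewrite subrr in h.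
rewrite -[RHS]h; congr (D _ p q k).
by apply: functional_extensionality_dep => i; apply: functional_extensionality_dep => j;
  apply: functional_extensionality_dep => l; rewrite subrr.
Qed.

Lemma eq_D c c' p q k : (forall p q k, c p q k = c' p q k) -> D c p q k = D c' p q k.
Proof.
move=> e; congr (D _ p q k).
by apply: functional_extensionality_dep => i; apply: functional_extensionality_dep => j;
  apply: functional_extensionality_dep => l; exact: e.
Qed.

Definition deg (N : nat) c : Prop := forall p q k, (p + q + k)%N != N -> c p q k = 0.

Lemma deg_D N c : deg N c -> deg N.+1 (D c).
Proof.
move=> dc p q k ne; rewrite /D.
have -> : t1 c p q k = 0.
  case: p ne => [//|p] /eqP ne /=; rewrite dc; last by apply/eqP => e; apply: ne; lia.
  exact: (morphB0 (@d1B tc _ _ _)).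
have -> : t2 c p q k = 0.
  case: q ne => [//|q] /eqP ne /=; rewrite dc; last by apply/eqP => e; apply: ne; lia.
  exact: (morphB0 (@d2B tc _ _ _)).
have -> : t3 c p q k = 0.
  case: k ne => [//|k] /eqP ne /=; rewrite dc; last by apply/eqP => e; apply: ne; lia.
  exact: (morphB0 (@d3B tc _ _ _)).
by rewrite !addr0.
Qed.

Hypothesis row_exact0 : forall q k (c : X 0 q.+1 k), d1 c = 0 -> c = 0.
Hypothesis row_exact : forall p q k (c : X p.+1 q.+1 k), d1 c = 0 ->
  exists b : X p q.+1 k, d1 b = c.

(** The component of largest p of a cocycle is a row cocycle, hence a row coboundary,
    and subtracting the corresponding total coboundary lowers this p; the row q = 0,
    on which exactness is not assumed, stays untouched. *)
Lemma exact_off_axis N z : (forall p q k, D z p q k = 0) -> deg N z ->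
  (forall p k, z p 0 k = 0) ->
  exists b, [/\ forall p q k, D b p q k = z p q k, forall p k, b p 0 k = 0 &
    forall p q k, (p + q + k).+1 != N -> b p q k = 0].
Proof.
suff S A : forall z, (forall p q k, D z p q k = 0) -> deg N z ->
    (forall p k, z p 0 k = 0) -> (forall p q k, (A <= p)%N -> z p q k = 0) ->
  exists b, [/\ forall p q k, D b p q k = z p q k, forall p k, b p 0 k = 0 &
    forall p q k, (p + q + k).+1 != N -> b p q k = 0].
  by move=> Dz dz zq; apply: (S N.+1) => // p q k Np; apply: dz; lia.
elim: A => [|A IH] {}z Dz dz zq zA.
  exists (fun p q k => 0); split=> // p q k; rewrite D0.
  by rewrite zA.
have zrow q k : d1 (z A q k) = 0.
  have := Dz A.+1 q k; rewrite /D /=.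
  have -> : t2 z A.+1 q k = 0.
    by case: q => [//|q] /=; rewrite zA ?(morphB0 (@d2B tc _ _ _)).
  have -> : t3 z A.+1 q k = 0.
    by case: k => [//|k] /=; rewrite zA ?(morphB0 (@d3B tc _ _ _)).
  by rewrite !addr0.
have hb p q k : exists b : X p q k,
    (forall e : p.+1 = A, d1 b = ecast i (X i q k) (esym e) (z A q k)) /\
    (p.+1 != A \/ z A q k = 0 -> b = 0).
  have [e|ne] := eqVneq p.+1 A; last first.
    by exists 0; split=> // e; rewrite e eqxx in ne.
  subst A; have [z0|nz0] := eqVneq (z p.+1 q k) 0.
    exists 0; split=> // e; rewrite (Prop_irrelevance e erefl) /= z0.
    exact: (morphB0 (@d1B tc _ _ _)).
  case: q nz0 => [|q] nz0; first by rewrite zq eqxx in nz0.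
  have [b bE] := row_exact (zrow q.+1 k).
  exists b; split=> [e|[|z0]]; first by rewrite (Prop_irrelevance e erefl).
  - by move/eqP.
  - by rewrite z0 eqxx in nz0.
pose b p q k := projT1 (cid (hb p q k)).
have bP p q k := projT2 (cid (hb p q k)); rewrite -/(b _ _ _) in bP.
have b0 p q k : p.+1 != A \/ z A q k = 0 -> b p q k = 0 by have [_] := bP p q k.
have bA p q k (e : p.+1 = A) : d1 (b p q k) = ecast i (X i q k) (esym e) (z A q k).
  by have [h _] := bP p q k.
have bq p k : b p 0 k = 0 by apply: b0; right.
pose z' p q k := z p q k - D b p q k.
have Db p q k : (A <= p)%N -> D b p q k = z p q k.
  move=> Ap; have n2 : t2 b p q k = 0.
    by case: q => [//|q] /=; rewrite b0 ?(morphB0 (@d2B tc _ _ _)) //; left; lia.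
  have n3 : t3 b p q k = 0.
    by clear n2; case: k => [//|k] /=; rewrite b0 ?(morphB0 (@d3B tc _ _ _)) //; left; lia.
  rewrite /D n2 n3 !addr0; case: p Ap {n2 n3} => [|p] Ap /=.
    have A0 : A = 0%N by lia.
    case: q => [|q]; first by rewrite zq.
    by subst A; rewrite (row_exact0 (zrow q.+1 k)).
  have [e|ne] := eqVneq p.+1 A.
    by rewrite (bA _ _ _ e); subst A.
  by rewrite (b0 _ _ _ (or_introl ne)) (morphB0 (@d1B tc _ _ _)) zA //; lia.
have bdeg p q k : (p + q + k).+1 != N -> b p q k = 0.
  move=> ne; have [e|ne'] := eqVneq p.+1 A; last by apply: b0; left.
  by apply: b0; right; apply: dz; lia.
have [b' [Db' b'q b'd]] : exists b', [/\ forall p q k, D b' p q k = z' p q k,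
    forall p k, b' p 0 k = 0 & forall p q k, (p + q + k).+1 != N -> b' p q k = 0].
  apply: IH => [p q k|p q k ne|p k|p q k Ap].
  - by rewrite DB Dz DD ?subrr // => k'; exact: bq.
  - rewrite /z' dz // sub0r; case: N ne bdeg {dz} => [|N] ne bdeg.
      have bz i j l : b i j l = 0 by exact: bdeg.
      by rewrite (eq_D (c' := fun _ _ _ => 0)) // D0 oppr0.
    rewrite (@deg_D N b) ?oppr0 // => i j l ne'; apply: bdeg; lia.
  - rewrite /z' zq sub0r /D /=.
    have -> : t1 b p 0 k = 0 by case: p => [//|p] /=; rewrite bq (morphB0 (@d1B tc _ _ _)).
    have -> : t3 b p 0 k = 0 by case: k => [//|k] /=; rewrite bq (morphB0 (@d3B tc _ _ _)).
    by rewrite !addr0 oppr0.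
  - by rewrite /z' Db // subrr.
exists (fun p q k => b' p q k - (- b p q k)); split=> [p q k|p k|p q k ne].
- rewrite (DB b' (fun p q k => - b p q k)) Db' /z'.
  have -> : D (fun p q k => - b p q k) p q k = - D b p q k.
    rewrite -[RHS]sub0r -[X in X - _](D0 p q k) -DB.
    by apply: eq_D => i j l; rewrite sub0r.
  by rewrite opprK subrK.
- by rewrite b'q bq !oppr0 addr0.
- by rewrite b'd // bdeg // !oppr0 addr0.
Qed.

End TripleComplex.

(** The statement for the other axis, by exchanging the first two indices. *)
Section Exchange.
Variable X : nat -> nat -> nat -> zmodType.
Variables (d1 : forall p q k, X p q k -> X p.+1 q k)
  (d2 : forall p q k, X p q k -> X p q.+1 k)
  (d3 : forall p q k, X p q k -> X p q k.+1).
Hypothesis tc : triple_complex d1 d2 d3.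

Let X' p q k : zmodType := X q p k.
Let d1' p q k (c : X' p q k) : X' p.+1 q k := d2 c.
Let d2' p q k (c : X' p q k) : X' p q.+1 k := d1 c.
Let d3' p q k (c : X' p q k) : X' p q k.+1 := d3 c.

Let tc' : triple_complex d1' d2' d3'.
Proof.
split=> p q k; rewrite /d1' /d2' /d3'.
- exact: (d2B tc).
- exact: (d1B tc).
- exact: (d3B tc).
- by move=> c pq; rewrite (d22 tc) // addnC.
- by move=> c pq; rewrite (d11 tc) // addnC.
- by move=> c pq; rewrite (d33 tc) // addnC.
- by move=> c pq; rewrite (d12 tc) ?opprK // addnC.
- by move=> c pq; rewrite (d23 tc) // addnC.
- by move=> c pq; rewrite (d13 tc) // addnC.
Qed.

Let D' (c : forall p q k, X p q k) p q k :
  D d1' d2' d3' (fun p q k => c q p k) p q k = D d1 d2 d3 c q p k.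
Proof.
by rewrite /D; congr (_ + _); rewrite addrC; congr (_ + _); [case: q|case: p].
Qed.

Hypothesis column_exact0 : forall p k (c : X p.+1 0 k), d2 c = 0 -> c = 0.
Hypothesis column_exact : forall p q k (c : X p.+1 q.+1 k), d2 c = 0 ->
  exists b : X p.+1 q k, d2 b = c.

Lemma exact_off_other_axis N (z : forall p q k, X p q k) :
  (forall p q k, D d1 d2 d3 z p q k = 0) -> deg N z -> (forall q k, z 0 q k = 0) ->
  exists b, [/\ forall p q k, D d1 d2 d3 b p q k = z p q k, forall q k, b 0 q k = 0 &
    forall p q k, (p + q + k).+1 != N -> b p q k = 0].
Proof.
move=> Dz dz z0.
have [||p q k|p q k ne|q k|b [Db b0 bd]] := @exact_off_axis X' d1' d2' d3' tc' _ _ N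
    (fun p q k => z q p k).
- by move=> q k c; exact: column_exact0.
- by move=> p q k c; exact: column_exact.
- by rewrite D'; exact: Dz.
- by apply: dz; rewrite (addnC q).
- exact: (z0 q k).
exists (fun p q k => b q p k); split=> [p q k|q k|p q k ne].
- by rewrite -D'; exact: Db.
- exact: b0.
- by apply: bd; rewrite (addnC q).
Qed.

End Exchange.

(** * The triple complex of a homomorphism *)

Section Pullbacks.
Context {R : realType}.
Variables (E : sheafComplex R) (k : nat).
Implicit Types M N Q : smoothSpace R.

Local Notation S M := (bs_sheaf (sc_sheaf E k) M).

Definition pull M N (f : M -> N) (c : sect (S N) setT) : sect (S M) setT :=
  comor (bs_map (sc_sheaf E k) f) setT c.

Lemma pull_linear M N (f : M -> N) : linear (pull f).
Proof. by move=> a u v; rewrite /pull linearP. Qed.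

HB.instance Definition _ M N (f : M -> N) :=
  GRing.isLinear.Build R (sect (S N) setT) (sect (S M) setT) *:%R (pull f) (pull_linear f).

Lemma pull_comp M N Q (f : M -> N) (g : N -> Q) c :
  manifold M -> manifold N -> manifold Q -> smooth f -> smooth g ->
  pull f (pull g c) = pull (g \o f) c.
Proof. by move=> mM mN mQ sf sg; rewrite /pull bs_comp //; exact: openT. Qed.

Lemma eq_pull M N (f g : M -> N) c : (forall x, f x = g x) -> pull f c = pull g c.
Proof. by move=> /funext ->. Qed.

Lemma pull_id M (f : M -> M) c : manifold M -> (forall x, f x = x) -> pull f c = c.
Proof.
move=> mM fE; rewrite (eq_pull (g := id)) // /pull bs_id //; exact: openT.
Qed.

Lemma pull_retract M N (f : M -> N) (g : N -> M) c :
  manifold M -> manifold N -> smooth f -> smooth g -> (forall x, g (f x) = x) ->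
  pull f (pull g c) = c.
Proof. by move=> mM mN sf sg gf; rewrite pull_comp // pull_id. Qed.

Lemma pull_square M N N' Q (f : M -> N) (g : N -> Q) (f' : M -> N') (g' : N' -> Q) c :
  manifold M -> manifold N -> manifold N' -> manifold Q ->
  smooth f -> smooth g -> smooth f' -> smooth g' -> (forall x, g (f x) = g' (f' x)) ->
  pull f (pull g c) = pull f' (pull g' c).
Proof. by move=> mM mN mN' mQ sf sg sf' sg' h; rewrite !pull_comp //; exact: eq_pull. Qed.

End Pullbacks.

Section AlternatingSums.
Variables (R : pzRingType) (V : lmodType R).

(** The simplicial identity pairs the terms with i <= j with those with i > j, with
    opposite signs. *)
Lemma alternating_double_sum n (a : 'I_n.+2 -> 'I_n.+1 -> V) :
  (forall i j : 'I_n.+1, (i <= j)%N ->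
     a (lift ord0 j) i = a (widen_ord (leqnSn _) i) j) ->
  \sum_(j < n.+2) \sum_(i < n.+1) (-1) ^+ (j + i) *: a j i = 0.
Proof.
move=> h.
under eq_bigr => j _ do rewrite (bigID (fun i : 'I_n.+1 => (i < j)%N)) /=.
rewrite big_split /= big_ord_recl /= [X in X + _ + _]big1 ?add0r // .
rewrite [X in _ + X]big_ord_recr /= [X in _ + (_ + X)]big1 ?addr0; last first.
  by move=> i; rewrite -leqNgt leqNgt ltn_ord.
rewrite (exchange_big_dep xpredT) //= -big_split /= big1 // => i _.
rewrite [X in _ + X](eq_bigl (fun j : 'I_n.+1 => (i <= j)%N)); last first.
  by move=> j; rewrite -leqNgt.
rewrite (eq_bigl (fun j : 'I_n.+1 => (i <= j)%N)) -?big_split /=; last first.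
  by move=> j; rewrite /bump /= add1n ltnS.
rewrite big1 // => j ij.
by rewrite h // /bump /= add1n addSn exprS mulN1r scaleNr addnC addNr.
Qed.

Lemma sign_sum_recl n (f : 'I_n.+1 -> V) s :
  \sum_(i < n.+1) (-1) ^+ (s + i) *: f i =
  (-1) ^+ s *: f ord0 - \sum_(i < n) (-1) ^+ (s + i) *: f (lift ord0 i).
Proof.
rewrite big_ord_recl /= addn0 -sumrN; congr (_ + _); apply: eq_bigr => i _.
by rewrite /bump /= add1n addnS exprS mulN1r scaleNr.
Qed.

End AlternatingSums.

Section MixedComplex.
Context {R : realType}.
Variables (H G : groupoid R) (F : homomorphism H G) (E : sheafComplex R).
Hypotheses (lH : is_lie H) (lG : is_lie G).

Local Notation F0 := (hom0 F).
Local Notation Y := (Y F).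
Local Notation S k M := (bs_sheaf (sc_sheaf E k) M).

Definition X p q k : lmodType R := sect (S k (Y p q)) setT.

(** The signs of [dd2] and [dd3] make the three differentials anticommute. Strings
    with p + q vertices have length p + q - 1, so on the two axes, where one of
    [dd1], [dd2] is absent, [dd3] has the sign of the total complexes of the nerves. *)
Definition dd1 p q k (c : X p q k) : X p.+1 q k :=
  \sum_(i < p.+1) (-1) ^+ i *: (pull (@dH R H G F p q i) c : X p.+1 q k).
Definition dd2 p q k (c : X p q k) : X p q.+1 k :=
  \sum_(j < q.+1) (-1) ^+ (p + j) *: (pull (@dG R H G F p q j) c : X p q.+1 k).
Definition dd3 p q k (c : X p q k) : X p q k.+1 :=
  (-1) ^+ (p + q).-1 *: (sc_d E k setT c : X p q k.+1).

Hypothesis mY : forall p q, (0 < p + q)%N -> manifold (Y p q).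

Let sH p q i : smooth (@dH R H G F p q i).
Proof. exact: dH_smooth. Qed.
Let sG p q j : smooth (@dG R H G F p q j).
Proof. exact: dG_smooth. Qed.

Lemma yg_dH p q i (y : Y p.+1 q) u v :
  yg (dH i y) u v = yg y (smap (lift i) id u) (smap (lift i) id v).
Proof. by []. Qed.

Lemma yg_dG p q j (y : Y p q.+1) u v :
  yg (dG j y) u v = yg y (smap id (lift j) u) (smap id (lift j) v).
Proof. by []. Qed.

Lemma lift_liftC n (i j : 'I_n.+1) (u : 'I_n) : (i <= j)%N ->
  lift (lift ord0 j) (lift i u) = lift (widen_ord (leqnSn _) i) (lift j u).
Proof. by move=> ij; apply: val_inj; rewrite /= /bump /=; lia. Qed.

Lemma dH_dH p q (i j : 'I_p.+1) (y : Y p.+2 q) : (i <= j)%N ->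
  dH i (dH (lift ord0 j) y) = dH j (dH (widen_ord (leqnSn _) i) y).
Proof.
move=> ij; apply: yP => [u|u v]; first by rewrite !yx_dH lift_liftC.
by rewrite !yg_dH; case: u => u; case: v => v /=; rewrite ?lift_liftC.
Qed.

Lemma dG_dG p q (i j : 'I_q.+1) (y : Y p q.+2) : (i <= j)%N ->
  dG i (dG (lift ord0 j) y) = dG j (dG (widen_ord (leqnSn _) i) y).
Proof.
move=> ij; apply: yP => [//|u v].
by rewrite !yg_dG; case: u => u; case: v => v /=; rewrite ?lift_liftC.
Qed.

Lemma dH_dG p q (i : 'I_p.+1) (j : 'I_q.+1) (y : Y p.+1 q.+1) :
  dH i (dG j y) = dG j (dH i y).
Proof. by apply: yP => [//|[u|u] [v|v]]. Qed.

Lemma sc_d_pull (k : nat) (M N : smoothSpace R) (f : M -> N) (c : sect (S k N) setT) :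
  manifold M -> manifold N -> smooth f ->
  sc_d E k setT (pull f c) = pull f (sc_d E k setT c).
Proof. by move=> mM mN sf; rewrite /pull -sc_d_map //; exact: openT. Qed.

Lemma mixed_triple_complex : triple_complex dd1 dd2 dd3.
Proof.
have oT (M : smoothSpace R) : open [set: M] by exact: openT.
split.
- move=> p q k x y; rewrite /dd1 -sumrB; apply: eq_bigr => i _.
  by rewrite linearB scalerBr.
- move=> p q k x y; rewrite /dd2 -sumrB; apply: eq_bigr => i _.
  by rewrite linearB scalerBr.
- by move=> p q k x y; rewrite /dd3 linearB scalerBr.
- move=> p q k c pq.
  rewrite -[RHS](@alternating_double_sum R _ _
     (fun j i => pull (@dH R H G F p q i \o @dH R H G F p.+1 q j) c)).
    apply: eq_bigr => j _; rewrite linear_sum scaler_sumr; apply: eq_bigr => i _.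
    rewrite linearZ /= scalerA -exprD pull_comp //; exact: mY.
  by move=> i j ij; apply: eq_pull => y /=; exact: dH_dH.
- move=> p q k c pq.
  have pq1 : (0 < p + q.+1)%N by rewrite addnS.
  have pq2 : (0 < p + q.+2)%N by rewrite addnS.
  rewrite -[RHS](@alternating_double_sum R _ _
     (fun j i => pull (@dG R H G F p q i \o @dG R H G F p q.+1 j) c)).
    apply: eq_bigr => j _; rewrite linear_sum scaler_sumr; apply: eq_bigr => i _.
    rewrite linearZ /= scalerA -exprD pull_comp //; try exact: mY.
    congr (_ *: _); rewrite addnACA exprD -signr_odd oddD addbb expr0 mul1r //.
  by move=> i j ij; apply: eq_pull => y /=; exact: dG_dG.
- move=> p q k c pq; rewrite /dd3 linearZ /= sc_dd ?scaler0 //; exact: mY.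
- move=> p q k c pq.
  have pq1 : (0 < p + q.+1)%N by rewrite addnS.
  rewrite /dd1 /dd2 -sumrN.
  under eq_bigr => i _ do rewrite linear_sum scaler_sumr.
  rewrite exchange_big /=; apply: eq_bigr => j _.
  rewrite linear_sum scaler_sumr -sumrN; apply: eq_bigr => i _.
  rewrite !linearZ /= !scalerA -!exprD !pull_comp //; try exact: mY.
  rewrite scalerN -scaleNr; congr (_ *: _).
    by rewrite !addSn exprS mulN1r opprK.
  by apply: eq_pull => y /=; rewrite dH_dG.
- move=> p q k c pq; rewrite /dd1 /dd3 linear_sum scaler_sumr -sumrN.
  apply: eq_bigr => i _.
  rewrite !linearZ /= !scalerA sc_d_pull //; try exact: mY.
  rewrite scalerN -scaleNr; congr (_ *: _).
  by rewrite -[in RHS](prednK pq) exprS mulN1r mulNr opprK.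
- move=> p q k c pq; rewrite /dd2 /dd3 linear_sum scaler_sumr -sumrN.
  have pq1 : (0 < p + q.+1)%N by rewrite addnS.
  apply: eq_bigr => i _.
  rewrite !linearZ /= !scalerA sc_d_pull //; try exact: mY.
  rewrite scalerN -scaleNr; congr (_ *: _).
  by rewrite addnS /= -[in RHS](prednK pq) exprS mulN1r mulNr opprK.
Qed.

End MixedComplex.

(** * Exactness of the columns and of the rows *)

Section ColumnExactness.
Context {R : realType}.
Variables (H G : groupoid R) (F : homomorphism H G) (E : sheafComplex R).
Hypotheses (lH : is_lie H) (lG : is_lie G).

Local Notation F0 := (hom0 F).
Local Notation F1 := (hom1 F).
Local Notation Y := (Y F).
Local Notation S k M := (bs_sheaf (sc_sheaf E k) M).
Local Notation X := (X F E).

Hypothesis mY : forall p q, (0 < p + q)%N -> manifold (Y p q).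

Lemma double_vertex_subproof p q (y : Y p.+1 q) :
  tgt (gunit (vert (yg y) (inl ord0))) = vert (yg y) (inl ord0).
Proof. exact: tgt_unit. Qed.

(** The image under [F] of the first [H]-vertex, repeated as the first [G]-vertex:
    an extra degeneracy of the simplicial space [q |-> Y p q] for p > 0. *)
Definition double_vertex p q (y : Y p.+1 q) : Y p.+1 q.+1 :=
  addG (double_vertex_subproof y).

Lemma double_vertex_smooth p q : smooth (@double_vertex p q).
Proof.
apply: (@addG_smooth _ _ _ F lG (Y p.+1 q) p.+1 q id (inl ord0)
  (fun y => gunit (vert (yg y) (inl ord0)))) => [y||]; first exact: Y_regular.
  exact: smooth_id.
apply: (@smooth_comp _ (Y p.+1 q) (obj G) (arr G) (fun y => vert (yg y) (inl ord0)) gunit).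
  exact: yvert_smooth.
exact: (lie_unit lG).
Qed.

Lemma dG0_double p q (y : Y p.+1 q) : dG ord0 (double_vertex y) = y.
Proof. exact: dG0_addG. Qed.

Lemma dG_double p q j (y : Y p.+1 q.+1) :
  dG (lift ord0 j) (double_vertex y) = double_vertex (dG j y).
Proof. exact: dG_addG. Qed.

Lemma column_exact0 p k (c : X p.+1 0 k) : dd2 c = 0 -> c = 0.
Proof.
move=> dc; have := congr1 (pull (@double_vertex p 0)) dc.
rewrite /dd2 big_ord_recl big_ord0 addr0 linearZ /= linear0.
rewrite pull_retract; [|exact: mY|exact: mY|exact: double_vertex_smooth|exact: dG_smooth|
  exact: dG0_double].
move/(congr1 (fun x => (-1) ^+ (p.+1 + 0) *: x)).
by rewrite scaler0 scalerA -expr2 sqrr_sign scale1r.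
Qed.

(** Pullback along the extra degeneracy is a contracting homotopy. *)
Lemma column_exact p q k (c : X p.+1 q.+1 k) : dd2 c = 0 ->
  exists b : X p.+1 q k, dd2 b = c.
Proof.
move=> dc; exists ((-1) ^+ p.+1 *: (pull (@double_vertex p q) c : X p.+1 q k)).
have {dc} : \sum_(j < q.+1) (-1) ^+ (p.+1 + j) *:
    (pull (@dG R H G F p.+1 q.+1 (lift ord0 j)) c : X p.+1 q.+2 k) =
    (-1) ^+ p.+1 *: (pull (dG ord0) c : X p.+1 q.+2 k).
  by move: dc; rewrite /dd2 sign_sum_recl => /subr0_eq.
move=> /(congr1 (pull (@double_vertex p q.+1))).
rewrite linear_sum linearZ /= pull_retract;
  [|exact: mY|exact: mY|exact: double_vertex_smooth|exact: dG_smooth|exact: dG0_double].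
move=> h; rewrite /dd2.
transitivity ((-1) ^+ p.+1 *: ((-1) ^+ p.+1 *: c)); last first.
  by rewrite scalerA -expr2 sqrr_sign scale1r.
rewrite -h scaler_sumr; apply: eq_bigr => j _.
rewrite !linearZ /= !scalerA mulrC; congr (_ *: _).
rewrite pull_comp; [|exact: mY|exact: mY|exact: mY|exact: dG_smooth|exact: double_vertex_smooth].
rewrite pull_comp; [|exact: mY|exact: mY|exact: mY|exact: double_vertex_smooth|exact: dG_smooth].
by apply: eq_pull => y; exact: esym (dG_double j y).
Qed.

End ColumnExactness.

Section RowExactness.
Context {R : realType}.
Variables (H G : groupoid R) (F : homomorphism H G) (E : sheafComplex R).
Hypotheses (lH : is_lie H) (lG : is_lie G).

Local Notation F0 := (hom0 F).
Local Notation F1 := (hom1 F).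
Local Notation Y := (Y F).
Local Notation S k M := (bs_sheaf (sc_sheaf E k) M).
Local Notation X := (X F E).
Local Notation P := (fibre_product (@src R G) F0).

Hypothesis mY : forall p q, (0 < p + q)%N -> manifold (Y p q).

Definition gvert p q (y : Y p q.+1) : obj G := vert (yg y) (inr ord0).

Lemma gvert_smooth p q : smooth (@gvert p q).
Proof. exact: yvert_smooth. Qed.

Let mY1 p q : manifold (Y p q.+1).
Proof. by apply: mY; rewrite addnS. Qed.

(** Over an open set of [G_0] with a section of the evaluation map, one can choose
    smoothly an object of [H] and an arrow from its image to the first [G]-vertex, and
    insert this object as a new first [H]-vertex. *)
Section LocalSection.
Variables (V : set (obj G)) (s : obj G -> P).
Hypotheses (oV : open V) (sK : forall y, V y -> tgt (fp1 (s y)) = y)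
  (ss : forall y, V y -> smooth_at s y).

Definition over p q : set (Y p q.+1) := @gvert p q @^-1` V.

Lemma over_open p q : open (@over p q).
Proof. by have /continuousP := (gvert_smooth p q).1; apply. Qed.

Local Notation O p q := (subspaceS (@over p q)).

Let mO p q : manifold (O p q).
Proof. by apply: open_subspace_manifold => //; exact: over_open. Qed.

Definition incl p q (o : O p q) : Y p q.+1 := sval o.

Let soval (p q : nat) : smooth (@incl p q).
Proof. exact: subspace_val_smooth. Qed.

Lemma insert_src p q (o : O p q) :
  src (fp1 (s (gvert (sval o)))) = F0 (fp2 (s (gvert (sval o)))).
Proof. exact: (svalP (s _)). Qed.

Lemma insert_tgt p q (o : O p q) :
  tgt (fp1 (s (gvert (sval o)))) = vert (yg (sval o)) (inr ord0).
Proof. by rewrite sK //; exact: (svalP o). Qed.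

Definition insert p q (o : O p q) : Y p.+1 q.+1 := addH (insert_src o) (insert_tgt o).

Lemma insert_smooth p q : smooth (@insert p q).
Proof.
have rO (o : O p q) : regular_at o by exact: manifold_regular.
have sO : smooth (fun o : O p q => s (gvert (sval o))).
  apply/smoothP => o; apply: (@smooth_at_comp _ (O p q) (obj G) P (fun o => gvert (sval o)) s).
    by have /smoothP := @smooth_comp _ (O p q) (Y p q.+1) (obj G) (@incl p q) (@gvert p q) (soval p q) (@gvert_smooth p q).
  by apply: ss; exact: (svalP o).
apply: addH_smooth => //.
- exact: smooth_comp sO (@fp2_smooth R _ _ _ (@src R G) F0).
- exact: smooth_comp sO (@fp1_smooth R _ _ _ (@src R G) F0).
Qed.

Definition dO p q i (o : O p.+1 q) : O p q := exist _ (dH i (sval o)) (svalP o).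

Lemma dO_smooth p q i : smooth (@dO p q i).
Proof.
apply/smoothP => o; apply: subspace_map_smooth_at; first exact: manifold_regular.
have /smoothP := @smooth_comp _ (O p.+1 q) (Y p.+1 q.+1) (Y p q.+1) (@incl p.+1 q) (@dH R H G F p q.+1 i)
  (soval p.+1 q) (dH_smooth F lH lG q.+1 i); exact.
Qed.

Lemma dH0_insert p q (o : O p q) : dH ord0 (insert o) = sval o.
Proof. exact: dH0_addH. Qed.

Lemma dH_insert p q i (o : O p.+1 q) : dH (lift ord0 i) (insert o) = insert (dO i o).
Proof. exact: dH_addH. Qed.

Lemma pull_insert_d p q k (c : X p.+1 q.+1 k) : dd1 c = 0 ->
  \sum_(i < p.+1) (-1) ^+ i *:
     pull (@insert p.+1 q) (pull (@dH R H G F p.+1 q.+1 (lift ord0 i)) c) =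
  pull (@incl p.+1 q) c.
Proof.
move=> dc; have : \sum_(i < p.+1) (-1) ^+ i *:
    (pull (@dH R H G F p.+1 q.+1 (lift ord0 i)) c : X p.+2 q.+1 k) =
    (pull (dH ord0) c : X p.+2 q.+1 k).
  have := dc; rewrite /dd1.
  have := @sign_sum_recl R (X p.+2 q.+1 k) p.+1
    (fun i => pull (@dH R H G F p.+1 q.+1 i) c) 0.
  rewrite expr0 scale1r => -> /subr0_eq -> //.
move=> /(congr1 (pull (@insert p.+1 q))); rewrite linear_sum /=.
rewrite pull_comp //; [|exact: insert_smooth|exact: dH_smooth].
have -> : pull (dH ord0 \o @insert p.+1 q) c = pull (@incl p.+1 q) c.
  by apply: eq_pull => o; exact: dH0_insert.
move=> <-; by apply: eq_bigr => i _; rewrite linearZ.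
Qed.

Section OverV.
Variables (p q k : nat).

Local Notation A := (over (p := p) (q := q)).

(** A sheaf on the big site has the same sections on an open set as on the
    corresponding open subspace; [incl] translates between the two. *)
Lemma restrict_bij :
  bijective (comor (bs_map (sc_sheaf E k) (@incl p q)) A).
Proof. by apply: bs_open; [exact: mY1|exact: over_open|exact: over_open|]. Qed.

Lemma restrict_pull (c : X p q.+1 k) :
  comor (bs_map (sc_sheaf E k) (@incl p q)) A (res _ setT A c) =
  res _ setT (@incl p q @^-1` A) (pull (@incl p q) c).
Proof. by rewrite comor_res //; [exact: openT|exact: over_open]. Qed.

End OverV.
End LocalSection.

Hypothesis local_section : forall y : obj G, exists (V : set (obj G)) (s : obj G -> P),
  [/\ open V, V y, forall y, V y -> tgt (fp1 (s y)) = y & forall y, V y -> smooth_at s y].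

Lemma row_exact0 q k (c : X 0 q.+1 k) : dd1 c = 0 -> c = 0.
Proof.
move=> dc; pose good (V : set (obj G)) := exists s : obj G -> P,
  [/\ open V, forall y, V y -> tgt (fp1 (s y)) = y & forall y, V y -> smooth_at s y].
apply: (@sect_eq R (Y 0 q.+1) (S k (Y 0 q.+1)) {V | good V}
  (fun V => over (sval V) (p := 0) (q := q))).
- by move=> [V [s [oV sK ss]]]; exact: over_open.
- move=> y; have [V [s [oV Vy sK ss]]] := local_section (gvert y).
  by have gV : good V by [exists s]; exists (exist _ V gV).
- move=> [V [s [oV sK ss]]] /=; apply: (bij_inj (restrict_bij oV 0 q k)).
  rewrite restrict_pull // !linear0.
  have -> : pull (@incl V 0 q) c = 0.
    rewrite -(eq_pull (f := dH ord0 \o insert sK (p := 0) (q := q))); last first.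
      by move=> o; exact: dH0_insert.
    rewrite -pull_comp; [|by apply: open_subspace_manifold => //; exact: over_open|
      exact: mY|exact: mY|exact: insert_smooth|exact: dH_smooth].
    by move: dc; rewrite /dd1 big_ord_recl big_ord0 addr0 expr0 scale1r => ->; rewrite linear0.
  by rewrite linear0.
Qed.

Section RowOperator.
Variables (p q k : nat).

Local Notation W r := (pushforward (S k (Y r q.+1)) (@gvert_smooth r q)).

(** [dd1] as a morphism of sheaves on [G_0], over which [Y p q] lies by the first
    [G]-vertex; the faces that remove [H]-vertices leave this vertex alone. *)
Definition row_operator (U : set (obj G)) (e : sect (W p) U) : sect (W p.+1) U :=
  \sum_(i < p.+1) (-1) ^+ i *:
    (comor (bs_map (sc_sheaf E k) (@dH R H G F p q.+1 i)) (@gvert p q @^-1` U) e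
      : sect (W p.+1) U).

Lemma row_operatorB U : {morph @row_operator U : x y / x - y}.
Proof.
move=> x y; rewrite /row_operator -sumrB; apply: eq_bigr => i _.
by rewrite linearB scalerBr.
Qed.

Lemma row_operator_res U V e : open U -> open V -> V `<=` U ->
  @row_operator V (res (W p) U V e) = res (W p.+1) U V (row_operator e).
Proof.
move=> oU oV VU; rewrite /row_operator linear_sum; apply: eq_bigr => i _.
rewrite linearZ; congr (_ *: _).
apply: (@comor_res _ _ _ _ _ _ (bs_map (sc_sheaf E k) (@dH R H G F p q.+1 i))
  (@gvert p q @^-1` U) (@gvert p q @^-1` V) e).
- by have /continuousP := (@gvert_smooth p q).1; apply.
- by have /continuousP := (@gvert_smooth p q).1; apply.
- by move=> x; exact: VU.
Qed.

Lemma row_operator_act U (a : obj G -> R) e : open U -> smooth_on U a ->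
  @row_operator U (act (W p) a e) = act (W p.+1) a (row_operator e).
Proof.
move=> oU sa; rewrite /row_operator act_sum //; last first.
  by move=> x _; exact: manifold_regular (lie_obj lG).
apply: eq_bigr => i _; congr (_ *: _).
apply: (@comor_act _ _ _ _ _ _ (bs_map (sc_sheaf E k) (@dH R H G F p q.+1 i))
  (@gvert p q @^-1` U) (a \o @gvert p q) e).
  by have /continuousP := (@gvert_smooth p q).1; apply.
by move=> x Ux; apply: (@gvert_smooth p q).2; exact: sa.
Qed.

End RowOperator.

(** Over an open set with such a section, inserting the new vertex gives a contracting
    homotopy; the local solutions are glued by a partition of unity on [G_0], which is
    where [G_0] has to be Hausdorff. *)
Lemma row_exact p q k (c : X p.+1 q.+1 k) : dd1 c = 0 ->
  exists b : X p q.+1 k, dd1 b = c.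
Proof.
move=> dc.
pose W r := pushforward (S k (Y r q.+1)) (@gvert_smooth r q).
pose L U : {additive sect (W p) U -> sect (W p.+1) U} :=
  HB.pack (@row_operator p q k U)
    (GRing.isZmodMorphism.Build _ _ (@row_operator p q k U) (@row_operatorB p q k U)).
have [||y|e eP] := @solve_globally R (obj G) (W p) (W p.+1) (lie_obj lG) (lie_obj_hausdorff lG)
  L _ _ c.
- by move=> U V e; exact: row_operator_res.
- by move=> U a e; exact: row_operator_act.
- have [V [s [oV Vy sK ss]]] := local_section y.
  have mO r : manifold (subspaceS (over V (p := r) (q := q))).
    by apply: open_subspace_manifold => //; exact: over_open.
  pose inc r := @incl V r q.
  have sinc r : smooth (inc r) by exact: subspace_val_smooth.
  have [g gK gK'] := restrict_bij oV p q k.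
  pose w : sect (S k (subspaceS (over V (p := p) (q := q)))) setT := pull (insert sK (q := q)) c.
  pose e := g (res _ setT _ w).
  have oA r : open (over V (p := r) (q := q)) by exact: over_open.
  exists V, e; split=> //.
  apply: (bij_inj (restrict_bij oV p.+1 q k)).
  transitivity (res (S k (subspaceS (over V (p := p.+1) (q := q)))) setT
    (inc p.+1 @^-1` over V (q := q)) (pull (inc p.+1) c)); last first.
    by symmetry; exact: restrict_pull.
  rewrite -(pull_insert_d oV sK ss dc) !linear_sum; apply: eq_bigr => i _.
  rewrite !linearZ /=; congr (_ *: _).
  transitivity (comor (bs_map (sc_sheaf E k) (dH i \o inc p.+1)) (over V (p := p) (q := q)) e).
    by rewrite bs_comp //; try exact: mY1; exact: dH_smooth.
  transitivity (comor (bs_map (sc_sheaf E k) (inc p \o @dO V p q i)) (over V (p := p) (q := q)) e).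
    by [].
  rewrite bs_comp //; try exact: mY1; last first.
    exact: dO_smooth.
  rewrite gK' comor_res; [|exact: openT| |by []]; last first.
    by have /continuousP := (sinc p).1; apply.
  congr (res _ _ _ _).
  transitivity (pull (insert sK (q := q) \o @dO V p q i) c).
    by rewrite -pull_comp //; first [exact: mY|exact: dO_smooth|exact: insert_smooth].
  rewrite pull_comp //; try first [exact: mY|exact: insert_smooth|exact: dH_smooth].
  by apply: eq_pull => o; exact: esym (dH_insert sK i o).
by exists e.
Qed.

End RowExactness.

(** * The two axes are the nerves of H and G *)

Section NerveStringsComparison.
Context {R : realType}.
Variables (H G : groupoid R) (F : homomorphism H G).
Hypotheses (lH : is_lie H) (lG : is_lie G).

Local Notation F0 := (hom0 F).
Local Notation F1 := (hom1 F).
Local Notation Y := (Y F).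

(** The string on all the vertices, those of [H] first; for p = 0 this is the
    inverse of [of_nerveG]. *)
Definition concat p q n (e : n.+1 = (p + q)%N) (y : Y p q) : nerve G n :=
  string (cod_reindex (fun i => fintype.split (cast_ord e i)) (ycod y)).

Lemma concat_smooth p q n (e : n.+1 = (p + q)%N) : smooth (concat e).
Proof.
apply: (@string_smooth R G lG (Y p q) n
  (fun y u v => yg y (fintype.split (cast_ord e u)) (fintype.split (cast_ord e v)))).
  by move=> y; exact: Y_regular.
by move=> u v; exact: yg_smooth.
Qed.

Lemma face_concat_dH p q n (e : n.+2 = (p.+1 + q)%N) (e' : n.+1 = (p + q)%N)
    (i : 'I_p.+1) (y : Y p.+1 q) :
  face n (cast_ord (esym e) (lshift q i)) (concat e y) = concat e' (dH i y).
Proof.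
rewrite /concat face_string; apply: string_eq => u v; rewrite yg_dH.
have h w : fintype.split (cast_ord e (lift (cast_ord (esym e) (lshift q i)) w)) =
    smap (lift i) id (fintype.split (cast_ord e' w)).
  rewrite (_ : cast_ord e _ = unsplit (smap (lift i) id (fintype.split (cast_ord e' w)))) ?unsplitK //.
  apply: val_inj => /=; case: splitP => k /= ->; rewrite /bump; first by [].
  by have := ltn_ord i; lia.
by rewrite !h.
Qed.

Lemma face_concat_dG p q n (e : n.+2 = (p + q.+1)%N) (e' : n.+1 = (p + q)%N)
    (j : 'I_q.+1) (y : Y p q.+1) :
  face n (cast_ord (esym e) (rshift p j)) (concat e y) = concat e' (dG j y).
Proof.
rewrite /concat face_string; apply: string_eq => u v; rewrite yg_dG.
have h w : fintype.split (cast_ord e (lift (cast_ord (esym e) (rshift p j)) w)) =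
    smap id (lift j) (fintype.split (cast_ord e' w)).
  rewrite (_ : cast_ord e _ = unsplit (smap id (lift j) (fintype.split (cast_ord e' w)))) ?unsplitK //.
  apply: val_inj => /=; case: splitP => k /= ->; rewrite /bump; last by lia.
  by have := ltn_ord k; lia.
by rewrite !h.
Qed.

Definition no_ord T (i : 'I_0) : T.
Proof. by case: i. Defined.

Definition lowerG n (u : 'I_0 + 'I_n) : 'I_n :=
  match u with inl i => no_ord _ i | inr j => j end.
Definition lowerH n (u : 'I_n + 'I_0) : 'I_n :=
  match u with inl i => i | inr j => no_ord _ j end.

Definition of_nerveG n (s : nerve G n) : Y 0 n.+1 :=
  mkY (x := no_ord (obj H)) (cod_reindex (@lowerG n.+1) (edges_codiscrete s)) (fun i => no_ord _ i).

Lemma of_nerveH_subproof n (s : nerve H n) (i : 'I_n.+1) :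
  vert (fun u v => F1 (edges s (@lowerH n.+1 u) (@lowerH n.+1 v))) (inl i) = F0 (vert (edges s) i).
Proof. by have [_ _ hs _ _ _] := homP F; rewrite /vert hs. Qed.

Definition of_nerveH n (s : nerve H n) : Y n.+1 0 :=
  mkY (x := vert (edges s))
    (cod_reindex (@lowerH n.+1) (hom_codiscrete F (edges_codiscrete s)))
    (of_nerveH_subproof s).

Lemma of_nerveG_smooth n : smooth (@of_nerveG n).
Proof.
apply: y_map_smooth => [s|[]//|u v]; first exact: nerve_regular.
exact: edges_smooth.
Qed.

Lemma of_nerveH_smooth n : smooth (@of_nerveH n).
Proof.
apply: y_map_smooth => [s|i|u v]; first exact: nerve_regular.
  by apply: vert_smooth => // u v; exact: edges_smooth.
have [_ s1 _ _ _ _] := homP F.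
apply: (@smooth_comp _ (nerve H n) (arr H) (arr G) (fun s => edges s (lowerH u) (lowerH v)) F1) => //.
exact: edges_smooth.
Qed.

Lemma dG_of_nerveG n j (s : nerve G n.+1) : dG j (of_nerveG s) = of_nerveG (face n j s).
Proof.
apply: yP => [[]//|u v]; rewrite yg_dG.
rewrite -[in RHS](edgesK s) face_string.
transitivity (edges s (lift j (lowerG u)) (lift j (lowerG v))); last first.
  by symmetry; exact: edges_string.
by case: u => [[]//|u]; case: v => [[]//|v].
Qed.

Lemma dH_of_nerveH n i (s : nerve H n.+1) : dH i (of_nerveH s) = of_nerveH (face n i s).
Proof.
have h u v : edges (face n i s) u v = edges s (lift i u) (lift i v).
  by rewrite -{1}(edgesK s) face_string edges_string.
apply: yP => [k|u v]; first by rewrite yx_dH /yx /= /vert h.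
rewrite yg_dH /yg /= h.
by case: u => [u|[]//]; case: v => [v|[]//].
Qed.

Lemma concat_of_nerveG n (s : nerve G n) : concat (erefl : n.+1 = (0 + n.+1)%N) (of_nerveG s) = s.
Proof.
rewrite -[RHS]edgesK /concat; apply: string_eq => u v.
have h (w : 'I_n.+1) : lowerG (fintype.split (cast_ord (erefl : n.+1 = (0 + n.+1)%N) w)) = w.
  by case: splitP => [[]//|j /= wj]; apply: val_inj.
by rewrite /yg /= !h.
Qed.

Lemma concat_of_nerveH n (e : n.+1 = (n.+1 + 0)%N) (s : nerve H n) :
  concat e (of_nerveH s) = nerve_map F n s.
Proof.
rewrite -[in RHS](edgesK s) nerve_map_string /concat; apply: string_eq => u v.
have h (w : 'I_n.+1) : lowerH (fintype.split (cast_ord e w)) = w.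
  by case: splitP => [j /= wj|[]//]; apply: val_inj.
by rewrite /yg /= !h.
Qed.

Lemma of_nerveG_concat n (y : Y 0 n.+1) :
  of_nerveG (concat (erefl : n.+1 = (0 + n.+1)%N) y) = y.
Proof.
apply: yP => [[]//|u v]; transitivity (edges (concat (erefl : n.+1 = (0 + n.+1)%N) y) (lowerG u) (lowerG v)) => //.
rewrite edges_string.
have h (w : 'I_0 + 'I_n.+1) : fintype.split (cast_ord (erefl : n.+1 = (0 + n.+1)%N) (lowerG w)) = w.
  rewrite (_ : cast_ord _ _ = unsplit w) ?unsplitK //; apply: val_inj.
  by case: w => [[]//|j].
by rewrite !h.
Qed.

Section FullyFaithful.
Variable lam : pb_arr F0 -> arr H.
Hypotheses (lamK : cancel (to_pullback F) lam) (lamK' : cancel lam (to_pullback F)).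
Hypothesis slam : smooth lam.

(** Since [F] is faithful, the identities between the lifted arrows can be checked
    in [G]. *)
Lemma liftY_codiscrete p q (y : Y p q) : codiscrete (liftY lam y).
Proof.
have sl i j : src (liftY lam y i j) = yx y i by rewrite /liftY (src_lam lamK').
have tl i j : tgt (liftY lam y i j) = yx y j by rewrite /liftY (tgt_lam lamK').
have hl i j : F1 (liftY lam y i j) = yg y (inl i) (inl j).
  by rewrite /liftY (hom1_lam lamK').
split=> [i j|i j|i j k]; rewrite /vert ?sl ?tl //.
have e : src (liftY lam y j k) = tgt (liftY lam y i j) by rewrite sl tl.
apply: (hom1_faithful lamK).
- by rewrite src_gm // !sl.
- by rewrite tgt_gm // !tl.
- by rewrite hom1_gm // !hl (cod_mul (ycod y)).
Qed.

Definition to_nerveH n (y : Y n.+1 0) : nerve H n := string (liftY_codiscrete y).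

Lemma to_nerveH_smooth n : smooth (@to_nerveH n).
Proof.
apply: (@string_smooth R H lH (Y n.+1 0) n (fun y => liftY lam y)).
  by move=> y; exact: Y_regular.
by move=> u v; exact: liftY_smooth.
Qed.

Lemma of_nerveHK n (s : nerve H n) : to_nerveH (of_nerveH s) = s.
Proof.
rewrite -[RHS]edgesK; apply: string_eq => u v.
have c := edges_codiscrete s.
apply: (hom1_faithful lamK).
- by rewrite /liftY (src_lam lamK') (cod_src c).
- by rewrite /liftY (tgt_lam lamK') (cod_tgt c).
- by rewrite /liftY (hom1_lam lamK').
Qed.

Lemma to_nerveHK n (y : Y n.+1 0) : of_nerveH (to_nerveH y) = y.
Proof.
have h u v : edges (to_nerveH y) u v = liftY lam y u v by rewrite edges_string.
apply: yP => [i|u v].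
  transitivity (vert (edges (to_nerveH y)) i) => //.
  by rewrite /vert h /liftY (src_lam lamK').
transitivity (F1 (edges (to_nerveH y) (lowerH u) (lowerH v))) => //.
rewrite h /liftY (hom1_lam lamK').
by case: u => [u|[]//]; case: v => [v|[]//].
Qed.

End FullyFaithful.
End NerveStringsComparison.

(** * Comparison of the total complexes *)

Section Comparison.
Context {R : realType}.
Variables (H G : groupoid R) (F : homomorphism H G) (E : sheafComplex R).
Hypotheses (lH : is_lie H) (lG : is_lie G).

Local Notation F0 := (hom0 F).
Local Notation F1 := (hom1 F).
Local Notation Y := (Y F).
Local Notation X := (X F E).
Local Notation dX := (D (@dd1 R H G F E) (@dd2 R H G F E) (@dd3 R H G F E)).
Implicit Types (c : forall p q k, X p q k) (u : cochain E G) (w : cochain E H).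

Hypothesis mY : forall p q, (0 < p + q)%N -> manifold (Y p q).

Let mYl p q : manifold (Y p.+1 q). Proof. exact: mY. Qed.
Let mYr p q : manifold (Y p q.+1). Proof. by apply: mY; rewrite addnS. Qed.

Lemma manifold_nerveG n : manifold (nerve G n).
Proof.
apply: (@manifold_diffeo R (nerve G n) (Y 0 n.+1) (@of_nerveG R H G F n)
  (concat (erefl : n.+1 = (0 + n.+1)%N))) => //.
- exact: concat_of_nerveG.
- exact: of_nerveG_concat.
- exact: of_nerveG_smooth.
- exact: concat_smooth.
Qed.

Lemma face_smooth (K : groupoid R) n i : is_lie K -> smooth (@face R K n i).
Proof.
move=> lK; have -> : face n i = fun s : nerve K n.+1 => string (cod_reindex (lift i) (edges_codiscrete s)).
  by apply/funext => s; rewrite -face_string edgesK.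
apply: (@string_smooth R K lK (nerve K n.+1) n (fun s a b => edges s (lift i a) (lift i b))).
  by move=> s; exact: nerve_regular.
by move=> a b; exact: edges_smooth.
Qed.

Section FullyFaithful.
Variable lam : pb_arr F0 -> arr H.
Hypotheses (lamK : cancel (to_pullback F) lam) (lamK' : cancel lam (to_pullback F)).
Hypothesis slam : smooth lam.

Local Notation to_nerveH := (to_nerveH lamK lamK').

Lemma manifold_nerveH n : manifold (nerve H n).
Proof.
apply: (@manifold_diffeo R (nerve H n) (Y n.+1 0) (@of_nerveH R H G F n)
  (@to_nerveH n)) => //.
- exact: of_nerveHK.
- exact: to_nerveHK.
- exact: of_nerveH_smooth.
- exact: to_nerveH_smooth.
Qed.

Let mG := manifold_nerveG.
Let mH := manifold_nerveH.

(** Pullback along [concat] is a map from the complex of [G] to the triple complex;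
    on the axis p = 0 it is the identity, on the axis q = 0 it is induced by [F]. *)
Definition spread u p q k : X p q k :=
  if pselect (0 < p + q)%N is left h
  then pull (concat (prednK h)) (u ((p + q).-1, k)) else 0.

Lemma spreadE u p q n k (e : n.+1 = (p + q)%N) :
  spread u p q k = pull (concat e) (u (n, k)).
Proof.
rewrite /spread; case: pselect => [h|]; last by rewrite -e.
move: (prednK h) => e'; have en : (p + q).-1 = n by rewrite -e.
by subst n; rewrite (Prop_irrelevance e e').
Qed.

Lemma spread00 u k : spread u 0 0 k = 0.
Proof. by rewrite /spread; case: pselect. Qed.

Definition restrictG c : cochain E G := fun nk => pull (@of_nerveG R H G F nk.1) (c 0 nk.1.+1 nk.2).
Definition restrictH c : cochain E H := fun nk => pull (@of_nerveH R H G F nk.1) (c nk.1.+1 0 nk.2).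

(** The extension by zero is a section of [restrictH], not a chain map. *)
Definition extendH w p q k : X p q k :=
  match p return X p q k with
  | 0 => 0
  | p'.+1 => match q return X p'.+1 q k with
    | 0 => pull (@to_nerveH p') (w (p', k))
    | _.+1 => 0
    end
  end.

Lemma big_cast (V : nmodType) n m (e : n = m) (f : 'I_n -> V) :
  \sum_(i < n) f i = \sum_(i < m) f (cast_ord (esym e) i).
Proof. by subst m; apply: eq_bigr => i _; rewrite cast_ord_id. Qed.

(** A string on p + q vertices has p + q faces, of which p remove a vertex of [H] and
    q a vertex of [G]. *)
Lemma spread_D u p q k : dX (spread u) p q k = spread (tot_diff u) p q k.
Proof.
case pq : (p + q)%N => [|n].
  have [p0 q0] : p = 0%N /\ q = 0%N by lia.
  subst p q; rewrite spread00 /D /= add0r; case: k => [|k] //=; first by rewrite addr0.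
  by rewrite spread00 /dd3 linear0 scaler0 addr0.
rewrite (spreadE _ _ (esym pq)) /tot_diff /= linearD; congr (_ + _); last first.
  case: k => [|k] /=; first by rewrite linear0.
  rewrite (spreadE _ _ (esym pq)) linearZ /dd3 /=; congr (_ *: _); first by rewrite pq.
  by apply: sc_d_pull => //; [apply: mY; rewrite pq|exact: concat_smooth].
case: n pq => [|n] pq /=.
  rewrite linear0; have [[p0 q0]|[p0 q0]] : (p = 1 /\ q = 0)%N \/ (p = 0 /\ q = 1)%N by lia.
    by subst p q; rewrite /= spread00 /dd1 big1 ?add0r // => i _; rewrite linear0 scaler0.
  by subst p q; rewrite /= spread00 /dd2 big1 ?add0r // => i _; rewrite linear0 scaler0.
have e := esym pq; rewrite (Prop_irrelevance (esym pq) e).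
rewrite /delta linear_sum (big_cast e) big_split_ord /=; congr (_ + _).
  case: p e pq => [|p] e pq /=; first by rewrite big_ord0.
  apply: eq_bigr => i _; rewrite linearZ; congr (_ *: _).
  have e' : n.+1 = (p + q)%N by lia.
  rewrite (spreadE _ _ e').
  apply: (@pull_square _ E k _ _ _ _ (dH i) (concat e') (concat e)
     (face n (cast_ord (esym e) (lshift q i)))) => //; try exact: concat_smooth; try exact: dH_smooth;
    try exact: face_smooth; try (by apply: mY; rewrite -?e').
  by move=> y; exact: esym (face_concat_dH e e' i y).
case: q e pq => [|q] e pq /=; first by rewrite big_ord0.
apply: eq_bigr => i _; rewrite linearZ; congr (_ *: _).
have e' : n.+1 = (p + q)%N by lia.
rewrite (spreadE _ _ e').
apply: (@pull_square _ E k _ _ _ _ (dG i) (concat e') (concat e)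
   (face n (cast_ord (esym e) (rshift p i)))) => //; try exact: concat_smooth; try exact: dG_smooth;
  try exact: face_smooth; try (by apply: mY; rewrite -?e').
by move=> y; exact: esym (face_concat_dG e e' i y).
Qed.

Lemma restrictG_D c nk : (forall k, c 0 0 k = 0) -> restrictG (dX c) nk = tot_diff (restrictG c) nk.
Proof.
case: nk => n k c0; rewrite /restrictG /tot_diff /D /= add0r linearD; congr (_ + _); last first.
  case: k => [|k] /=; first by rewrite linear0.
  rewrite linearZ; congr (_ *: _).
  by symmetry; apply: sc_d_pull => //; exact: of_nerveG_smooth.
case: n => [|n] /=; first by rewrite c0 /dd2 big1 ?linear0 // => i _; rewrite linear0 scaler0.
rewrite /dd2 /delta linear_sum; apply: eq_bigr => i _.
rewrite add0n linearZ; congr (_ *: _).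
apply: (@pull_square _ E k _ _ _ _ (@of_nerveG R H G F n.+1) (dG i) (face n i)
   (@of_nerveG R H G F n)) => //;
  try exact: of_nerveG_smooth; try exact: dG_smooth; try exact: face_smooth.
by move=> s; exact: dG_of_nerveG.
Qed.

Lemma restrictH_D c nk : (forall k, c 0 0 k = 0) -> restrictH (dX c) nk = tot_diff (restrictH c) nk.
Proof.
case: nk => n k c0; rewrite /restrictH /tot_diff /D /= addr0 linearD; congr (_ + _); last first.
  case: k => [|k] /=; first by rewrite linear0.
  rewrite /dd3 linearZ addn0; congr (_ *: _).
  by symmetry; apply: sc_d_pull => //; exact: of_nerveH_smooth.
case: n => [|n] /=; first by rewrite c0 /dd1 big1 ?linear0 // => i _; rewrite linear0 scaler0.
rewrite /dd1 /delta linear_sum; apply: eq_bigr => i _.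
rewrite linearZ; congr (_ *: _).
apply: (@pull_square _ E k _ _ _ _ (@of_nerveH R H G F n.+1) (dH i) (face n i)
   (@of_nerveH R H G F n)) => //;
  try exact: of_nerveH_smooth; try exact: dH_smooth; try exact: face_smooth.
by move=> s; exact: dH_of_nerveH.
Qed.

Lemma restrictG_spread u nk : restrictG (spread u) nk = u nk.
Proof.
case: nk => n k; rewrite /restrictG /= (spreadE _ _ (erefl : n.+1 = (0 + n.+1)%N)).
by apply: pull_retract => //; [exact: of_nerveG_smooth|exact: concat_smooth|exact: concat_of_nerveG].
Qed.

Lemma restrictH_spread u nk : restrictH (spread u) nk = induced_map F u nk.
Proof.
case: nk => n k; have e : n.+1 = (n.+1 + 0)%N by rewrite addn0.
rewrite /restrictH /= (spreadE _ _ e) pull_comp //; last by exact: concat_smooth.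
  by apply: eq_pull => s; exact: concat_of_nerveH.
exact: of_nerveH_smooth.
Qed.

Lemma restrictH_extendH w nk : restrictH (extendH w) nk = w nk.
Proof.
case: nk => n k; apply: pull_retract => //; [exact: of_nerveH_smooth|exact: to_nerveH_smooth|].
exact: of_nerveHK.
Qed.

Lemma restrictH_eq0 c : (forall k, c 0 0 k = 0) -> (forall nk, restrictH c nk = 0) ->
  forall p k, c p 0 k = 0.
Proof.
move=> c0 h [|p] k //; have /(congr1 (@pull R E k _ _ (@to_nerveH p))) := h (p, k).
rewrite /restrictH /= linear0 pull_retract //; [exact: to_nerveH_smooth|exact: of_nerveH_smooth|exact: to_nerveHK].
Qed.

Lemma restrictG_eq0 c : (forall k, c 0 0 k = 0) -> (forall nk, restrictG c nk = 0) ->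
  forall q k, c 0 q k = 0.
Proof.
move=> c0 h [|q] k //.
have <- : pull (@concat R H G F 0 q.+1 q erefl) (pull (@of_nerveG R H G F q) (c 0 q.+1 k)) = 0.
  by have := h (q, k); rewrite /restrictG /= => ->; rewrite linear0.
by rewrite pull_retract //; [exact: concat_smooth|exact: of_nerveG_smooth|exact: of_nerveG_concat].
Qed.

Hypothesis local_section : forall y : obj G,
  exists (V : set (obj G)) (s : obj G -> fibre_product (@src R G) F0),
  [/\ open V, V y, forall y, V y -> tgt (fp1 (s y)) = y & forall y, V y -> smooth_at s y].

Let tc : triple_complex (@dd1 R H G F E) (@dd2 R H G F E) (@dd3 R H G F E) :=
  mixed_triple_complex E lH lG mY.

Lemma D00 c k : (forall k, c 0 0 k = 0) -> dX c 0 0 k = 0.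
Proof.
move=> c0; rewrite /D /= !add0r; case: k => [|k] //=.
by rewrite c0 /dd3 linear0 scaler0.
Qed.

Lemma tot_diff0 (K : groupoid R) : tot_diff (0 : cochain E K) = 0.
Proof. by have := tot_diff_is_linear (-1) (0 : cochain E K) 0; rewrite scaler0 addr0 scaleN1r addNr. Qed.

(** A description of coboundaries uniform in the degree, degree 0 included. *)
Lemma is_coboundaryP (K : groupoid R) m (c : cochain E K) : is_coboundary m c <->
  exists b : cochain E K, (forall nk, tot_diff b nk = c nk) /\
    forall n k, (n + k).+1 != m -> b (n, k) = 0.
Proof.
case: m => [|m]; split.
- by move=> ->; exists 0; split=> // nk; rewrite tot_diff0.
- case=> b [Db b0]; have {}b0 : b = 0.
    by apply: functional_extensionality_dep => -[n k]; exact: b0.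
  by apply: functional_extensionality_dep => nk; rewrite -Db b0 tot_diff0.
- by case=> b bd ->; exists b; split=> // n k; exact: bd.
- by case=> b [Db bd]; exists b => //; apply: functional_extensionality_dep => nk; rewrite Db.
Qed.

Lemma induced_map_tot_diff u : induced_map F (tot_diff u) = tot_diff (induced_map F u).
Proof.
have <- : restrictH (spread u) = induced_map F u.
  by apply: functional_extensionality_dep => nk; exact: restrictH_spread.
apply: functional_extensionality_dep => nk.
rewrite -restrictH_D; last exact: spread00.
by rewrite -restrictH_spread /restrictH spread_D.
Qed.

Lemma induced_map_cocycle m u : is_cocycle m u -> is_cocycle m (induced_map F u).
Proof.
move=> [ud uD]; split=> [n k ne|]; first by rewrite /induced_map /= ud // linear0.
rewrite -induced_map_tot_diff uD; apply: functional_extensionality_dep => nk.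
exact: linear0.
Qed.

Lemma induced_map_coboundary m u : is_coboundary m u -> is_coboundary m (induced_map F u).
Proof.
move=> /is_coboundaryP[b [Db bd]]; apply/is_coboundaryP; exists (induced_map F b).
split=> [nk|n k ne]; last by rewrite /induced_map /= bd // linear0.
rewrite -induced_map_tot_diff; congr (induced_map F _ nk).
by apply: functional_extensionality_dep => nk'; exact: Db.
Qed.

Lemma spread_deg m u : in_degree m u -> deg m.+1 (spread u).
Proof.
move=> ud p q k; case pq : (p + q)%N => [|n] ne.
  by rewrite /spread; case: pselect => // h; exfalso; lia.
by rewrite (spreadE _ _ (esym pq)) ud ?linear0 //; move: ne; lia.
Qed.

Lemma spread_cocycle u p q k : tot_diff u = 0 -> dX (spread u) p q k = 0.
Proof.
move=> uD; rewrite spread_D uD /spread; case: pselect => // h; exact: linear0.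
Qed.

Lemma extendH_deg m w : in_degree m w -> deg m.+1 (extendH w).
Proof.
move=> wd [|p] [|q] k ne //=; rewrite wd ?linear0 //.
by move: ne; rewrite addn0; lia.
Qed.

(** The kernel of the restriction to [H] is acyclic. *)
Lemma rows_exact N c : (forall p q k, dX c p q k = 0) -> deg N c ->
  (forall p k, c p 0 k = 0) ->
  exists b, [/\ forall p q k, dX b p q k = c p q k, forall p k, b p 0 k = 0 &
    forall p q k, (p + q + k).+1 != N -> b p q k = 0].
Proof.
apply: exact_off_axis; first exact: tc.
- by move=> q k c'; exact: row_exact0.
- by move=> p q k c'; exact: row_exact.
Qed.

(** The kernel of the restriction to [G] is acyclic. *)
Lemma columns_exact N c : (forall p q k, dX c p q k = 0) -> deg N c ->
  (forall q k, c 0 q k = 0) ->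
  exists b, [/\ forall p q k, dX b p q k = c p q k, forall q k, b 0 q k = 0 &
    forall p q k, (p + q + k).+1 != N -> b p q k = 0].
Proof.
apply: exact_off_other_axis; first exact: tc.
- by move=> p k c'; exact: column_exact0.
- by move=> p q k c'; exact: column_exact.
Qed.

(** Extend [w] by zero to [W]. The restriction of [D W] to [H] vanishes, so [D W] is
    the differential of some [b] that vanishes on the axis of [H], and [Z = W - b] is
    a cocycle extending [w]; let [u] be its restriction to [G]. Then [Z] and
    [spread u] have the same restriction to [G], hence differ by a coboundary; on the
    axis of [H] this says that [w] and [F^* u] do. *)
Lemma induced_map_surjective m w : is_cocycle m w ->
  exists u, is_cocycle m u /\ is_coboundary m (induced_map F u - w).
Proof.
move=> [wd wD]; pose W := extendH w.
have Wd : deg m.+1 W by exact: extendH_deg.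
have DW0 : forall p k, dX W p 0 k = 0.
  apply: restrictH_eq0 => [k|nk]; first exact: D00.
  rewrite restrictH_D // (_ : restrictH W = w) ?wD //.
  by apply: functional_extensionality_dep => nk'; exact: restrictH_extendH.
have [p q k||b [Db b0 bd]] := @rows_exact m.+2 (dX W) _ _ DW0; first by rewrite (DD tc).
  exact: (deg_D tc).
pose Z p q k := W p q k - b p q k.
have DZ p q k : dX Z p q k = 0 by rewrite (DB tc) Db subrr.
have Z0 k : Z 0 0 k = 0 by rewrite /Z b0 subr0.
have Zd : deg m.+1 Z by move=> p q k ne; rewrite /Z Wd // bd ?subr0.
pose u := restrictG Z.
have uD : tot_diff u = 0.
  apply: functional_extensionality_dep => nk; rewrite -restrictG_D // /restrictG DZ.
  exact: linear0.
have ud : in_degree m u by move=> n k ne; rewrite /u /restrictG /= Zd ?linear0.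
exists u; split; first by [].
pose c p q k := spread u p q k - Z p q k.
have cG : forall q k, c 0 q k = 0.
  apply: restrictG_eq0 => [k|nk]; first by rewrite /c spread00 Z0 subr0.
  by rewrite /restrictG linearB -[X in X - _]/(restrictG (spread u) nk) restrictG_spread subrr.
have [p q k|p q k ne|e [De e0 ed]] := @columns_exact m.+1 c _ _ cG.
- by rewrite (DB tc) spread_cocycle // DZ subr0.
- by rewrite /c Zd // (spread_deg ud) // subr0.
apply/is_coboundaryP; exists (restrictH e); split=> [nk|n k ne].
  rewrite -restrictH_D; last by move=> k; exact: e0.
  rewrite /restrictH De /c /Z b0 subr0 linearB; congr (_ - _).
    exact: restrictH_spread.
  exact: restrictH_extendH.
by rewrite /restrictH /= ed ?linear0 //; move: ne; lia.
Qed.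

(** If [F^* u] is the coboundary of [v], then [spread u] minus the differential of
    the extension of [v] vanishes on the axis of [H], hence is a coboundary; on the
    axis of [G], where the extension vanishes, it is [u]. *)
Lemma induced_map_injective m u : is_cocycle m u ->
  is_coboundary m (induced_map F u) -> is_coboundary m u.
Proof.
move=> [ud uD] /is_coboundaryP[v [Dv vd]].
pose V := extendH v.
have Vd p q k : (p + q + k)%N != m -> V p q k = 0.
  by case: p => [|p] //; case: q => [|q] //= ne; rewrite vd ?linear0 //; move: ne; rewrite addn0.
have V0 k : V 0 0 k = 0 by [].
pose c p q k := spread u p q k - dX V p q k.
have c0 k : c 0 0 k = 0 by rewrite /c spread00 D00 // subr0.
have cH : forall p k, c p 0 k = 0.
  apply: restrictH_eq0 => // nk.
  rewrite /restrictH linearB -[X in X - _]/(restrictH (spread u) nk) restrictH_spread.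
  rewrite -[X in _ - X]/(restrictH (dX V) nk) restrictH_D // (_ : restrictH V = v) ?Dv ?subrr //.
  by apply: functional_extensionality_dep => nk'; exact: restrictH_extendH.
have [p q k|p q k ne|b [Db b0 bd]] := @rows_exact m.+1 c _ _ cH.
- by rewrite (DB tc) spread_cocycle // (DD tc) // subr0.
- by rewrite /c (spread_deg ud) // (@deg_D _ _ _ _ tc m V) ?subr0 //.
apply/is_coboundaryP; exists (restrictG b); split=> [nk|n k ne].
  rewrite -restrictG_D; last by move=> k; exact: b0.
  rewrite /restrictG Db /c linearB.
  rewrite -[X in X - _]/(restrictG (spread u) nk) restrictG_spread.
  rewrite -[X in _ - X]/(restrictG (dX V) nk) restrictG_D // (_ : restrictG V = 0) ?tot_diff0 ?subr0 //.
  by apply: functional_extensionality_dep => nk'; exact: linear0.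
by rewrite /restrictG /= bd ?linear0.
Qed.

End FullyFaithful.
End Comparison.

(** * Maps between quotients, and the theorem *)

Section Quotients.
Local Open Scope quotient_scope.
Context {R : realType}.

Section LinearQuotient.
Variables (V V' : lmodType R) (S : {pred V}) (S' : {pred V'}).
Hypotheses (SP : submod_closed S) (SP' : submod_closed S').

Lemma lclass_surj (q : lquot SP) : exists v, lclass SP v = q.
Proof. by exists (repr (q : {ideal_quot (lquot_zmodClosed SP)})); exact: reprK. Qed.

Lemma lquot_map (f : V -> V') : linear f -> (forall v, v \in S -> f v \in S') ->
  exists Phi : {linear lquot SP -> lquot SP'}, forall v, Phi (lclass SP v) = lclass SP' (f v).
Proof.
move=> lf fS.
pose g q := lclass SP' (f (projT1 (cid (lclass_surj q)))).
have gE v : g (lclass SP v) = lclass SP' (f v).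
  rewrite /g; case: cid => v' /= /lclass_eq vv'; apply/lclass_eq.
  have -> : f v' - f v = f (v' - v) by rewrite [in RHS](addrC v') -[in RHS]scaleN1r lf scaleN1r addrC.
  exact: fS.
have lg : linear g.
  move=> a q q'; have [v <-] := lclass_surj q; have [v' <-] := lclass_surj q'.
  by rewrite -lclass_is_linear !gE lf lclass_is_linear.
pose Phi : {linear lquot SP -> lquot SP'} :=
  HB.pack g (GRing.isLinear.Build R (lquot SP) (lquot SP') *:%R g lg).
by exists Phi.
Qed.

End LinearQuotient.
End Quotients.

Theorem theorem1p1 (R : realType) (H G : lieGroupoid R) (F : homomorphism H G)
  (E : sheafComplex R) :
  weak_equivalence F ->
  forall m : nat,
  exists Phi : {linear cohomology E G m -> cohomology E H m},
    (forall z : cocycle E G m,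
      exists w : cocycle E H m,
        cocycle_val w = induced_map F (cocycle_val z) /\
        Phi (cohomology_class z) = cohomology_class w) /\
    bijective Phi.
Proof.
move=> [surj sub [_ _ [_ [lam [lamK lamK' slam]]]]] m.
have lH := lieP H; have lG := lieP G.
have mY p q : (0 < p + q)%N -> manifold (Y F p q).
  by move=> pq; exact: (manifold_Y lH lG lamK lamK' slam pq).
have local_section (y : obj G) : exists (V : set (obj G))
    (s : obj G -> fibre_product (@src R G) (hom0 F)),
    [/\ open V, V y, forall y, V y -> tgt (fp1 (s y)) = y & forall y, V y -> smooth_at s y].
  have [z _ <-] : range (fun z : fibre_product (@src R G) (hom0 F) => tgt (sval z).1) y.
    by rewrite surj.
  by have [V [s [oV Vz sK ss]]] := submersion_section z sub; exists V, s.
have fP (z : cocycle E G m) : induced_map F z \in @cocycle_pred R E H m.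
  apply/asboolP; apply: (induced_map_cocycle lH lG mY lamK lamK' slam).
  exact/asboolP/cocycle_valP.
pose f z := Cocycle (fP z).
have lf : linear f.
  move=> a z z'; apply: val_inj; apply: functional_extensionality_dep => nk.
  exact: linearP.
have [z|Phi PhiE] := @lquot_map R _ _ _ _ (@coboundary_submod_closed R E G m)
    (@coboundary_submod_closed R E H m) f lf.
  move=> /asboolP zb; apply/asboolP.
  exact: (induced_map_coboundary lH lG mY lamK lamK' slam).
exists Phi; split=> [z|]; first by exists (f z); split; last exact: PhiE.
have inj : injective Phi.
  move=> q q'; have [z <-] := lclass_surj q; have [z' <-] := lclass_surj q'.
  rewrite !PhiE => /lclass_eq/asboolP h; apply/lclass_eq/asboolP.
  apply: (induced_map_injective lH lG mY lamK lamK' slam local_section).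
    exact/asboolP/cocycle_valP.
  have -> // : induced_map F (cocycle_val (z - z')) = cocycle_val (f z - f z').
  by apply: functional_extensionality_dep => nk; exact: linearB.
have onto q : exists q', Phi q' = q.
  have [w <-] := lclass_surj q.
  have /asboolP wP := cocycle_valP w.
  have [u [/asboolP uP uw]] :=
    induced_map_surjective lH lG mY lamK lamK' slam local_section wP.
  by exists (cohomology_class (Cocycle uP)); rewrite PhiE; apply/lclass_eq/asboolP.
have [g gK] := choice onto.
by exists g => // q; apply: inj; rewrite gK.
Qed.
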